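(* Let $\Phi_1\in\mathcal C(A_0B_0,A_1B_1)$, $\Phi_2\in\mathcal C(A'_0B'_0,A'_1B'_1)$ and $\epsilon\ge0$. The following are equivalent. (i) $\delta_{LOCC}(\Phi_1\|\Phi_2)\le\epsilon$. (ii) For all finite-dimensional systems $R^A_0,R^A_1,R^B_0,R^B_1$ and every $\rho\in\mathfrak S(R^A_0R^B_0R^A_1R^B_1)$, $$\sup_{\Theta\in\mathcal C_2^{LOCC}(A'B',R^AR^B)}\langle\rho,\Theta(\Phi_2)\rangle\le\sup_{\Theta\in\mathcal C_2^{LOCC}(AB,R^AR^B)}\langle\rho,\Theta(\Phi_1)\rangle+\frac{\epsilon}{2}\|\rho\|^\diamond_{R^A_1R^B_1|R^A_0R^B_0}.$$ (iii) For all such systems and every ensemble $\mathcal E$ on $R^A_0R^B_0R^A_1R^B_1$, $$P^{LOCC}_{\Phi_2}(\mathcal E)\le P^{LOCC}_{\Phi_1}(\mathcal E)+\frac{\epsilon}{2}P_{\rm succ}(\mathcal E).$$ Moreover, (i) is also equivalent to (ii), resp. (iii), required only for $R^A_0=A'_0$, $R^A_1=A'_1$, $R^B_0=B'_0$, $R^B_1=B'_1$.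
   Context: Finite-dimensional systems; $\mathcal C(X,Y)$ channels; $\|\cdot\|_\diamond$ diamond norm. $\mathcal C_{LOCC}(X^A|X^B,Y^A|Y^B)$ denotes channels from $X^AX^B$ to $Y^AY^B$ implementable by local operations and classical communication between party $A$ (holding $X^A$, $Y^A$) and party $B$; $\mathcal M_{LOCC}$ denotes LOCC measurements. An LOCC superchannel $\Theta\in\mathcal C_2^{LOCC}(AB,A'B')$ (from bipartite channels $A_0B_0\to A_1B_1$ to bipartite channels $A'_0B'_0\to A'_1B'_1$) is given by ancillas $U^A,U^B$, $\Theta_{\rm pre}\in\mathcal C_{LOCC}(A'_0|B'_0,U^AA_0|B_0U^B)$ and $\Theta_{\rm post}\in\mathcal C_{LOCC}(U^AA_1|B_1U^B,A'_1|B'_1)$, acting by $\Theta(\Phi)=\Theta_{\rm post}\circ(\mathrm{id}_{U^AU^B}\otimes\Phi)\circ\Theta_{\rm pre}$. $\delta_{LOCC}(\Phi_1\|\Phi_2)=\inf_{\Theta\in\mathcal C_2^{LOCC}(AB,A'B')}\|\Theta(\Phi_1)-\Phi_2\|_\diamond$. For $X\in\mathcal B_h(S_0S_1)$ and $\phi\in\mathcal L(S_0,S_1)$, $\langle X,\phi\rangle={\rm Tr}[XC_{\phi^*}]$ with Choi matrix $C_\psi=(\psi\otimes\mathrm{id})(|I\rangle\rangle\langle\langle I|)$ and $\phi^*$ the adjoint; $\|\rho\|^\diamond_{S_1|S_0}=\max_{\alpha\in\mathcal C(S_0,S_1)}\langle\rho,\alpha\rangle$. Ensembles $\mathcal E=\{\lambda_i,\rho_i\}_{i=1}^k$,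 $P_{\rm succ}(\mathcal E,M)=\sum_i\lambda_i{\rm Tr}[\rho_iM_i]$, $P_{\rm succ}(\mathcal E)=\max_MP_{\rm succ}(\mathcal E,M)$. For $\Phi\in\mathcal C(A''_0B''_0,A''_1B''_1)$ and $\mathcal E=\{\lambda_i,\rho_i\}_{i=1}^k$ on $R^A_0R^B_0R^A_1R^B_1$, $P^{LOCC}_\Phi(\mathcal E)$ is the supremum over ancillas $U^A,U^B$, $\alpha\in\mathcal C_{LOCC}(R^A_0|R^B_0,U^AA''_0|B''_0U^B)$ and $k$-outcome LOCC measurements $M$ with respect to the cut $U^AA''_1R^A_1|R^B_1B''_1U^B$ of $\sum_i\lambda_i{\rm Tr}\big[\big(((\mathrm{id}_{U^AU^B}\otimes\Phi)\circ\alpha)\otimes\mathrm{id}_{R^A_1R^B_1}\big)(\rho_i)M_i\big]$. *)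

(* Defs.v *)
(* MathComp + MathComp-Analysis (reals/ereal) + real_closed complex.
   Finite-dimensional quantum systems are finite types (their basis labels);
   operators are functions  I -> J -> C  with C = R[i], R : realType.
   Composite systems are product types; a bipartite system X^A X^B is XA * XB. *)
From mathcomp Require Import all_boot all_algebra.
From mathcomp.real_closed Require Import complex.
From mathcomp Require Import classical_sets reals ereal.
From Stdlib Require Import ClassicalEpsilon.

Set Implicit Arguments.
Unset Strict Implicit.
Unset Printing Implicit Defensive.
Import GRing.Theory Num.Theory.
Local Open Scope ring_scope.

Section QDefs.
Variable R : realType.
Local Notation C := (R[i]).

(* operators from the space with basis J to the space with basis I *)
Definition mx (I J : finType) := I -> J -> C.
Definition Lmap (I J : finType) := mx I I -> mx J J.
Arguments mx (I J)%_type.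
Arguments Lmap (I J)%_type.

Definition mmul (I J K : finType) (X : mx I J) (Y : mx J K) : mx I K :=
  fun i k => \sum_(j : J) X i j * Y j k.
Definition madj (I J : finType) (X : mx I J) : mx J I :=
  fun j i => Num.conj (X i j).
Definition mtr (I : finType) (X : mx I I) : C := \sum_(i : I) X i i.
Definition mid (I : finType) : mx I I := fun i j => (i == j)%:R.

Definition psd (I : finType) (X : mx I I) : Prop :=
  forall v : I -> C, 0 <= \sum_(i : I) \sum_(j : I) Num.conj (v i) * X i j * v j.
Definition state (I : finType) (X : mx I I) : Prop := psd X /\ mtr X = 1.

(* relabelling of tensor factors (conjugation by a permutation unitary
   when f is a bijection) *)
Definition relabel (I J : finType) (f : I -> J) (X : mx J J) : mx I I :=
  fun i i' => X (f i) (f i').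

(* id_K (x) Phi  (ancilla on the left) and  Phi (x) id_K (ancilla on the right) *)
Definition idt (K I J : finType) (Phi : Lmap I J) : Lmap (K * I) (K * J) :=
  fun X p q => Phi (fun i i' => X (p.1, i) (q.1, i')) p.2 q.2.
Definition tid (I J K : finType) (Phi : Lmap I J) : Lmap (I * K) (J * K) :=
  fun X p q => Phi (fun i i' => X (i, p.2) (i', q.2)) p.1 q.1.

Arguments idt K%_type {I J}.
Arguments tid {I J} K%_type.
Arguments mid I%_type : clear implicits.

Definition lin_map (I J : finType) (Phi : Lmap I J) : Prop :=
  forall (a : C) (X Y : mx I I),
    Phi (fun i j => a * X i j + Y i j) = (fun i j => a * Phi X i j + Phi Y i j).
Definition cp (I J : finType) (Phi : Lmap I J) : Prop :=
  forall (K : finType) (X : mx (K * I) (K * I)), psd X -> psd (idt K Phi X).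
Definition tp (I J : finType) (Phi : Lmap I J) : Prop :=
  forall X : mx I I, mtr (Phi X) = mtr X.
Definition channel (I J : finType) (Phi : Lmap I J) : Prop :=
  [/\ lin_map Phi, cp Phi & tp Phi].

Definition instrument (O I J : finType) (E : O -> Lmap I J) : Prop :=
  (forall o, lin_map (E o) /\ cp (E o)) /\
  tp (fun X i j => \sum_(o : O) E o X i j).

(* Finite-round LOCC instruments from XA|XB to YA|YB (outcome set O):
   either nothing is done, or one party applies a local instrument,
   broadcasts its outcome x, and the protocol continues with an LOCC
   instrument depending on x. *)
Inductive locc_inst : forall (XA XB YA YB O : finType),
    (O -> Lmap (XA * XB) (YA * YB)) -> Prop :=
| locc_nil (XA XB : finType) :
    locc_inst (fun (_ : unit) (X : mx (XA * XB) (XA * XB)) => X)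
| locc_stepA (XA XB ZA YA YB O1 : finType) (E : O1 -> Lmap XA ZA)
    (O2 : O1 -> finType)
    (F : forall x : O1, O2 x -> Lmap (ZA * XB) (YA * YB)) :
    instrument E -> (forall x, locc_inst (F x)) ->
    locc_inst (fun (p : {x : O1 & O2 x}) X =>
                 F (tag p) (tagged p) (tid XB (E (tag p)) X))
| locc_stepB (XA XB ZB YA YB O1 : finType) (E : O1 -> Lmap XB ZB)
    (O2 : O1 -> finType)
    (F : forall x : O1, O2 x -> Lmap (XA * ZB) (YA * YB)) :
    instrument E -> (forall x, locc_inst (F x)) ->
    locc_inst (fun (p : {x : O1 & O2 x}) X =>
                 F (tag p) (tagged p) (idt XA (E (tag p)) X)).

Definition locc_channel (XA XB YA YB : finType)
    (Phi : Lmap (XA * XB) (YA * YB)) : Prop :=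
  exists (O : finType) (G : O -> Lmap (XA * XB) (YA * YB)),
    locc_inst G /\ forall X, Phi X = (fun i j => \sum_(o : O) G o X i j).

Definition povm (k : nat) (I : finType) (M : 'I_k -> mx I I) : Prop :=
  (forall i, psd (M i)) /\ (fun a b => \sum_(i < k) M i a b) = mid I.
Definition locc_meas (k : nat) (XA XB : finType)
    (M : 'I_k -> mx (XA * XB) (XA * XB)) : Prop :=
  povm M /\
  exists (O : finType) (G : O -> Lmap (XA * XB) (unit * unit)) (f : O -> 'I_k),
    locc_inst G /\
    forall (i : 'I_k) (X : mx (XA * XB) (XA * XB)),
      mtr (mmul X (M i)) = \sum_(o : O | f o == i) mtr (G o X).

(* Action of the LOCC superchannel given by ancillas UA, UB,
   pre in C_LOCC(A'0|B'0, UA A0|B0 UB) and post in C_LOCC(UA A1|B1 UB, A'1|B'1):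
   Theta(Phi) = post o (id_{UA UB} (x) Phi) o pre   (with the obvious
   reorderings of tensor factors). *)
Definition super_apply (UA UB A0 B0 A1 B1 A0' B0' A1' B1' : finType)
    (pre : Lmap (A0' * B0') ((UA * A0) * (B0 * UB)))
    (post : Lmap ((UA * A1) * (B1 * UB)) (A1' * B1'))
    (Phi : Lmap (A0 * B0) (A1 * B1)) : Lmap (A0' * B0') (A1' * B1') :=
  fun X =>
    post (relabel (fun p : (UA * A1) * (B1 * UB) =>
                     ((p.1.1, p.2.2), (p.1.2, p.2.1)))
            (idt (UA * UB) Phi
               (relabel (fun q : (UA * UB) * (A0 * B0) =>
                           ((q.1.1, q.2.1), (q.2.2, q.1.2)))
                  (pre X)))).

Definition locc_super_image (A0 B0 A1 B1 A0' B0' A1' B1' : finType)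
    (Phi : Lmap (A0 * B0) (A1 * B1)) (Psi : Lmap (A0' * B0') (A1' * B1')) : Prop :=
  exists (UA UB : finType)
    (pre : Lmap (A0' * B0') ((UA * A0) * (B0 * UB)))
    (post : Lmap ((UA * A1) * (B1 * UB)) (A1' * B1')),
    [/\ locc_channel pre, locc_channel post & Psi = super_apply pre post Phi].

Definition psd_sqrt (I : finType) (P : mx I I) : mx I I :=
  epsilon (inhabits (fun _ _ => 0) : inhabited (mx I I))
          (fun Q => psd Q /\ mmul Q Q = P).
Definition trnorm (I J : finType) (X : mx I J) : R :=
  complex.Re (mtr (psd_sqrt (mmul (madj X) X))).

Definition dnorm (I J : finType) (Psi : Lmap I J) : \bar R :=
  ereal_sup [set (trnorm (idt I Psi X))%:E | X in
             [set X : mx (I * I) (I * I) | trnorm X <= 1]].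

Definition map_sub (I J : finType) (Phi Psi : Lmap I J) : Lmap I J :=
  fun X i j => Phi X i j - Psi X i j.

Definition delta_locc (A0 B0 A1 B1 A0' B0' A1' B1' : finType)
    (Phi1 : Lmap (A0 * B0) (A1 * B1)) (Phi2 : Lmap (A0' * B0') (A1' * B1')) : \bar R :=
  ereal_inf [set dnorm (map_sub Psi Phi2) | Psi in locc_super_image Phi1].

Definition hs_adj (I J : finType) (phi : Lmap I J) : Lmap J I :=
  epsilon (inhabits (fun _ => fun _ _ => 0) : inhabited (Lmap J I))
    (fun psi => forall (A : mx J J) (B : mx I I),
        mtr (mmul (madj A) (phi B)) = mtr (mmul (madj (psi A)) B)).

Definition maxent (S : finType) : mx (S * S) (S * S) :=
  fun p q => ((p.1 == p.2) && (q.1 == q.2))%:R.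
Arguments maxent S%_type : clear implicits.
Definition choi (S1 S0 : finType) (psi : Lmap S1 S0) : mx (S0 * S1) (S0 * S1) :=
  tid S1 psi (maxent S1).

(* <X, phi> = Tr[X C_{phi^*}]  (real part; it is real for Hermitian X) *)
Definition hs_pair (S0 S1 : finType) (X : mx (S0 * S1) (S0 * S1)) (phi : Lmap S0 S1) : R :=
  complex.Re (mtr (mmul X (choi (hs_adj phi)))).

Definition cond_dnorm (S0 S1 : finType) (rho : mx (S0 * S1) (S0 * S1)) : \bar R :=
  ereal_sup [set (hs_pair rho alpha)%:E | alpha in [set a : Lmap S0 S1 | channel a]].

Definition sup_pair (A0 B0 A1 B1 RA0 RB0 RA1 RB1 : finType)
    (rho : mx ((RA0 * RB0) * (RA1 * RB1)) ((RA0 * RB0) * (RA1 * RB1)))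
    (Phi : Lmap (A0 * B0) (A1 * B1)) : \bar R :=
  ereal_sup [set (hs_pair rho Psi)%:E | Psi in
             @locc_super_image A0 B0 A1 B1 RA0 RB0 RA1 RB1 Phi].

Definition ensemble (k : nat) (S : finType) (lam : 'I_k -> R) (rho : 'I_k -> mx S S) : Prop :=
  [/\ forall i, 0 <= lam i, \sum_(i < k) lam i = 1 & forall i, state (rho i)].

Definition psucc_with (k : nat) (S : finType) (lam : 'I_k -> R) (rho : 'I_k -> mx S S)
    (M : 'I_k -> mx S S) : R :=
  \sum_(i < k) lam i * complex.Re (mtr (mmul (rho i) (M i))).

Definition psucc (k : nat) (S : finType) (lam : 'I_k -> R) (rho : 'I_k -> mx S S) : \bar R :=
  ereal_sup [set (psucc_with lam rho M)%:E | M in [set M : 'I_k -> mx S S | povm M]].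

Definition p_locc (A0 B0 A1 B1 RA0 RB0 RA1 RB1 : finType)
    (Phi : Lmap (A0 * B0) (A1 * B1)) (k : nat) (lam : 'I_k -> R)
    (rho : 'I_k -> mx ((RA0 * RB0) * (RA1 * RB1)) ((RA0 * RB0) * (RA1 * RB1))) : \bar R :=
  ereal_sup [set x | exists (UA UB : finType)
      (alpha : Lmap (RA0 * RB0) ((UA * A0) * (B0 * UB)))
      (M : 'I_k -> mx (((UA * A1) * RA1) * ((RB1 * B1) * UB))
                      (((UA * A1) * RA1) * ((RB1 * B1) * UB))),
      [/\ locc_channel alpha, locc_meas M &
      x = (\sum_(i < k) lam i * complex.Re (mtr (mmul
            (relabel (fun p : ((UA * A1) * RA1) * ((RB1 * B1) * UB) =>
                        (((p.1.1.1, p.2.2), (p.1.1.2, p.2.1.2)), (p.1.2, p.2.1.1)))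
               (tid (RA1 * RB1)
                  (fun X => idt (UA * UB) Phi
                     (relabel (fun q : (UA * UB) * (A0 * B0) =>
                                 ((q.1.1, q.2.1), (q.2.2, q.1.2))) (alpha X)))
                  (rho i)))
            (M i))))%:E]].

End QDefs.

Arguments mx R (I J)%_type.
Arguments Lmap R (I J)%_type.

(* Main.v *)
Require Import Defs.
From mathcomp Require Import all_boot all_order all_algebra.
From mathcomp.real_closed Require Import complex.
From mathcomp Require Import boolp classical_sets reals ereal.
From mathcomp Require Import topology normedtype sequences.
From mathcomp Require Import fingroup perm spectral.
From mathcomp Require Import ring lra.
From Stdlib Require Import ClassicalEpsilon.
Import Order.TTheory GRing.Theory Num.Theory.
Local Open Scope ring_scope.

Set Implicit Arguments.
Unset Strict Implicit.
Unset Printing Implicit Defensive.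

(** If a functional F on maps is nonnegative on cp maps and at most t on channels,
    then F(Phi) - F(Psi) <= (1/2) ||Phi - Psi|| t in diamond norm.  As LOCC
    superchannels compose, this yields (i) => (ii) and (i) => (iii).

    (ii) on R = A'B' => (i): the LOCC images of Phi1 form a convex set.  If all of
    them are more than epsilon away from Phi2, they can be separated from the convex
    set of all Phi2 - (epsilon/2) alpha + P with alpha a channel and P cp.  The
    separating functional is nonnegative on cp maps, hence a multiple of some
    <rho, .> with rho a state, and this rho violates (ii).

    (iii) => (ii), on the same R: to rho associate the ensemble obtained by applying
    all local signed permutations to R_1.  A local Bell-type measurement turns a
    superchannel into a guessing strategy, and the corresponding correction turns a
    guessing strategy into a superchannel, so that P^LOCC of the
    ensemble is a constant c times the supremum of <rho, Theta(Phi)>, while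
    P_succ is at most c ||rho||^diamond. *)

(** The ancillas of a superchannel are unbounded, so compactness is not at hand and no supremum or
    infimum over superchannels can be assumed attained. Separation therefore carries a margin:
    either some point of the convex set is within [delta] of 0 in Hilbert-Schmidt distance, and a
    multiple of the identity repairs it into an exact certificate, or the whole set stays [delta]
    away and the separating functional is strict. The loss goes into [eta].

    The factor 1/2 arises as follows. $F$ is the pairing with a positive matrix $G$, and duality
    gives $G\le\sigma\otimes1$ with $\mathrm{Tr}\,\sigma\le t+\eta$. Dividing by $\sigma^{1/2}$ on
    both sides turns $G$ into an effect $0\le E\le1$, evaluated on the image of a pure state made
    from $\sigma$ under the difference of two channels. That image is traceless, so only half of its
    trace norm is paid.

    Signed permutations play the role of the Weyl operators: they satisfy a twirling identity in
    every finite dimension, with real entries. With $W$ the set of local signed permutations,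
    $c=|R^A_1R^B_1|/|W|$. *)

Section Separation.
Variables (R : realType) (T : finType).
Local Open Scope classical_set_scope.
Import numFieldNormedType.Exports.

Lemma cvg_sum_fin (f : T -> nat -> R) (l : T -> R) :
  (forall i, f i @ \oo --> l i) ->
  (fun n => \sum_i f i n) @ \oo --> \sum_i l i.
Proof.
move=> h; apply: cvg_big => [|i _]; last exact: h.
exact: add_continuous.
Qed.

(* The separating vector is the point of the closure of D nearest to 0, obtained as
   the limit of a minimizing sequence, which is Cauchy by the parallelogram identity. *)
Lemma convex_separation (D : (T -> R) -> Prop) (m : R) :
  (exists d, D d) ->
  (forall x y t, D x -> D y -> 0 <= t <= 1 -> D (fun i => t * x i + (1 - t) * y i)) ->
  (forall d, D d -> m <= \sum_i d i ^+ 2) ->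
  exists H : T -> R, forall d, D d -> m <= \sum_i H i * d i.
Proof.
move=> [d0 Dd0] Dc Dm.
pose S := [set x | exists2 d, D d & x = \sum_i d i ^+ 2].
have hS : has_inf S by split; [exists (\sum_i d0 i ^+ 2); exists d0 | exists m => x [d /Dm h ->]].
pose m1 := inf S.
have m1le d : D d -> m1 <= \sum_i d i ^+ 2.
  by move=> h; apply: ge_inf; [exact: hS.2 | exists d].
have hu n : exists d, D d /\ \sum_i d i ^+ 2 < m1 + n.+1%:R^-1.
  have : 0 < n.+1%:R^-1 :> R by rewrite invr_gt0 ltr0n.
  by move=> /inf_adherent/(_ hS)[x [d Dd ->] h]; exists d.
have [u uP] := boolp.choice hu.
have par n k : \sum_i (u n i - u k i) ^+ 2 <= 2 * n.+1%:R^-1 + 2 * k.+1%:R^-1.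
  have := m1le _ (Dc _ _ 2^-1 (uP n).1 (uP k).1 _); move=> /(_ _)/wrap[|h]; first lra.
  have := (uP n).2; have := (uP k).2.
  set a := \sum_i u k i ^+ 2; set b := \sum_i u n i ^+ 2 => ha hb.
  have : \sum_i (u n i - u k i) ^+ 2 = 2 * a + 2 * b
      - 4 * \sum_i (2^-1 * u n i + (1 - 2^-1) * u k i) ^+ 2.
    rewrite !mulr_sumr -big_split /= -sumrB; by apply: eq_bigr => i _; field.
  move=> ->; clearbody a b; move: h ha hb; move: (\sum_i (2^-1 * u n i + _) ^+ 2) => c.
  by move: (n.+1%:R^-1) (k.+1%:R^-1) => x y; lra.
have uc i : exists l, (fun n => u n i) @ \oo --> (l : R).
  apply/cvg_ex/cauchy_cvgP/cauchy_exP => e e0.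
  have [N hN] : exists N : nat, 4 * N.+1%:R^-1 < e ^+ 2.
    have e2 : 0 < e ^+ 2 by rewrite exprn_gt0.
    exists (Num.bound (4 / e ^+ 2)); rewrite ltr_pdivrMr ?ltr0n // mulrC -ltr_pdivrMr //.
    apply: lt_le_trans (archi_boundP _) _; first by rewrite divr_ge0 // ltW.
    by rewrite ler_nat.
  exists (u N i); exists N => // n /= Nn; rewrite /ball /= -sqrtr_sqr.
  rewrite -[e]ger0_norm ?ltW // -(sqrtr_sqr e) ltr_sqrt ?exprn_gt0 //.
  apply: le_lt_trans hN.
  apply: (@le_trans _ _ (\sum_i (u N i - u n i) ^+ 2)).
    by rewrite (bigD1 i) //= lerDl sumr_ge0 // => j _; rewrite sqr_ge0.
  apply: le_trans (par N n) _.
  have : n.+1%:R^-1 <= N.+1%:R^-1 :> R by rewrite lef_pV2 ?posrE ?ltr0n // ler_nat.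
  by move: (n.+1%:R^-1) (N.+1%:R^-1) => x y; lra.
have [H HP] := boolp.choice uc.
have cN : (fun n => n.+1%:R^-1 : R) @ \oo --> (0 : R) by exact: cvg_harmonic.
have Hm : m <= \sum_i H i ^+ 2.
  have c1 : (fun n => \sum_i u n i ^+ 2) @ \oo --> \sum_i H i ^+ 2.
    by apply: cvg_sum_fin => i; apply: cvgM; exact: HP.
  rewrite -(cvg_lim (@Rhausdorff R) c1); apply: limr_ge; first by apply/cvg_ex; exists (\sum_i H i ^+ 2).
  by apply: nearW => n; exact: Dm (uP n).1.
exists H => d Dd; apply: le_trans Hm _; rewrite -subr_ge0.
set a := \sum_i (d i - H i) ^+ 2.
have a0 : 0 <= a by apply: sumr_ge0 => i _; rewrite sqr_ge0.
(* First variation at the minimum: moving from [H] towards [d] cannot decrease the norm. [H] may lie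
   outside [D], so the inequality is written for the terms of the sequence, with $1/(n+1)$ covering
   their failure to be minimal, and then passed to the limit. *)
have key t : 0 < t <= 1 -> 0 <= 2 * (\sum_i H i * d i - \sum_i H i ^+ 2) + t * a.
  move=> /andP[t0 t1].
  have c2 : (fun n => 2 * t * (\sum_i u n i * (d i - u n i))
      + t ^+ 2 * (\sum_i (d i - u n i) ^+ 2) + n.+1%:R^-1) @ \oo -->
      2 * t * (\sum_i H i * (d i - H i)) + t ^+ 2 * a + 0.
    apply: cvgD => //; apply: cvgD; apply: cvgM; try exact: cvg_cst.
      apply: cvg_sum_fin => i; apply: cvgM; first exact: HP.
      by apply: cvgB; [exact: cvg_cst | exact: HP].
    by apply: cvg_sum_fin => i; apply: cvgM; apply: cvgB; try exact: cvg_cst; exact: HP.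
  have : 0 <= 2 * t * (\sum_i H i * (d i - H i)) + t ^+ 2 * a + 0.
    rewrite -(cvg_lim (@Rhausdorff R) c2); apply: limr_ge.
      by apply/cvg_ex; eexists; exact: c2.
    apply: nearW => n.
    have := m1le _ (Dc _ _ t Dd (uP n).1 _); move=> /(_ _)/wrap[|h]; first lra.
    have := (uP n).2.
    have -> : 2 * t * (\sum_i u n i * (d i - u n i)) + t ^+ 2 * (\sum_i (d i - u n i) ^+ 2)
       = \sum_i (t * d i + (1 - t) * u n i) ^+ 2 - \sum_i u n i ^+ 2.
      rewrite !mulr_sumr -big_split /= -sumrB; apply: eq_bigr => i _; ring.
    by move: h; move: (n.+1%:R^-1) (\sum_i u n i ^+ 2) (\sum_i (_ + _) ^+ 2) => x y z; lra.
  have -> : \sum_i H i * (d i - H i) = \sum_i H i * d i - \sum_i H i ^+ 2.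
    by rewrite -sumrB; apply: eq_bigr => i _; ring.
  move: (_ - _) => b h; rewrite -(pmulr_rge0 _ t0); apply: le_trans h _.
  rewrite le_eqVlt; apply/orP; left; apply/eqP; ring.
move: (_ - _) key => b key; rewrite leNgt; apply/negP => b0.
have a1 : 0 < a + 1 by lra.
(* With $b<0$ this $t$ satisfies $ta<-b$, hence $2b+ta<0$, against [key]. *)
pose t := Num.min 1 (- b / (a + 1)).
have t0 : 0 < t by rewrite lt_min ltr01 divr_gt0 //; lra.
have := key t; rewrite t0 ge_min lexx /= => /(_ isT).
have : t * (a + 1) <= - b by rewrite -ler_pdivlMr // ge_min lexx orbT.
nra.
Qed.

End Separation.

(** * Operators, traces and positive semidefinite matrices *)

Section Basics.
Variable R : realType.
Local Notation C := (R[i]).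
Implicit Types (I J K L : finType).

Lemma sum_pair (M : nmodType) I J (F : I * J -> M) :
  \sum_p F p = \sum_i \sum_j F (i, j).
Proof. by rewrite pair_bigA /=; apply: eq_bigr => -[]. Qed.

Lemma sum_delta (S : pzSemiRingType) I (a : I) (F : I -> S) :
  \sum_i (i == a)%:R * F i = F a.
Proof.
rewrite (bigD1 a) //= eqxx mul1r big1 ?addr0 // => i /negPf ->.
by rewrite mul0r.
Qed.

Lemma sum_deltaV (S : pzSemiRingType) I (a : I) (F : I -> S) :
  \sum_i (a == i)%:R * F i = F a.
Proof. by rewrite -[RHS]sum_delta; apply: eq_bigr => i _; rewrite eq_sym. Qed.

Lemma conj_nat n : Num.conj (n%:R : C) = n%:R.
Proof. exact: rmorph_nat. Qed.

Lemma ReD (x y : C) : complex.Re (x + y) = complex.Re x + complex.Re y.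
Proof. by case: x y => [a b] [c d]. Qed.
Lemma ReN (x : C) : complex.Re (- x) = - complex.Re x.
Proof. by case: x. Qed.
Lemma ReB (x y : C) : complex.Re (x - y) = complex.Re x - complex.Re y.
Proof. by rewrite ReD ReN. Qed.
Lemma Re0 : complex.Re (0 : C) = 0.
Proof. by []. Qed.
Lemma Re_sum I (P : pred I) (F : I -> C) :
  complex.Re (\sum_(i | P i) F i) = \sum_(i | P i) complex.Re (F i).
Proof. exact: (big_morph _ ReD Re0). Qed.
Lemma Re_rM (a : R) (x : C) : complex.Re (a%:C%C * x) = a * complex.Re x.
Proof. by case: x => u v /=; rewrite mul0r subr0. Qed.
Lemma ReJ (x : C) : complex.Re (Num.conj x) = complex.Re x.
Proof. by case: x. Qed.
Lemma Re_ge0 (x : C) : 0 <= x -> 0 <= complex.Re x.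
Proof. by rewrite lecE => /andP[]. Qed.
Lemma Re_le (x y : C) : x <= y -> complex.Re x <= complex.Re y.
Proof. by rewrite lecE => /andP[]. Qed.
Lemma Re_real (x : C) : 0 <= x -> (complex.Re x)%:C%C = x.
Proof. by move=> h; apply: RRe_real; exact: ger0_real. Qed.

Lemma mulr_conj_ge0 (x : C) : 0 <= Num.conj x * x.
Proof. by rewrite mulrC mul_conjC_ge0. Qed.

Lemma mmulA I J K L (X : mx R I J) (Y : mx R J K) (Z : mx R K L) :
  mmul X (mmul Y Z) = mmul (mmul X Y) Z.
Proof.
apply/funext => i; apply/funext => l; rewrite /mmul.
under eq_bigr do rewrite mulr_sumr; rewrite exchange_big /=.
apply: eq_bigr => k _; rewrite mulr_suml; apply: eq_bigr => j _.
by rewrite mulrA.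
Qed.

Lemma mmul1x I J (X : mx R I J) : mmul (@mid R I) X = X.
Proof.
by apply/funext => i; apply/funext => j; rewrite /mmul /mid sum_deltaV.
Qed.

Lemma mmulx1 I J (X : mx R I J) : mmul X (@mid R J) = X.
Proof.
apply/funext => i; apply/funext => j; rewrite /mmul /mid.
by under eq_bigr do rewrite mulrC; rewrite sum_delta.
Qed.

Lemma madj_mul I J K (X : mx R I J) (Y : mx R J K) :
  madj (mmul X Y) = mmul (madj Y) (madj X).
Proof.
apply/funext => i; apply/funext => k; rewrite /mmul /madj rmorph_sum.
by apply: eq_bigr => j _; rewrite rmorphM mulrC.
Qed.

Lemma madjK I J (X : mx R I J) : madj (madj X) = X.
Proof. by apply/funext => i; apply/funext => j; rewrite /madj conjCK. Qed.

Lemma madj1 I : madj (@mid R I) = @mid R I.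
Proof.
by apply/funext => i; apply/funext => j; rewrite /madj /mid conj_nat eq_sym.
Qed.

Lemma mmulBl I J K (X Y : mx R I J) (Z : mx R J K) :
  mmul (fun i j => X i j - Y i j) Z = fun i j => mmul X Z i j - mmul Y Z i j.
Proof.
apply/funext => i; apply/funext => k; rewrite /mmul -sumrB.
by apply: eq_bigr => j _; rewrite mulrBl.
Qed.

Lemma mmulBr I J K (Z : mx R I J) (X Y : mx R J K) :
  mmul Z (fun i j => X i j - Y i j) = fun i j => mmul Z X i j - mmul Z Y i j.
Proof.
apply/funext => i; apply/funext => k; rewrite /mmul -sumrB.
by apply: eq_bigr => j _; rewrite mulrBr.
Qed.

Lemma mtrC I J (X : mx R I J) (Y : mx R J I) : mtr (mmul X Y) = mtr (mmul Y X).
Proof.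
rewrite /mtr /mmul exchange_big; apply: eq_bigr => j _.
by apply: eq_bigr => i _; rewrite mulrC.
Qed.

Lemma mtrD I (X Y : mx R I I) : mtr (fun i j => X i j + Y i j) = mtr X + mtr Y.
Proof. by rewrite /mtr big_split. Qed.
Lemma mtrB I (X Y : mx R I I) : mtr (fun i j => X i j - Y i j) = mtr X - mtr Y.
Proof. by rewrite /mtr sumrB. Qed.
Lemma mtrZ I a (X : mx R I I) : mtr (fun i j => a * X i j) = a * mtr X.
Proof. by rewrite /mtr mulr_sumr. Qed.
Lemma mtr_sum I K (P : pred K) (X : K -> mx R I I) :
  mtr (fun i j => \sum_(k | P k) X k i j) = \sum_(k | P k) mtr (X k).
Proof. by rewrite /mtr exchange_big. Qed.

Lemma psd_gram I J (X : mx R J I) : psd (mmul (madj X) X).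
Proof.
move=> v; suff -> : \sum_i \sum_j Num.conj (v i) * mmul (madj X) X i j * v j
   = \sum_k Num.conj (\sum_i X k i * v i) * \sum_i X k i * v i.
  by apply: sumr_ge0 => k _; exact: mulr_conj_ge0.
rewrite /mmul /madj.
under eq_bigr => i _ do (under eq_bigr => j _ do rewrite mulr_sumr mulr_suml;
  rewrite exchange_big).
rewrite exchange_big; apply: eq_bigr => k _.
rewrite rmorph_sum mulr_suml; apply: eq_bigr => i _.
rewrite mulr_sumr; apply: eq_bigr => j _.
by rewrite rmorphM /=; ring.
Qed.

Lemma psd_rank1 I (v : I -> C) : psd (fun i j => v i * Num.conj (v j)).
Proof.
have := @psd_gram I unit (fun _ i => Num.conj (v i)).
congr psd; apply/funext => i; apply/funext => j; rewrite /mmul /madj.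
by rewrite big_const card_unit /= addr0 conjCK.
Qed.

Lemma psdD I (X Y : mx R I I) : psd X -> psd Y -> psd (fun i j => X i j + Y i j).
Proof.
move=> hX hY v.
under eq_bigr => i _ do (under eq_bigr => j _ do rewrite mulrDr mulrDl;
  rewrite big_split).
by rewrite big_split /=; apply: addr_ge0.
Qed.

Lemma psdZ I (a : C) (X : mx R I I) : 0 <= a -> psd X -> psd (fun i j => a * X i j).
Proof.
move=> ha hX v; have := mulr_ge0 ha (hX v); congr (_ <= _).
rewrite mulr_sumr; apply: eq_bigr => i _; rewrite mulr_sumr.
by apply: eq_bigr => j _; ring.
Qed.

Lemma psd0 I : psd (fun i j : I => 0 : C).
Proof. by move=> v; rewrite big1 // => i _; rewrite big1 // => j _; rewrite mulr0 mul0r. Qed.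

Lemma psd_sum I K (P : pred K) (X : K -> mx R I I) :
  (forall k, P k -> psd (X k)) -> psd (fun i j => \sum_(k | P k) X k i j).
Proof.
move=> hX v.
under eq_bigr => i _ do (under eq_bigr => j _ do rewrite mulr_sumr mulr_suml;
  rewrite exchange_big /=).
rewrite exchange_big /=; apply: sumr_ge0 => k hk; exact: hX.
Qed.

(** [f] is arbitrary: the form of the pullback at [v] is the form of [X] at the vector of fibre sums
    of [v]. An injection gives the compression to a block, a projection the tensor product with an
    all-ones matrix. *)
Lemma psd_relabel I J (f : I -> J) (X : mx R J J) : psd X -> psd (relabel f X).
Proof.
move=> hX v; have := hX (fun j => \sum_(i | f i == j) v i).
congr (_ <= _).
rewrite [RHS](partition_big f xpredT) //=; apply: eq_bigr => j _.
rewrite exchange_big /=.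
rewrite [in LHS](eq_bigr (fun j' => \sum_(i | f i == j) \sum_(i' | f i' == j')
   Num.conj (v i) * X (f i) (f i') * v i')); last first.
  move=> j' _; rewrite rmorph_sum !mulr_suml; apply: eq_bigr => i /eqP <-.
  by rewrite mulr_sumr; apply: eq_bigr => i' /eqP <-.
rewrite exchange_big [in RHS]exchange_big; apply: eq_bigr => i _.
by rewrite [RHS](partition_big f xpredT).
Qed.

Lemma psd_delta I (X : mx R I I) (a b : I) (s t : C) : psd X ->
  0 <= Num.conj s * s * X a a + Num.conj s * t * X a b
     + Num.conj t * s * X b a + Num.conj t * t * X b b.
Proof.
move/(_ (fun i => (i == a)%:R * s + (i == b)%:R * t)).
congr (_ <= _).
under eq_bigr => i _ do (under eq_bigr => j _ do rewrite mulrDr;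
  rewrite big_split /=).
rewrite big_split /=.
have h (c : I) (u : C) : \sum_i \sum_j Num.conj ((i == a)%:R * s + (i == b)%:R * t)
   * X i j * ((j == c)%:R * u) = Num.conj s * u * X a c + Num.conj t * u * X b c.
  under eq_bigr => i _ do (under eq_bigr => j _ do rewrite mulrCA;
    rewrite sum_delta).
  under eq_bigr => i _ do rewrite rmorphD /= !rmorphM /= !conj_nat !mulrDl -!mulrA.
  rewrite big_split /= !sum_delta; ring.
rewrite !h; ring.
Qed.

Lemma psd_diag_ge0 I (X : mx R I I) a : psd X -> 0 <= X a a.
Proof.
move/(@psd_delta _ _ a a 1 0); rewrite !rmorph1 !rmorph0.
by rewrite !(mul1r, mul0r, mulr0, addr0).
Qed.

(** The order on [C] makes nonnegative numbers real, so Hermitian symmetry follows by polarization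
    from the values of the form at $e_a+e_b$ and $e_a+ie_b$. *)
Lemma psd_herm I (X : mx R I I) a b : psd X -> X b a = Num.conj (X a b).
Proof.
move=> hX; have ha := psd_diag_ge0 a hX; have hb := psd_diag_ge0 b hX.
have /ger0_real h1 := @psd_delta _ X a b 1 1 hX.
have /ger0_real h2 := @psd_delta _ X a b 1 'i hX.
have e1 : X a b + X b a \is Num.real.
  have -> : X a b + X b a = 1^* * 1 * X a a + 1^* * 1 * X a b + 1^* * 1 * X b a
    + 1^* * 1 * X b b - X a a - X b b by rewrite !rmorph1; ring.
  by rewrite !rpredB // ger0_real.
have e2 : 'i * (X a b - X b a) \is Num.real.
  have -> : 'i * (X a b - X b a) = 1^* * 1 * X a a + 1^* * 'i * X a b
    + 'i^* * 1 * X b a + 'i^* * 'i * X b b - X a a - X b b.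
    rewrite !rmorph1 !conjCi; have -> : - 'i * 'i = 1 :> C.
      by rewrite mulNr -expr2 sqrCi opprK.
    by ring.
  by rewrite !rpredB // ger0_real.
move/CrealP: e1; rewrite rmorphD /= => e1.
move/CrealP: e2; rewrite rmorphM /= rmorphB /= conjCi mulNr -mulrN => /(mulfI (neq0Ci _)) e2.
have h : 2 * X b a = 2 * Num.conj (X a b).
  have -> : 2 * X b a = (X a b + X b a) - (X a b - X b a) by ring.
  rewrite -e1 -e2; ring.
by apply: mulfI h; rewrite pnatr_eq0.
Qed.

Lemma psd_madj I (X : mx R I I) : psd X -> madj X = X.
Proof.
move=> h; apply/funext => i; apply/funext => j; rewrite /madj.
by rewrite (psd_herm j i h).
Qed.

(** The spectral theorem for normal matrices, transported from ordinals to the index type. The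
    columns of [V] are the eigenvectors, so [V] is the adjoint of [spectralmx]. *)
Lemma psd_spectral I (X : mx R I I) : psd X ->
  exists (V : mx R I I) (q : I -> C),
  [/\ forall k, 0 <= q k, mmul V (madj V) = @mid R I, mmul (madj V) V = @mid R I &
   X = fun i j => \sum_k q k * V i k * Num.conj (V j k)].
Proof.
move=> hX; pose A : 'M[C]_#|I| := \matrix_(i, j) X (enum_val i) (enum_val j).
have Ah : A \is normalmx.
  apply/normalmxP; congr (_ *m _); apply/matrixP => i j; rewrite !mxE.
    by rewrite (psd_herm _ _ hX).
  by rewrite -(psd_herm _ _ hX).
have /orthomx_spectralP := Ah.
have := spectral_unitarymx A.
move: (spectralmx A) (spectral_diag A) => P d Pu; rewrite invmx_unitary // => hA.
pose V : mx R I I := fun i k => Num.conj (P (enum_rank k) (enum_rank i)).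
have reidx (F : 'I_#|I| -> C) : \sum_k F k = \sum_(k : I) F (enum_rank k).
  by rewrite (reindex enum_rank) //; apply: onW_bij; exact: enum_rank_bij.
have V2 : mmul (madj V) V = @mid R I.
  apply/funext => i; apply/funext => j; rewrite /mmul /madj /V /mid.
  move/unitarymxP/matrixP/(_ (enum_rank i) (enum_rank j)): Pu; rewrite !mxE.
  rewrite (inj_eq enum_rank_inj) reidx => <-.
  by apply: eq_bigr => k _; rewrite conjCK !mxE.
have V1 : mmul V (madj V) = @mid R I.
  apply/funext => i; apply/funext => j; rewrite /mmul /madj /V /mid.
  move/unitarymxP/mulmx1C/matrixP/(_ (enum_rank i) (enum_rank j)): Pu; rewrite !mxE.
  rewrite (inj_eq enum_rank_inj) reidx => <-.
  by apply: eq_bigr => k _; rewrite conjCK !mxE.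
have XE : X = fun i j => \sum_k d 0 (enum_rank k) * V i k * Num.conj (V j k).
  apply/funext => i; apply/funext => j.
  move/matrixP/(_ (enum_rank i) (enum_rank j)): hA; rewrite !mxE !enum_rankK => ->.
  rewrite reidx; apply: eq_bigr => k _; rewrite mul_mx_diag !mxE /V conjCK.
  by rewrite [X in X * _]mulrC.
exists V, (fun k => d 0 (enum_rank k)); split => // k.
(* Orthonormality of the columns makes the form at the [k]-th eigenvector equal to the [k]-th
   eigenvalue. *)
have := hX (V ^~ k); rewrite XE; congr (_ <= _).
under eq_bigr => i _ do (under eq_bigr => j _ do rewrite mulr_sumr mulr_suml;
  rewrite exchange_big).
rewrite exchange_big /=.
have e l m : \sum_i Num.conj (V i l) * V i m = (l == m)%:R :> C.
  by have := congr1 (fun f => f l m) V2.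
transitivity (\sum_l d 0 (enum_rank l) * (k == l)%:R * (l == k)%:R).
  apply: eq_bigr => l _; rewrite -(e k l) -(e l k) mulr_sumr exchange_big.
  apply: eq_bigr => i _; rewrite mulr_sumr mulr_suml; apply: eq_bigr => j _; ring.
rewrite (eq_bigr (fun l => (l == k)%:R * d 0 (enum_rank l))) ?sum_delta //.
by move=> l _; rewrite eq_sym; case: (l == k); rewrite ?(mulr1,mulr0,mul1r,mul0r).
Qed.

(** In an eigenbasis of [X] the trace is the sum of the forms of [Y] at the eigenvectors, weighted
    by the eigenvalues. *)
Lemma psd_mtr_mul_ge0 I (X Y : mx R I I) : psd X -> psd Y -> 0 <= mtr (mmul X Y).
Proof.
move=> /psd_spectral[V [q [hq _ _ ->]]] hY; rewrite /mtr /mmul.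
under eq_bigr => i _ do (under eq_bigr => j _ do rewrite mulr_suml;
  rewrite exchange_big).
rewrite exchange_big /=; apply: sumr_ge0 => k _.
suff -> : \sum_i \sum_j q k * V i k * Num.conj (V j k) * Y j i =
   q k * \sum_j \sum_i Num.conj (V j k) * Y j i * V i k.
  by apply: mulr_ge0; [exact: hq | exact: hY].
rewrite mulr_sumr exchange_big; apply: eq_bigr => j _ /=.
rewrite mulr_sumr; apply: eq_bigr => i _; ring.
Qed.

End Basics.

(** * Polar decomposition and the trace norm via positive block matrices *)

Section TraceNorm.
Variable R : realType.
Local Notation C := (R[i]).
Implicit Types (I J K L : finType).

Lemma psd_scale_diag I (c : I -> C) (X : mx R I I) :
  psd X -> psd (fun i j => c i * X i j * Num.conj (c j)).
Proof.
move=> hX v; have := hX (fun i => Num.conj (c i) * v i); congr (_ <= _).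
apply: eq_bigr => i _; apply: eq_bigr => j _; rewrite rmorphM /= conjCK; ring.
Qed.

Lemma psd_congr I J (S : mx R I J) (Q : mx R J J) :
  psd Q -> psd (mmul S (mmul Q (madj S))).
Proof.
move=> hQ v; have := hQ (fun k => \sum_i Num.conj (S i k) * v i); congr (_ <= _).
rewrite /mmul /madj; symmetry.
under eq_bigr => i _ do (under eq_bigr => j _ do
  (rewrite mulr_sumr mulr_suml; under eq_bigr => k _ do
   rewrite !mulr_sumr mulr_suml); rewrite exchange_big /=).
rewrite exchange_big; apply: eq_bigr => k _ /=.
under eq_bigr => i _ do rewrite exchange_big /=.
rewrite exchange_big; apply: eq_bigr => l _ /=.
rewrite rmorph_sum /= !mulr_suml; apply: eq_bigr => i _.
rewrite mulr_sumr; apply: eq_bigr => j _; rewrite rmorphM /= conjCK; ring.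
Qed.

Lemma gram_eq0 I J (X : mx R J I) :
  mmul (madj X) X = (fun _ _ => 0) -> X = fun _ _ => 0.
Proof.
move=> h; apply/funext => j; apply/funext => i.
have := congr1 (fun f => f i i) h; rewrite /mmul /madj => /eqP.
rewrite psumr_eq0 => [|k _]; last exact: mulr_conj_ge0.
by move=> /allP/(_ j (mem_index_enum _))/=; rewrite mulf_eq0 conjC_eq0 orbb => /eqP.
Qed.

(** $V\,\mathrm{diag}(q)V^\dagger$, used as a functional calculus: for a fixed unitary [V], products
    and adjoints act on [q] only. *)
Definition dg I (V : mx R I I) (q : I -> C) : mx R I I :=
  fun i j => \sum_k q k * V i k * Num.conj (V j k).

Lemma dg_mul I (V : mx R I I) (q r : I -> C) : mmul (madj V) V = @mid R I ->
  mmul (dg V q) (dg V r) = dg V (fun k => q k * r k).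
Proof.
move=> hV; apply/funext => i; apply/funext => j; rewrite /mmul /dg.
have e l m : \sum_i Num.conj (V i l) * V i m = (l == m)%:R :> C.
  by have := congr1 (fun f => f l m) hV.
under eq_bigr => k _ do (rewrite mulr_suml; under eq_bigr => l _ do rewrite mulr_sumr).
rewrite exchange_big; apply: eq_bigr => l _ /=; rewrite exchange_big /=.
transitivity (\sum_m (l == m)%:R * (q l * V i l * r m * Num.conj (V j m))).
  apply: eq_bigr => m _; rewrite -e mulr_suml; apply: eq_bigr => k _; ring.
rewrite sum_deltaV; ring.
Qed.

Lemma dg_adj I (V : mx R I I) (q : I -> C) :
  madj (dg V q) = dg V (fun k => Num.conj (q k)).
Proof.
apply/funext => i; apply/funext => j; rewrite /madj /dg rmorph_sum.
by apply: eq_bigr => k _; rewrite !rmorphM /= conjCK; ring.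
Qed.

Lemma psd_dg I (V : mx R I I) (q : I -> C) : (forall k, 0 <= q k) -> psd (dg V q).
Proof.
move=> hq; apply: psd_sum => k _.
have := psdZ (hq k) (psd_rank1 (V ^~ k)); congr psd.
by apply/funext => i; apply/funext => j; rewrite mulrA.
Qed.

(** [psd_sqrt] is picked by [epsilon]; its two defining properties become available once one root is
    exhibited, here by [sqrtC] on the eigenvalues. *)
Lemma psd_sqrtP I (P : mx R I I) : psd P ->
  psd (psd_sqrt P) /\ mmul (psd_sqrt P) (psd_sqrt P) = P.
Proof.
move=> hP; apply: (epsilon_spec (inhabits _)
  (fun Q : mx R I I => psd Q /\ mmul Q Q = P)).
have [V [q [hq _ hV ->]]] := psd_spectral hP; exists (dg V (fun k => sqrtC (q k))); split.
  by apply: psd_dg => k; rewrite sqrtC_ge0.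
rewrite dg_mul //; congr dg; apply/funext => k.
by rewrite -expr2 sqrtCK.
Qed.

(** $U=YQ^+$ with $Q^+$ the pseudo-inverse of $Q$. For singular $Y$ this is a partial isometry,
    hence the inequality $UU^\dagger\le1$ in place of an equality. *)
Lemma polar I (Y Q : mx R I I) : psd Q -> mmul Q Q = mmul (madj Y) Y ->
  exists U : mx R I I, [/\ Y = mmul U Q, Q = mmul (madj U) Y
    & psd (fun i j => @mid R I i j - mmul U (madj U) i j)].
Proof.
move=> hQ; have hQa := psd_madj hQ.
have [V [q [hq V1 V2 QE]]] := psd_spectral hQ.
have {}QE : Q = dg V q by [].
(* The convention $0^{-1}=0$ makes [Qp] the Moore-Penrose inverse. *)
pose q1 k := (q k)^-1; pose Qp := dg V q1.
have qc k : Num.conj (q k) = q k by apply/CrealP; exact: ger0_real.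
have Qpa : madj Qp = Qp.
  by rewrite dg_adj; congr dg; apply/funext => k; rewrite /q1 fmorphV /= qc.
have V1' : dg V (fun=> 1) = @mid R I.
  rewrite -V1; apply/funext => i; apply/funext => j; rewrite /dg /mmul /madj.
  by apply: eq_bigr => k _; rewrite mul1r.
move=> QQ; pose U := mmul Y Qp.
have UQ : mmul U Q = Y.
  (* [P'] projects onto the kernel of $Q$, which is the kernel of $Y$ because $Y^\dagger Y=Q^2$. *)
  pose P' := dg V (fun k => 1 - q1 k * q k).
  have P'a : madj P' = P'.
    rewrite dg_adj; congr dg; apply/funext => k.
    by rewrite rmorphB rmorph1 rmorphM /= /q1 fmorphV /= qc.
  have /gram_eq0 YP' : mmul (madj (mmul Y P')) (mmul Y P') = fun _ _ => 0.
    rewrite madj_mul -mmulA (mmulA (madj Y)) -QQ P'a QE !dg_mul //.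
    apply/funext => i; apply/funext => j; rewrite /dg big1 // => k _.
    rewrite /q1; have [->|h] := eqVneq (q k) 0; first by rewrite !(mul0r,mulr0).
    by rewrite mulVf // subrr !mul0r.
  have h : mmul Y (fun i j => @mid R I i j - P' i j) = Y.
    by rewrite mmulBr YP' mmulx1; apply/funext => i; apply/funext => j; rewrite subr0.
  rewrite -[RHS]h /U -mmulA QE dg_mul //; congr mmul.
  rewrite -V1'; apply/funext => i; apply/funext => j; rewrite /P' /dg -sumrB.
  by apply: eq_bigr => k _; ring.
have q1q k : q1 k * q k * q k = q k.
  rewrite /q1; have [->|h] := eqVneq (q k) 0; first by rewrite !mulr0.
  by rewrite mulVf // mul1r.
have qq1 k : q k * q1 k * q1 k = q1 k.
  rewrite /q1; have [->|h] := eqVneq (q k) 0; first by rewrite invr0 !mulr0.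
  by rewrite mulfV // mul1r.
exists U; split => //.
  rewrite /U madj_mul Qpa -mmulA -QQ QE !dg_mul //; congr dg.
  by apply/funext => k; rewrite mulrA q1q.
(* [Z] is an orthogonal projection, hence equal to its own Gram matrix. *)
pose Z : mx R I I := fun i j => @mid R I i j - mmul U (madj U) i j.
have Za : madj Z = Z.
  apply/funext => i; apply/funext => j; rewrite /madj /Z rmorphB /=.
  have := congr1 (fun f => f i j) (madj1 R I); rewrite {1}/madj => ->.
  have := congr1 (fun f => f i j) (madj_mul U (madj U)); rewrite {1}/madj => ->.
  by rewrite madjK.
have UUU : mmul U (mmul (madj U) U) = U.
  rewrite {2}/U madj_mul Qpa -mmulA (mmulA (madj Y)) -QQ {1 2}/U -mmulA.
  rewrite QE !dg_mul //; congr mmul; congr dg; apply/funext => k.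
  rewrite /q1; have [->|h] := eqVneq (q k) 0; first by rewrite invr0 !mul0r.
  by field.
rewrite -/Z; have := psd_gram Z; rewrite Za; congr psd.
rewrite {2}/Z mmulBr mmulx1 /Z mmulBl mmul1x -mmulA.
rewrite (mmulA (madj U)) (mmulA U) UUU.
by apply/funext => i; apply/funext => j; rewrite subrr subr0.
Qed.

Definition blk I (A Y B : mx R I I) : mx R (bool * I) (bool * I) :=
  fun p q => match p.1, q.1 with
    | true, true => A p.2 q.2 | true, false => Y p.2 q.2
    | false, true => madj Y p.2 q.2 | false, false => B p.2 q.2 end.

Lemma mtr_blk_mul I (A Y B : mx R I I) (N : mx R (bool * I) (bool * I)) :
  mtr (mmul (blk A Y B) N) =
    mtr (mmul A (fun i j => N (true, i) (true, j)))
  + mtr (mmul Y (fun i j => N (false, i) (true, j)))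
  + mtr (mmul (madj Y) (fun i j => N (true, i) (false, j)))
  + mtr (mmul B (fun i j => N (false, i) (false, j))).
Proof.
rewrite /mtr sum_pair big_bool /= /mmul -!big_split /=.
by apply: eq_bigr => i _; rewrite !sum_pair !big_bool /=; ring.
Qed.

Lemma trnorm_blk I (Y : mx R I I) : exists A B : mx R I I,
  psd (blk A Y B) /\ mtr A + mtr B = 2 * (trnorm Y)%:C%C.
Proof.
have [hQ QQ] := psd_sqrtP (psd_gram Y); rewrite /trnorm.
move: (psd_sqrt _) hQ QQ => Q hQ QQ; have [U [YE QE _]] := polar hQ QQ.
exists (mmul U (mmul Q (madj U))), Q; split.
  pose S : mx R (bool * I) I := fun p k => if p.1 then U p.2 k else @mid R I p.2 k.
  have := psd_congr S hQ; congr psd.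
  apply/funext => -[[] i]; apply/funext => -[[] j]; rewrite /blk /=.
  - by [].
  - rewrite YE -[in RHS](mmulx1 Q) -[in RHS](madj1 R I).
    by apply: eq_bigr => k _; congr (_ * _); apply: eq_bigr => l _.
  - rewrite YE madj_mul (psd_madj hQ) -[in RHS](mmul1x (mmul Q _)).
    by apply: eq_bigr => k _.
  - rewrite -[in RHS](mmulx1 Q) -[in RHS](madj1 R I) -[in RHS](mmul1x (mmul Q _)).
    by apply: eq_bigr => k _; congr (_ * _); apply: eq_bigr => l _.
have -> : mtr (mmul U (mmul Q (madj U))) = mtr Q.
  by rewrite mmulA -YE mtrC -QE.
rewrite Re_real; last by apply: sumr_ge0 => i _; exact: psd_diag_ge0.
ring.
Qed.

(** Testing the block matrix against $S^\dagger S$, where $S$ is the row of blocks $U^\dagger$ and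
    $-1$, gives $2\,\mathrm{Tr}\,Q\le\mathrm{Tr}(AUU^\dagger)+\mathrm{Tr}\,B$, and $UU^\dagger\le1$
    finishes. *)
Lemma blk_trnorm I (A Y B : mx R I I) : psd (blk A Y B) ->
  2 * trnorm Y <= complex.Re (mtr A + mtr B).
Proof.
move=> hM.
have hA : psd A by exact: (psd_relabel (fun i => (true, i)) hM).
have [hQ QQ] := psd_sqrtP (psd_gram Y); rewrite /trnorm.
move: (psd_sqrt _) hQ QQ => Q hQ QQ; have [U [YE QE hU]] := polar hQ QQ.
pose S : mx R I (bool * I) := fun k p => if p.1 then Num.conj (U p.2 k) else - @mid R I p.2 k.
have := psd_mtr_mul_ge0 hM (psd_gram S); rewrite mtr_blk_mul.
set N1 := (X in mmul A X); set N2 := (X in mmul Y X).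
set N3 := (X in mmul (madj Y) X); set N4 := (X in mmul B X).
have e1 : N1 = mmul U (madj U).
  apply/funext => i; apply/funext => j; rewrite /N1 /mmul /madj /S /=.
  by apply: eq_bigr => k _; rewrite conjCK.
have e2 : N2 = fun i j => - madj U i j.
  apply/funext => i; apply/funext => j; rewrite /N2 /mmul /madj /S /mid /=.
  under eq_bigr do rewrite rmorphN /= conj_nat mulNr.
  by rewrite sumrN sum_deltaV.
have e3 : N3 = fun i j => - U i j.
  apply/funext => i; apply/funext => j; rewrite /N3 /mmul /madj /S /mid /=.
  under eq_bigr do rewrite conjCK mulrN mulrC.
  by rewrite sumrN sum_deltaV.
have e4 : N4 = @mid R I.
  apply/funext => i; apply/funext => j; rewrite /N4 /mmul /madj /S /mid /=.
  under eq_bigr do rewrite rmorphN /= conj_nat mulrNN.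
  by rewrite sum_deltaV eq_sym.
have tN (X Z : mx R I I) : mtr (mmul X (fun i j => - Z i j)) = - mtr (mmul X Z).
  rewrite /mtr /mmul -sumrN; apply: eq_bigr => i _; rewrite -sumrN.
  by apply: eq_bigr => j _; rewrite mulrN.
rewrite e1 e2 e3 e4 !tN mmulx1 (mtrC Y) -QE.
have -> : mmul (madj Y) U = Q by rewrite -(psd_madj hQ) QE madj_mul madjK.
have := psd_mtr_mul_ge0 hA hU; rewrite mmulBr mtrB mmulx1.
move=> /Re_ge0 + /Re_ge0; rewrite !(ReD, ReN); lra.
Qed.

(* Tests the block matrix against [[E, -E], [-E, E]] and [[1-E, 1-E], [1-E, 1-E]]. *)
Lemma traceless_pair_le I (E Y : mx R I I) : psd E ->
  psd (fun i j => @mid R I i j - E i j) -> mtr Y = 0 ->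
  - complex.Re (mtr (mmul E Y)) <= trnorm Y / 2.
Proof.
move=> hE hE' tY; have [A [B [hM tAB]]] := trnorm_blk Y.
(* Equal signs go with [E] and opposite signs with [1 - E]. Since [Y] is traceless, the off-diagonal
   terms of the two inequalities add up to $4\,\mathrm{Re}\,\mathrm{Tr}(EY)$ and the diagonal ones
   to $\mathrm{Tr}\,A+\mathrm{Tr}\,B=2\|Y\|_1$. *)
pose c (b : bool) : C := if b then 1 else -1.
have h1 := psd_mtr_mul_ge0 hM (psd_relabel (@snd bool I) hE).
have h2 := psd_mtr_mul_ge0 hM (psd_scale_diag (fun p => c p.1)
            (psd_relabel (@snd bool I) hE')).
move: h1 h2; rewrite !mtr_blk_mul /relabel /c /=.
rewrite !rmorphN !rmorph1.
have e1 (X Z : mx R I I) : mtr (mmul X (fun i j => 1 * Z i j * 1)) = mtr (mmul X Z).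
  by congr (mtr (mmul X _)); apply/funext => i; apply/funext => j; rewrite mul1r mulr1.
have e2 (X Z : mx R I I) : mtr (mmul X (fun i j => -1 * Z i j * -1)) = mtr (mmul X Z).
  by congr (mtr (mmul X _)); apply/funext => i; apply/funext => j; ring.
have tN (X Z : mx R I I) : mtr (mmul X (fun i j => - Z i j)) = - mtr (mmul X Z).
  rewrite /mtr /mmul -sumrN; apply: eq_bigr => i _; rewrite -sumrN.
  by apply: eq_bigr => j _; rewrite mulrN.
have e3 (X Z : mx R I I) : mtr (mmul X (fun i j => -1 * Z i j * 1)) = - mtr (mmul X Z).
  by rewrite -tN; congr (mtr (mmul X _)); apply/funext => i; apply/funext => j; ring.
have e4 (X Z : mx R I I) : mtr (mmul X (fun i j => 1 * Z i j * -1)) = - mtr (mmul X Z).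
  by rewrite -tN; congr (mtr (mmul X _)); apply/funext => i; apply/funext => j; ring.
rewrite !e1 !e2 !e3 !e4.
have rc : complex.Re (mtr (mmul (madj Y) E)) = complex.Re (mtr (mmul E Y)).
  rewrite -[in LHS](psd_madj hE) -madj_mul -ReJ /mtr rmorph_sum.
  by congr complex.Re; apply: eq_bigr => i _; rewrite /= /madj conjCK.
have tY' : mtr (madj Y) = 0.
  by rewrite -(rmorph0 (@Num.conj C)) -tY /mtr rmorph_sum.
have eYE := mtrC Y E.
rewrite !mmulBr !mtrB !mmulx1 tY tY' eYE => /Re_ge0 + /Re_ge0.
have := congr1 (@complex.Re R) tAB; rewrite mulrC Re_rM /=.
rewrite !(ReD, ReN) rc Re0; lra.
Qed.

End TraceNorm.

(** * Completely positive maps, Choi matrices and the pairing with states *)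

Section Maps.
Variable R : realType.
Local Notation C := (R[i]).
Implicit Types (I J K L : finType).

Lemma mx_ext I J (X Y : mx R I J) : (forall i j, X i j = Y i j) -> X = Y.
Proof. by move=> h; apply/funext => i; apply/funext => j. Qed.

Definition munit I (a b : I) : mx R I I := fun i j => (i == a)%:R * (j == b)%:R.

Definition lcp I J (Phi : Lmap R I J) := lin_map Phi /\ cp Phi.

Lemma channel_lcp I J (Phi : Lmap R I J) : channel Phi -> lcp Phi.
Proof. by case. Qed.

Lemma lin_map0 I J (Phi : Lmap R I J) : lin_map Phi -> Phi (fun _ _ => 0) = fun _ _ => 0.
Proof.
move=> h; have := h (-1) (fun _ _ => 0) (fun _ _ => 0).
rewrite (_ : (fun _ _ => -1 * 0 + 0) = fun _ _ => 0); last first.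
  by apply: mx_ext => i j; rewrite mulr0 addr0.
move=> {1}->; apply: mx_ext => i j; ring.
Qed.

Lemma lin_mapZ I J (Phi : Lmap R I J) a X : lin_map Phi ->
  Phi (fun i j => a * X i j) = fun i j => a * Phi X i j.
Proof.
move=> h; have := h a X (fun _ _ => 0); rewrite lin_map0 //.
rewrite (_ : (fun i j => a * X i j + 0) = fun i j => a * X i j); last first.
  by apply: mx_ext => i j; rewrite addr0.
by move->; apply: mx_ext => i j; rewrite addr0.
Qed.

Lemma lin_map_sum I J K (P : pred K) (Phi : Lmap R I J) (X : K -> mx R I I) :
  lin_map Phi -> Phi (fun i j => \sum_(k | P k) X k i j) =
                 fun i j => \sum_(k | P k) Phi (X k) i j.
Proof.
move=> h.
suff hs (s : seq K) : Phi (fun i j => \sum_(k <- s | P k) X k i j) =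
                      fun i j => \sum_(k <- s | P k) Phi (X k) i j by exact: hs.
elim: s => [|k s IH].
  under eq_fun do under eq_fun do rewrite big_nil.
  by rewrite lin_map0 //; apply: mx_ext => i j; rewrite big_nil.
under eq_fun do under eq_fun do rewrite big_cons.
have [Pk|nPk] := boolP (P k); last first.
  rewrite IH; apply: mx_ext => i j; by rewrite big_cons (negPf nPk).
have := h 1 (X k) (fun i j => \sum_(k <- s | P k) X k i j).
under eq_fun do under eq_fun do rewrite mul1r.
by move->; rewrite IH; apply: mx_ext => i j; rewrite mul1r big_cons Pk.
Qed.

Lemma munit_sum I (X : mx R I I) :
  X = fun i j => \sum_p X p.1 p.2 * @munit I p.1 p.2 i j.
Proof.
apply: mx_ext => i j; rewrite sum_pair /munit /=.
under eq_bigr => a _ do (under eq_bigr => b _ do rewrite mulrCA [X in _ * X]mulrC;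
  rewrite -mulr_sumr sum_deltaV).
by rewrite sum_deltaV.
Qed.

Lemma lin_mapE I J (Phi : Lmap R I J) X s t : lin_map Phi ->
  Phi X s t = \sum_p X p.1 p.2 * Phi (munit p.1 p.2) s t.
Proof.
move=> h; rewrite {1}(munit_sum X) lin_map_sum //.
by apply: eq_bigr => p _; rewrite lin_mapZ.
Qed.

(* The Choi matrix with the input factor first; its transpose is [choi (hs_adj Phi)]. *)
Definition jmx I J (Phi : Lmap R I J) : mx R (I * J) (I * J) :=
  fun p q => Phi (munit p.1 q.1) p.2 q.2.
Definition kmap I J (K : mx R (I * J) (I * J)) : Lmap R I J :=
  fun X s t => \sum_p X p.1 p.2 * K (p.1, s) (p.2, t).

Lemma kmap_jmx I J (Phi : Lmap R I J) : lin_map Phi -> kmap (jmx Phi) = Phi.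
Proof. by move=> h; apply/funext => X; apply: mx_ext => s t; rewrite [RHS]lin_mapE. Qed.

Lemma jmx_kmap I J (K : mx R (I * J) (I * J)) : jmx (kmap K) = K.
Proof.
apply: mx_ext => -[a s] [b t]; rewrite /jmx /kmap /munit /= sum_pair /=.
under eq_bigr => i _ do (under eq_bigr => j _ do rewrite -mulrA;
  rewrite -mulr_sumr sum_delta).
by rewrite sum_delta.
Qed.

Lemma lin_kmap I J (K : mx R (I * J) (I * J)) : lin_map (kmap K).
Proof.
move=> a X Y; apply: mx_ext => s t; rewrite /kmap mulr_sumr -big_split /=.
by apply: eq_bigr => p _; ring.
Qed.

Lemma mtr_kmap I J (K : mx R (I * J) (I * J)) X :
  mtr (kmap K X) = \sum_p X p.1 p.2 * \sum_s K (p.1, s) (p.2, s).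
Proof. by rewrite /mtr /kmap exchange_big; apply: eq_bigr => p _; rewrite mulr_sumr. Qed.

(** The Choi matrix is the image of the unnormalized maximally entangled state, with ancilla [I]. *)
Lemma cp_jmx I J (Phi : Lmap R I J) : cp Phi -> psd (jmx Phi).
Proof.
move=> h; pose v (p : I * I) : C := (p.1 == p.2)%:R.
have := h I _ (psd_rank1 v); congr psd; apply: mx_ext => -[a s] [b t].
rewrite /idt /jmx /v /=; congr (Phi _ s t); apply: mx_ext => i j.
by rewrite /munit conj_nat (eq_sym a) (eq_sym b).
Qed.

(** The eigenvectors of [K], read as matrices $V_k$, are Kraus operators; the factor written out in
    the proof is $1_L\otimes V_k$. *)
Lemma cp_kmap I J (K : mx R (I * J) (I * J)) : psd K -> cp (kmap K).
Proof.
move=> /psd_spectral[V [q [hq _ _ ->]]] L X hX.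
have -> : idt (kmap (fun i j => \sum_k q k * V i k * Num.conj (V j k))) X
  = fun p r => \sum_k q k *
    mmul (fun (p : L * J) (l : L * I) => (p.1 == l.1)%:R * V (l.2, p.2) k)
     (mmul X (madj (fun (p : L * J) (l : L * I) => (p.1 == l.1)%:R * V (l.2, p.2) k))) p r.
  apply: mx_ext => -[l s] [m t]; rewrite /idt /kmap /mmul /madj /=.
  under eq_bigr do rewrite mulr_sumr.
  rewrite exchange_big; apply: eq_bigr => k _ /=.
  rewrite sum_pair [in RHS]sum_pair /=.
  transitivity (q k * \sum_a (V (a, s) k * \sum_b X (l, a) (m, b) * Num.conj (V (b, t) k))).
    rewrite mulr_sumr; apply: eq_bigr => a _; rewrite !mulr_sumr.
    by apply: eq_bigr => b _; ring.
  congr (_ * _).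
  under [RHS]eq_bigr => l' _ do (under eq_bigr => a _ do rewrite -mulrA; rewrite -mulr_sumr).
  rewrite sum_deltaV; apply: eq_bigr => a _; congr (_ * _).
  rewrite sum_pair /=.
  under [RHS]eq_bigr => m' _ do (under eq_bigr => b _ do
    rewrite rmorphM /= conj_nat mulrCA; rewrite -mulr_sumr).
  by rewrite sum_deltaV.
by apply: psd_sum => k _; apply: psdZ => //; exact: psd_congr.
Qed.

Lemma lcp_comp I J K (Phi : Lmap R I J) (Psi : Lmap R J K) :
  lcp Phi -> lcp Psi -> lcp (fun X => Psi (Phi X)).
Proof.
move=> [l1 c1] [l2 c2]; split => [a X Y|L X hX]; first by rewrite l1 l2.
exact: (c2 L _ (c1 L X hX)).
Qed.

Lemma lcp_idt L I J (Phi : Lmap R I J) : lcp Phi -> lcp (idt (K:=L) Phi).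
Proof.
move=> [l c]; split => [a X Y|K X hX].
  apply: mx_ext => p q; rewrite /idt.
  by rewrite (l a (fun i i' => X (p.1, i) (q.1, i')) (fun i i' => Y (p.1, i) (q.1, i'))).
exact: (psd_relabel (fun p : K * (L * J) => ((p.1, p.2.1), p.2.2))
  (c (K * L)%type _ (psd_relabel (fun p : (K * L) * I => (p.1.1, (p.1.2, p.2))) hX))).
Qed.

Lemma lcp_tid L I J (Phi : Lmap R I J) : lcp Phi -> lcp (tid (K:=L) Phi).
Proof.
move=> [l c]; split => [a X Y|K X hX].
  apply: mx_ext => p q; rewrite /tid.
  by rewrite (l a (fun i i' => X (i, p.2) (i', q.2)) (fun i i' => Y (i, p.2) (i', q.2))).
exact: (psd_relabel (fun p : K * (J * L) => ((p.1, p.2.2), p.2.1))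
  (c (K * L)%type _ (psd_relabel (fun p : (K * L) * I => (p.1.1, (p.2, p.1.2))) hX))).
Qed.

Lemma lcp_relabel I J (f : I -> J) : lcp (@relabel R I J f).
Proof.
split => // K X hX.
exact: (psd_relabel (fun p : K * I => (p.1, f p.2)) hX).
Qed.

Lemma lcp_id I : lcp (fun X : mx R I I => X).
Proof. by split => // K X hX; exact: (psd_relabel (fun p : K * I => (p.1, p.2)) hX). Qed.

Lemma lcp_sum I J K (P : pred K) (Phi : K -> Lmap R I J) :
  (forall k, P k -> lcp (Phi k)) -> lcp (fun X i j => \sum_(k | P k) Phi k X i j).
Proof.
move=> h; split=> [a X Y|L X hX].
  apply: mx_ext => i j; rewrite mulr_sumr -big_split /=.
  by apply: eq_bigr => k /h[l _]; rewrite l.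
by apply: psd_sum => k /h[_ c]; exact: c.
Qed.

Lemma lcpZ I J (a : C) (Phi : Lmap R I J) : 0 <= a -> lcp Phi ->
  lcp (fun X i j => a * Phi X i j).
Proof.
move=> ha [l c]; split=> [b X Y|L X hX]; last by apply: psdZ => //; exact: c.
by rewrite l; apply: mx_ext => i j; ring.
Qed.

Lemma lcp_psd I J (Phi : Lmap R I J) X : lcp Phi -> psd X -> psd (Phi X).
Proof.
move=> [_ c] hX.
exact: (psd_relabel (fun j => (tt, j)) (c unit _ (psd_relabel (@snd unit I) hX))).
Qed.

Lemma mtr_idt L I J (Phi : Lmap R I J) (c : C) X : (forall X, mtr (Phi X) = c * mtr X) ->
  mtr (idt (K:=L) Phi X) = c * mtr X.
Proof.
move=> h; rewrite /mtr !sum_pair /idt /= mulr_sumr; apply: eq_bigr => l _.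
exact: (h (fun i i' => X (l, i) (l, i'))).
Qed.

Lemma tp_idt L I J (Phi : Lmap R I J) : tp Phi -> tp (idt (K:=L) Phi).
Proof.
move=> h X; rewrite (@mtr_idt _ _ _ _ 1) ?mul1r // => Y; by rewrite h mul1r.
Qed.

Lemma tp_tid L I J (Phi : Lmap R I J) : tp Phi -> tp (tid (K:=L) Phi).
Proof.
move=> h X; rewrite /mtr !sum_pair /tid /= exchange_big [RHS]exchange_big.
apply: eq_bigr => l _; exact: (h (fun i i' => X (i, l) (i', l))).
Qed.

Lemma tp_relabel I J (f : I -> J) : bijective f -> tp (@relabel R I J f).
Proof. by move=> h X; rewrite /mtr /relabel [RHS](reindex f) //=; exact: onW_bij. Qed.

Lemma channel_comp I J K (Phi : Lmap R I J) (Psi : Lmap R J K) :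
  channel Phi -> channel Psi -> channel (fun X => Psi (Phi X)).
Proof.
move=> [l1 c1 t1] [l2 c2 t2].
have [l c] := lcp_comp (conj l1 c1) (conj l2 c2); split => // X.
by rewrite t2 t1.
Qed.
Lemma channel_idt L I J (Phi : Lmap R I J) : channel Phi -> channel (idt (K:=L) Phi).
Proof. by move=> [l c t]; have [] := @lcp_idt L _ _ _ (conj l c); split => //; exact: tp_idt. Qed.
Lemma channel_tid L I J (Phi : Lmap R I J) : channel Phi -> channel (tid (K:=L) Phi).
Proof. by move=> [l c t]; have [] := @lcp_tid L _ _ _ (conj l c); split => //; exact: tp_tid. Qed.
Lemma channel_relabel I J (f : I -> J) : bijective f -> channel (@relabel R I J f).
Proof. by move=> h; have [l c] := lcp_relabel f; split => //; exact: tp_relabel. Qed.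

Lemma cp_addZ I J (a : C) (Phi Psi : Lmap R I J) : 0 <= a -> lcp Phi -> lcp Psi ->
  lcp (fun X i j => a * Phi X i j + Psi X i j).
Proof.
move=> ha [l1 c1] [l2 c2]; split => [b X Y|K X hX].
  by rewrite l1 l2; apply: mx_ext => i j; ring.
by apply: psdD; [apply: psdZ => //; exact: c1|exact: c2].
Qed.

Lemma psd_tr I (X : mx R I I) : psd X -> psd (fun i j => X j i).
Proof.
move=> h v; have := h (fun i => Num.conj (v i)); congr (_ <= _).
rewrite exchange_big; apply: eq_bigr => i _; apply: eq_bigr => j _.
rewrite conjCK; ring.
Qed.

Lemma mmul_pr I (X Y : mx R I I) :
  mtr (mmul X (fun i j => Y j i)) = \sum_i \sum_j X i j * Y i j.
Proof. by []. Qed.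

(** The bilinear sum is $\mathrm{Tr}(XY^T)$, and transposition preserves positivity. States are
    paired with Choi matrices in this way throughout. *)
Lemma psd_pr_ge0 I (X Y : mx R I I) : psd X -> psd Y ->
  0 <= \sum_i \sum_j X i j * Y i j.
Proof. by move=> hX hY; rewrite -mmul_pr; apply: psd_mtr_mul_ge0 => //; exact: psd_tr. Qed.

Lemma psd_le_mtr I (X : mx R I I) : psd X ->
  psd (fun i j => mtr X * @mid R I i j - X i j).
Proof.
move=> /psd_spectral[V [q [hq V1 V2 XE]]]; have tX : mtr X = \sum_k q k.
  rewrite XE /mtr exchange_big; apply: eq_bigr => k _ /=.
  have := congr1 (fun f => f k k) V2; rewrite /mmul /madj /mid eqxx => e.
  transitivity (q k * true%:R); last by rewrite mulr1.
  rewrite -e mulr_sumr; apply: eq_bigr => i _; ring.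
have h : psd (dg V (fun k => (\sum_l q l) - q k)).
  by apply: psd_dg => k; rewrite (bigD1 k) //= [X in X - _]addrC addrK sumr_ge0.
move: h; congr psd; apply: mx_ext => i j.
rewrite tX -V1 XE /mmul /madj /dg mulr_sumr -sumrB.
by apply: eq_bigr => k _; ring.
Qed.

(** Complex form of $\langle\rho,\phi\rangle$ without the adjoint: $\phi$ acts on the first factor
    of $\rho$ and the result is evaluated on the unnormalized maximally entangled vector. Linearity
    in $\phi$ is visible here. *)
Definition cpair I J (rho : mx R (I * J) (I * J)) (phi : Lmap R I J) : C :=
  \sum_s \sum_t phi (fun a b => rho (a, s) (b, t)) s t.

Lemma cpairE I J (rho : mx R (I * J) (I * J)) (phi : Lmap R I J) : lin_map phi ->
  cpair rho phi = \sum_p \sum_q rho p q * jmx phi p q.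
Proof.
move=> h; rewrite sum_pair exchange_big; apply: eq_bigr => s _ /=.
under [RHS]eq_bigr => a _ do rewrite sum_pair exchange_big /=.
rewrite exchange_big; apply: eq_bigr => t _ /=.
by rewrite lin_mapE // sum_pair.
Qed.

Lemma cpair_ge0 I J (rho : mx R (I * J) (I * J)) (phi : Lmap R I J) :
  psd rho -> lcp phi -> 0 <= cpair rho phi.
Proof. by move=> h [l /cp_jmx c]; rewrite cpairE // psd_pr_ge0. Qed.

(** [hs_adj] is picked by [epsilon], so an adjoint is first exhibited. Its defining identity on
    matrix units yields conjugated entries of [jmx phi]; complete positivity makes [jmx phi]
    Hermitian, which removes the conjugation. *)
Lemma hs_pairE I J (rho : mx R (I * J) (I * J)) (phi : Lmap R I J) : lcp phi ->
  hs_pair rho phi = complex.Re (cpair rho phi).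
Proof.
move=> [l c]; rewrite cpairE // /hs_pair; congr complex.Re.
have hadj (A : mx R J J) (B : mx R I I) :
    mtr (mmul (madj A) (phi B)) = mtr (mmul (madj (hs_adj phi A)) B).
  move: A B; apply: (epsilon_spec (inhabits _) (fun psi : Lmap R J I =>
    forall A B, mtr (mmul (madj A) (phi B)) = mtr (mmul (madj (psi A)) B))).
  exists (fun A a b => \sum_p A p.1 p.2 * Num.conj (phi (munit a b) p.1 p.2)) => A B.
  rewrite /mtr /mmul /madj.
  under eq_bigr => i _ do under eq_bigr => j _ do rewrite (lin_mapE _ _ _ l) sum_pair.
  rewrite exchange_big /=.
  transitivity (\sum_a \sum_b \sum_(p : J * J) Num.conj (A p.1 p.2) * B a b *
     phi (munit a b) p.1 p.2).
    rewrite [RHS]exchange_big /=.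
    under [RHS]eq_bigr => b _ do under eq_bigr => a _ do rewrite sum_pair.
    under [LHS]eq_bigr => j _ do under eq_bigr => i _ do (rewrite mulr_sumr;
      under eq_bigr => a _ do rewrite mulr_sumr; rewrite exchange_big /=).
    under [LHS]eq_bigr => j _ do rewrite exchange_big /=.
    rewrite exchange_big; apply: eq_bigr => b _ /=.
    under [LHS]eq_bigr => j _ do rewrite exchange_big /=.
    rewrite exchange_big; apply: eq_bigr => a _ /=.
    by apply: eq_bigr => j _; apply: eq_bigr => i _; rewrite mulrA.
  rewrite exchange_big; apply: eq_bigr => b _; apply: eq_bigr => a _ /=.
  rewrite rmorph_sum mulr_suml; apply: eq_bigr => p _.
  by rewrite rmorphM /= conjCK; ring.
rewrite /mtr /mmul; apply: eq_bigr => -[a s] _; apply: eq_bigr => -[b t] _.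
congr (_ * _); rewrite /choi /tid /jmx /=.
have -> : (fun i i' => maxent R (i, t) (i', s)) = munit t s.
  by apply: mx_ext => i j; rewrite /maxent /munit /= -natrM mulnb.
have := hadj (munit t s) (munit b a); rewrite /mtr /mmul /madj /munit.
under eq_bigr => i _ do under eq_bigr => j _ do rewrite rmorphM /= !conj_nat.
under eq_bigr => i _ do (under eq_bigr => j _ do rewrite [X in X * _]mulrC -mulrA;
   rewrite -mulr_sumr sum_delta).
rewrite sum_delta.
under [RHS]eq_bigr => i _ do (under eq_bigr => j _ do rewrite mulrCA;
   rewrite sum_delta mulrC).
rewrite sum_delta => e.
have := cp_jmx c; move=> /(@psd_herm R _ _ (b, t) (a, s)); rewrite /jmx /= => ->.
by rewrite /munit e conjCK.
Qed.

Lemma mtr_jmx I J (phi : Lmap R I J) : channel phi -> mtr (jmx phi) = #|I|%:R.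
Proof.
move=> [_ _ t]; rewrite /mtr sum_pair /jmx /=.
rewrite (eq_bigr (fun=> 1)) ?sumr_const // => a _.
by have := t (munit a a); rewrite /mtr => ->; rewrite /munit sum_delta eqxx.
Qed.

(** A state satisfies $\rho\le1$, so the pairing is at most the trace of the Choi matrix. This makes
    the suprema over channels finite. *)
Lemma cpair_channel_le I J (rho : mx R (I * J) (I * J)) (phi : Lmap R I J) :
  state rho -> channel phi -> complex.Re (cpair rho phi) <= #|I|%:R.
Proof.
move=> [hr tr] hphi; have [l c t] := hphi; rewrite cpairE //.
have := psd_pr_ge0 (psd_le_mtr hr) (cp_jmx c); rewrite tr.
under eq_bigr => p _ do under eq_bigr => q _ do rewrite mul1r mulrBl.
under eq_bigr => p _ do rewrite sumrB sum_deltaV.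
rewrite sumrB -[X in X - _]/(mtr (jmx phi)) mtr_jmx // subr_ge0 => /Re_le.
by move=> h; apply: le_trans h _; rewrite -(rmorph_nat (real_complex R)).
Qed.

(** Heisenberg picture: [N i] is the adjoint map applied to [M i], with its entries read off on
    matrix units. *)
Lemma povm_pullback k I J (Xi : Lmap R I J) (M : 'I_k -> mx R J J) :
  channel Xi -> povm M -> exists N : 'I_k -> mx R I I, povm N /\
    forall i X, mtr (mmul X (N i)) = mtr (mmul (Xi X) (M i)).
Proof.
move=> [l c t] [Mp M1].
have mE i X : mtr (mmul (Xi X) (M i)) =
    \sum_p X p.1 p.2 * mtr (mmul (Xi (munit p.1 p.2)) (M i)).
  rewrite /mtr /mmul.
  under eq_bigr => a _ do under eq_bigr => b _ do
    rewrite (lin_mapE _ _ _ l) mulr_suml.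
  under eq_bigr => a _ do rewrite exchange_big /=.
  rewrite exchange_big; apply: eq_bigr => p _ /=.
  by rewrite mulr_sumr; apply: eq_bigr => a _; rewrite mulr_sumr;
     apply: eq_bigr => b _; rewrite mulrA.
exists (fun i b a => mtr (mmul (Xi (munit a b)) (M i))); split; last first.
  by move=> i X; rewrite mE sum_pair.
split => [i v|].
  have := psd_mtr_mul_ge0 (lcp_psd (conj l c) (psd_rank1 v)) (Mp i).
  rewrite mE sum_pair exchange_big; congr (_ <= _).
  by apply: eq_bigr => a _; apply: eq_bigr => b _ /=; ring.
apply: mx_ext => b a.
transitivity (mtr (mmul (Xi (munit a b)) (@mid R J))).
  rewrite -M1 /mtr exchange_big; apply: eq_bigr => s _ /=.
  rewrite /mmul exchange_big; apply: eq_bigr => u _ /=.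
  by rewrite mulr_sumr.
by rewrite mmulx1 t /mtr /munit sum_delta /mid eq_sym.
Qed.

End Maps.

Arguments munit {R I} a b _ _.

(** * Separation of Hermitian matrices and the dual form of $\|\cdot\|^\diamond$ *)

Section Duality.
Variable R : realType.
Local Notation C := (R[i]).
Implicit Types (I J K L : finType).

(** Used on cones: a functional bounded below along every ray of a cone is nonnegative on it. *)
Lemma lin_bound (c x : R) : (forall s, 0 <= s -> 0 <= c + s * x) -> 0 <= x.
Proof.
move=> h; rewrite leNgt; apply/negP => x0.
have hs : 0 <= (`|c| + 1) / - x.
  by rewrite divr_ge0 // ?addr_ge0 // oppr_ge0 ltW.
have := h _ hs; rewrite invrN mulrN mulNr -mulrA mulVf ?lt_eqF // mulr1.
have := ler_norm c; lra.
Qed.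

Lemma conj_affine (a : R) (x y : C) :
  Num.conj (a%:C%C * x - y) = a%:C%C * Num.conj x - Num.conj y.
Proof.
by case: x y => [u v] [w z]; apply/eqP; rewrite eq_complex /=; apply/andP; split;
  apply/eqP; ring.
Qed.

Lemma herm_separation I (D : mx R I I -> Prop) (m : R) :
  (exists d, D d) ->
  (forall d, D d -> forall p q, d q p = Num.conj (d p q)) ->
  (forall X Y t, D X -> D Y -> 0 <= t <= 1 ->
     D (fun i j => t%:C%C * X i j + (1 - t)%:C%C * Y i j)) ->
  (forall d, D d -> m <= \sum_p \sum_q (complex.Re (d p q) ^+ 2 + complex.Im (d p q) ^+ 2)) ->
  exists H : mx R I I, (forall p q, H q p = Num.conj (H p q)) /\
    forall d, D d -> m <= complex.Re (\sum_p \sum_q H p q * d p q).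
Proof.
move=> [d0 Dd0] Dh Dc Dm.
pose enc (X : mx R I I) (u : (I * I) * bool) : R :=
  if u.2 then complex.Re (X u.1.1 u.1.2) else complex.Im (X u.1.1 u.1.2).
have sumE (F : (I * I) * bool -> R) : \sum_u F u =
    \sum_p \sum_q (F ((p, q), true) + F ((p, q), false)).
  by rewrite !sum_pair; apply: eq_bigr => p _; apply: eq_bigr => q _; rewrite big_bool.
have [|||H0 H0P] := @convex_separation R _ (fun f => exists2 X, D X & f = enc X) m.
- by exists (enc d0), d0.
- move=> _ _ t [X DX ->] [Y DY ->] ht; exists (fun i j => t%:C%C * X i j + (1 - t)%:C%C * Y i j).
    exact: Dc.
  apply/funext => -[[p q] []]; rewrite /enc /=; case: (X p q) (Y p q) => [a b] [c e] /=; ring.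
- by move=> _ [X /Dm h ->]; rewrite sumE.
(* The minus sign comes from
   $\mathrm{Re}(hd)=\mathrm{Re}\,h\,\mathrm{Re}\,d-\mathrm{Im}\,h\,\mathrm{Im}\,d$. The Hermitian
   part taken next has the same real pairing with every Hermitian [d]. *)
pose H p q : C := Complex (H0 ((p, q), true)) (- H0 ((p, q), false)).
exists (fun p q => 2^-1 * (H p q + Num.conj (H q p))); split => [p q|d Dd].
  by rewrite rmorphM rmorphD /= conjCK fmorphV /= conj_nat addrC.
have e : \sum_p \sum_q 2^-1 * (H p q + Num.conj (H q p)) * d p q =
    2^-1 * ((\sum_p \sum_q H p q * d p q) + Num.conj (\sum_p \sum_q H p q * d p q)).
  rewrite [X in Num.conj X]exchange_big rmorph_sum -big_split mulr_sumr.
  apply: eq_bigr => p _ /=; rewrite rmorph_sum -big_split mulr_sumr.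
  apply: eq_bigr => q _ /=; rewrite rmorphM /= (Dh d Dd p q) conjCK; ring.
have -> : complex.Re (\sum_p \sum_q 2^-1 * (H p q + Num.conj (H q p)) * d p q) =
   complex.Re (\sum_p \sum_q H p q * d p q).
  rewrite e (_ : 2^-1 = (2^-1 : R)%:C%C :> C); last by rewrite fmorphV rmorph_nat.
  by rewrite Re_rM ReD ReJ; field.
have := H0P (enc d); move=> /(_ _)/wrap[|]; first by exists d.
rewrite sumE => h; apply: le_trans h _; rewrite le_eqVlt; apply/orP; left; apply/eqP.
rewrite Re_sum; apply: eq_bigr => p _; rewrite Re_sum; apply: eq_bigr => q _.
by rewrite /enc /H /=; case: (d p q) => a b /=; ring.
Qed.

Lemma herm_form_real I (X : mx R I I) (v : I -> C) :
  (forall p q, X q p = Num.conj (X p q)) ->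
  \sum_i \sum_j Num.conj (v i) * X i j * v j \is Num.real.
Proof.
move=> hX; apply/CrealP; rewrite rmorph_sum exchange_big; apply: eq_bigr => i _.
rewrite rmorph_sum; apply: eq_bigr => j _.
transitivity (v i * Num.conj (X i j) * Num.conj (v j)).
  by rewrite -[in RHS](conjCK (v i)) -!rmorphM.
by rewrite -hX; ring.
Qed.

Lemma sum_mean I (x : I -> C) :
  \sum_i \sum_j 2^-1 * (x i + x j) = #|I|%:R * \sum_i x i.
Proof.
rewrite (eq_bigr (fun i => 2^-1 * (x i *+ #|I| + \sum_j x j))); last first.
  by move=> i _; rewrite -mulr_sumr big_split /= sumr_const.
by rewrite -mulr_sumr big_split /= sumr_const sumrMnl -mulr_natl; field.
Qed.

(** The form of [d] at [v] is at most $\delta(\sum_i|v_i|)^2$ in modulus, and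
    $|v_i||v_j|\le(|v_i|^2+|v_j|^2)/2$ turns this into $\delta\,|I|\,\|v\|^2$. *)
Lemma small_herm_psd I (d : mx R I I) (delta : R) :
  (forall p q, d q p = Num.conj (d p q)) -> (forall p q, `|d p q| <= delta%:C%C) ->
  psd (fun p q => (#|I|%:R * delta)%:C%C * @mid R I p q + d p q).
Proof.
move=> hd hb v.
have -> : \sum_i \sum_j Num.conj (v i) * ((#|I|%:R * delta)%:C%C * @mid R I i j + d i j) * v j
  = (#|I|%:R * delta)%:C%C * (\sum_i `|v i| ^+ 2) + \sum_i \sum_j Num.conj (v i) * d i j * v j.
  rewrite mulr_sumr -big_split; apply: eq_bigr => i _ /=.
  rewrite (eq_bigr (fun j => (i == j)%:R * ((#|I|%:R * delta)%:C%C * (Num.conj (v i) * v j))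
      + Num.conj (v i) * d i j * v j)); last by move=> j _; rewrite /mid; ring.
  by rewrite big_split /= sum_deltaV normCK [v i * _]mulrC.
set w := (X in _ + X).
have wr : w \is Num.real by exact: herm_form_real.
have hw : `|w| <= (#|I|%:R * delta)%:C%C * (\sum_i `|v i| ^+ 2).
  apply: le_trans (ler_norm_sum _ _ _) _.
  apply: (@le_trans _ _ (\sum_i \sum_j delta%:C%C * (2^-1 * (`|v i| ^+ 2 + `|v j| ^+ 2)))).
    apply: ler_sum => i _; apply: le_trans (ler_norm_sum _ _ _) _; apply: ler_sum => j _.
    rewrite !normrM norm_conjC [X in X * _]mulrC -mulrA; apply: ler_pM => //.
    rewrite -subr_ge0 (_ : _ - _ = 2^-1 * (`|v i| - `|v j|) ^+ 2); last by field.
    by rewrite mulr_ge0 ?invr_ge0 ?ler0n // real_exprn_even_ge0 // rpredB // normr_real.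
  rewrite rmorphM rmorph_nat /= -mulrA mulrCA.
  under eq_bigr => i _ do rewrite -mulr_sumr.
  rewrite -mulr_sumr le_eqVlt; apply/orP; left; apply/eqP; congr (_ * _).
  exact: sum_mean.
rewrite addrC -[w]opprK addrC subr_ge0; apply: le_trans hw.
by rewrite -normrN real_ler_norm // rpredN.
Qed.

Lemma channel_kmap I J (K : mx R (I * J) (I * J)) : psd K ->
  (forall a b, \sum_s K (a, s) (b, s) = (a == b)%:R) -> channel (kmap K).
Proof.
move=> hK hp; split; [exact: lin_kmap | exact: cp_kmap | move=> X].
rewrite mtr_kmap sum_pair /mtr; apply: eq_bigr => a _ /=.
by under eq_bigr do rewrite hp mulrC; rewrite sum_deltaV.
Qed.

Lemma cpair_kmap I J (G K : mx R (I * J) (I * J)) :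
  cpair G (kmap K) = \sum_p \sum_q G p q * K p q.
Proof. by rewrite cpairE ?jmx_kmap //; exact: lin_kmap. Qed.

Lemma psd_tens1 I J (X : mx R I I) : psd X ->
  psd (fun p q : I * J => X p.1 q.1 * (p.2 == q.2)%:R).
Proof.
move=> hX.
have -> : (fun p q : I * J => X p.1 q.1 * (p.2 == q.2)%:R) =
    fun p q => \sum_s (p.2 == s)%:R * relabel fst X p q * Num.conj ((q.2 == s)%:R).
  apply: mx_ext => p q; rewrite /relabel.
  under eq_bigr => s _ do rewrite -mulrA.
  by rewrite sum_deltaV conj_nat eq_sym.
apply: psd_sum => s _.
exact: (psd_scale_diag (fun p : I * J => (p.2 == s)%:R) (psd_relabel fst hX)).
Qed.

Lemma psd_herm_form I (X : mx R I I) : (forall p q, X q p = Num.conj (X p q)) ->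
  (forall v, 0 <= complex.Re (\sum_i \sum_j Num.conj (v i) * X i j * v j)) -> psd X.
Proof.
move=> hX h v; have := h v; set w := \sum_i _.
have wr : w \is Num.real by exact: herm_form_real.
by rewrite -(RRe_real wr) /= ler0c.
Qed.

(* If no sigma exists, separating G from the cone below the sigma (x) 1 yields a positive
   K whose marginal is bounded; completing K to a channel contradicts the bound t. *)
Lemma cond_dnorm_dual I J (G : mx R (I * J) (I * J)) (t eta : R) (a0 : I) (s0 : J) :
  psd G -> (forall g, channel g -> complex.Re (cpair G g) <= t) -> 0 < eta ->
  exists sigma : mx R I I, [/\ psd sigma, complex.Re (mtr sigma) <= t + eta &
    psd (fun p q => sigma p.1 q.1 * (p.2 == q.2)%:R - G p q)].
Proof.
move=> hG ht eta0.
(* A pure output state: tensoring with it gives a positive matrix with any prescribed positive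
   marginal on the input. *)
pose w0 : mx R J J := fun s t => (s == s0)%:R * (t == s0)%:R.
have hw0 : psd w0.
  have := psd_rank1 (fun s : J => (s == s0)%:R : C); congr psd.
  by apply: mx_ext => s u; rewrite conj_nat.
have psd_wt (X : mx R I I) : psd X -> psd (fun p q : I * J => X p.1 q.1 * w0 p.2 q.2).
  move=> hX; have := psd_scale_diag (fun p : I * J => (p.2 == s0)%:R) (psd_relabel fst hX).
  by congr psd; apply: mx_ext => p q; rewrite /relabel /w0 conj_nat; ring.
have w0s : \sum_s w0 s s = 1 by rewrite /w0 sum_delta eqxx.
have psd1 : psd (@mid R I).
  by have := psd_gram (@mid R I); rewrite madj1 mmul1x.
have t0 : 0 <= t.
  pose K0 (p q : I * J) : C := @mid R I p.1 q.1 * w0 p.2 q.2.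
  have hK0 : psd K0 by exact: psd_wt.
  have hc : channel (kmap K0).
    apply: channel_kmap => // a b; rewrite /K0 /= -mulr_sumr w0s mulr1 //.
  by apply: le_trans (ht _ hc); apply: Re_ge0; apply: cpair_ge0 => //; exact: channel_lcp.
(* Half of [eta] separates [t'] strictly from [t]; the other half pays for the multiple of the
   identity added to $\sigma$ below, of trace [nn * delta * n]. *)
pose t' := t + eta / 2; have t'0 : 0 < t' by rewrite /t'; lra.
pose nn : R := #|{: I * J}|%:R; pose n : R := #|I|%:R.
have nn0 : 0 <= nn by rewrite ler0n.
have n0 : 0 <= n by rewrite ler0n.
pose delta := eta / 2 / (nn * n + 1).
have dd0 : 0 < nn * n + 1 by rewrite ltr_wpDl // mulr_ge0.
have delta0 : 0 < delta by rewrite /delta divr_gt0 //; lra.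
have deltaE : nn * delta * n <= eta / 2.
  rewrite /delta; have -> : nn * (eta / 2 / (nn * n + 1)) * n = eta / 2 * (nn * n) / (nn * n + 1).
    by field; rewrite gt_eqF.
  rewrite ler_pdivrMr //; have := mulr_ge0 nn0 n0; nra.
pose D (d : mx R (I * J) (I * J)) := exists sigma P,
  [/\ psd sigma, mtr sigma = t'%:C%C, psd P &
   d = fun p q => sigma p.1 q.1 * (p.2 == q.2)%:R - G p q - P p q].
have Dh d : D d -> forall p q, d q p = Num.conj (d p q).
  move=> [sg [P [h1 _ h2 ->]]] p q; rewrite !rmorphB rmorphM /= conj_nat.
  by rewrite (psd_herm p.1 q.1 h1) (psd_herm p q hG) (psd_herm p q h2) eq_sym.
(* If a point of [D] has norm below [delta], adding [nn * delta] times the identity to its $\sigma$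
   gives the required matrix. Otherwise [D] is separated from 0 with margin [delta ^+ 2]. *)
have [[d [Dd]]|hno] := pselect (exists d, D d /\
    ~ (delta ^+ 2 <= \sum_p \sum_q (complex.Re (d p q) ^+ 2 + complex.Im (d p q) ^+ 2))).
  move=> /negP; rewrite -ltNge => small.
  have hb p q : `|d p q| <= delta%:C%C.
    have dE : delta = Num.sqrt (delta ^+ 2) by rewrite sqrtr_sqr ger0_norm // ltW.
    rewrite normc_def lecR [X in _ <= X]dE; apply: ler_wsqrtr.
    apply: le_trans (ltW small); rewrite (bigD1 p) //= (bigD1 q) //= -addrA lerDl addr_ge0 //.
      by apply: sumr_ge0 => q' _; rewrite addr_ge0 // sqr_ge0.
    by apply: sumr_ge0 => p' _; apply: sumr_ge0 => q' _; rewrite addr_ge0 // sqr_ge0.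
  have hp := small_herm_psd (Dh d Dd) hb.
  have [sg [P [h1 h2 h3 dE]]] := Dd.
  exists (fun a b => (nn * delta)%:C%C * @mid R I a b + sg a b); split.
  - by apply: psdD => //; apply: psdZ => //; rewrite ler0c mulr_ge0 // ltW.
  - rewrite mtrD mtrZ h2 ReD Re_rM /=.
    have -> : complex.Re (mtr (@mid R I)) = n.
      rewrite /mtr /mid; under eq_bigr do rewrite eqxx.
      by rewrite sumr_const -[RHS]/(complex.Re ((#|I|%:R : R)%:C%C)) rmorph_nat.
    by rewrite /t'; lra.
  - have := psdD hp h3; congr psd; apply: mx_ext => p q; rewrite dE /mid.
    have -> : (p == q) = (p.1 == q.1) && (p.2 == q.2) by case: p q => ? ? [].
    by rewrite -mulnb natrM; ring.
exfalso; have {hno}big d : D d -> delta ^+ 2 <=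
    \sum_p \sum_q (complex.Re (d p q) ^+ 2 + complex.Im (d p q) ^+ 2).
  by move=> Dd; apply/negPn/negP => h; apply: hno; exists d; split => //; apply/negP.
(* Rank-one choices of $\sigma$ with trace [t']: testing against them bounds the largest eigenvalue
   of the marginal [tau]. *)
have sig_ex v : 0 < complex.Re (\sum_(a : I) Num.conj (v a) * v a) -> 
    let c := t' / complex.Re (\sum_a Num.conj (v a) * v a) in
    psd (fun a b => c%:C%C * (Num.conj (v a) * v b)) /\
    mtr (fun a b => c%:C%C * (Num.conj (v a) * v b)) = t'%:C%C.
  move=> h /=; split.
    apply: psdZ; first by rewrite ler0c divr_ge0 // ltW.
    by have := psd_rank1 (fun a => Num.conj (v a)); congr psd; apply: mx_ext => a b; rewrite conjCK.
  rewrite mtrZ /mtr rmorphM fmorphV /= Re_real; last by apply: sumr_ge0 => a _; exact: mulr_conj_ge0.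
  by rewrite divfK //; apply/eqP => e; move: h; rewrite e ltxx.
have Dne : exists d, D d.
  pose v (a : I) : C := (a == a0)%:R.
  have [|h1 h2] := sig_ex v.
    rewrite /v; under eq_bigr do rewrite conj_nat; by rewrite sum_delta eqxx.
  eexists; eexists; exists (fun _ _ => 0); split; [exact: h1|exact: h2|exact: psd0|reflexivity].
have Dcv X Y u : D X -> D Y -> 0 <= u <= 1 ->
    D (fun i j => u%:C%C * X i j + (1 - u)%:C%C * Y i j).
  move=> [s1 [P1 [a1 b1 c1 ->]]] [s2 [P2 [a2 b2 c2 ->]]] /andP[u0 u1].
  have u0' : 0 <= u%:C%C :> C by rewrite ler0c.
  have u1' : 0 <= (1 - u)%:C%C :> C by rewrite ler0c subr_ge0.
  exists (fun a b => u%:C%C * s1 a b + (1 - u)%:C%C * s2 a b).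
  exists (fun a b => u%:C%C * P1 a b + (1 - u)%:C%C * P2 a b); split.
  - by apply: psdD; exact: psdZ.
  - by rewrite mtrD !mtrZ b1 b2 rmorphB rmorph1 /=; ring.
  - by apply: psdD; exact: psdZ.
  - by apply: mx_ext => p q; rewrite rmorphB rmorph1 /=; ring.
have [H [Hh HP]] := herm_separation Dne Dh Dcv big.
pose K : mx R (I * J) (I * J) := fun p q => - H p q.
have Kh p q : K q p = Num.conj (K p q) by rewrite /K rmorphN /= (Hh p q).
pose pr (X : mx R (I * J) (I * J)) := complex.Re (\sum_p \sum_q K p q * X p q).
have KP sg P : psd sg -> mtr sg = t'%:C%C -> psd P ->
    pr (fun p q => sg p.1 q.1 * (p.2 == q.2)%:R) + delta ^+ 2 <= pr G + pr P.
  move=> h1 h2 h3; have := HP _ (ex_intro _ sg (ex_intro _ P (And4 h1 h2 h3 erefl))).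
  set z := (X in complex.Re X).
  have -> : z = (\sum_p \sum_q K p q * G p q) + (\sum_p \sum_q K p q * P p q)
     - \sum_p \sum_q K p q * (sg p.1 q.1 * (p.2 == q.2)%:R).
    rewrite /z -big_split -sumrB; apply: eq_bigr => p _ /=.
    by rewrite -big_split -sumrB; apply: eq_bigr => q _ /=; rewrite /K; ring.
  by rewrite ReB ReD /pr; lra.
(* [P] may be scaled up freely, so the functional is nonnegative on every rank-one positive
   matrix. *)
have hK : psd K.
  apply: psd_herm_form => // v.
  have [d [sg [_ [h1 h2 _ _]]]] := Dne.
  apply: (@lin_bound (pr G - pr (fun p q => sg p.1 q.1 * (p.2 == q.2)%:R))) => s s_ge0.
  pose P0 : mx R (I * J) (I * J) := fun p q => Num.conj (v p) * v q.
  have hP0 : psd P0.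
    by have := psd_rank1 (fun a => Num.conj (v a)); congr psd; apply: mx_ext => a b; rewrite conjCK.
  have hP : psd (fun p q => s%:C%C * P0 p q) by apply: psdZ => //; rewrite ler0c.
  have := KP _ _ h1 h2 hP.
  have -> : pr (fun p q => s%:C%C * P0 p q) = s * complex.Re (\sum_i \sum_j Num.conj (v i) * K i j * v j).
    rewrite /pr -Re_rM mulr_sumr; congr complex.Re; apply: eq_bigr => p _.
    by rewrite mulr_sumr; apply: eq_bigr => q _; rewrite /P0; ring.
  have := sqr_ge0 delta; lra.
have pr0 : pr (fun _ _ => 0) = 0.
  by rewrite /pr big1 // => p _; rewrite big1 // => q _; rewrite mulr0.
(* Only half of the margin is spent: [pr G] may equal [delta ^+ 2], and [c] has to be strictly
   positive to be divided by. *)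
pose c := (pr G - delta ^+ 2 / 2) / t'.
pose tau : mx R I I := fun a b => \sum_s K (a, s) (b, s).
have htau : psd tau.
  by apply: psd_sum => s _; exact: (psd_relabel (fun a => (a, s)) hK).
have form_tau v : complex.Re (\sum_a \sum_b Num.conj (v a) * tau a b * v b) <=
    c * complex.Re (\sum_a Num.conj (v a) * v a).
  set nv := complex.Re (\sum_a Num.conj (v a) * v a).
  have nv0 : 0 <= nv by apply: Re_ge0; apply: sumr_ge0 => a _; exact: mulr_conj_ge0.
  have [nv1|nv1] := ltP 0 nv; last first.
    have nvE : nv = 0 by apply/eqP; rewrite eq_le nv1 nv0.
    have vE a : v a = 0.
      have : \sum_a Num.conj (v a) * v a = 0.
        rewrite -[LHS]Re_real ?[complex.Re _]nvE //; first by apply: sumr_ge0 => b _; exact: mulr_conj_ge0.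
      move=> /eqP; rewrite psumr_eq0 => [|b _]; last exact: mulr_conj_ge0.
      by move=> /allP/(_ a (mem_index_enum _))/=; rewrite mulf_eq0 conjC_eq0 orbb => /eqP.
    rewrite nvE mulr0 big1 // => a _; rewrite big1 // => b _.
    by rewrite (vE b) mulr0.
  have [h1 h2] := sig_ex v nv1; have := KP _ _ h1 h2 (@psd0 R _); rewrite pr0 addr0.
  have -> : pr (fun p q => (t' / nv)%:C%C * (Num.conj (v p.1) * v q.1) * (p.2 == q.2)%:R) =
     t' / nv * complex.Re (\sum_a \sum_b Num.conj (v a) * tau a b * v b).
    rewrite /pr -Re_rM; congr complex.Re; rewrite mulr_sumr sum_pair.
    apply: eq_bigr => a _ /=; rewrite mulr_sumr.
    under eq_bigr => s _ do rewrite sum_pair /=.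
    rewrite exchange_big; apply: eq_bigr => b _ /=; rewrite /tau mulr_sumr mulr_suml mulr_sumr.
    apply: eq_bigr => s _.
    rewrite (eq_bigr (fun u => (s == u)%:R * (K (a, s) (b, u) *
       ((t' / nv)%:C%C * (Num.conj (v a) * v b))))); last by move=> u _; ring.
    by rewrite sum_deltaV; ring.
  rewrite -/nv; move: (complex.Re _) => x h.
  have hx : t' / nv * x <= pr G - delta ^+ 2 by move: h; lra.
  have : x * t' <= (pr G - delta ^+ 2) * nv.
    by have := ler_pM2r nv1 (t' / nv * x) (pr G - delta ^+ 2); rewrite hx mulrAC divfK ?gt_eqF // mulrC => ->.
  move=> {}hx; rewrite /c mulrAC ler_pdivlMr //; apply: le_trans hx _.
  rewrite ler_pM2r //; have := sqr_ge0 delta; lra.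
have c0 : 0 < c.
  have [_ [sg [_ [h1 h2 _ _]]]] := Dne.
  have := KP _ _ h1 h2 (@psd0 R _); rewrite pr0 addr0 => h.
  have h0 : 0 <= pr (fun p q => sg p.1 q.1 * (p.2 == q.2)%:R).
    by apply: Re_ge0; apply: psd_pr_ge0 => //; exact: psd_tens1.
  rewrite /c divr_gt0 //; have : 0 < delta ^+ 2 by rewrite exprn_gt0.
  lra.
have hct : psd (fun a b => c%:C%C * @mid R I a b - tau a b).
  apply: psd_herm_form => [a b|v].
    by rewrite conj_affine conj_nat (psd_herm a b htau) /mid eq_sym.
  have -> : \sum_a \sum_b Num.conj (v a) * (c%:C%C * @mid R I a b - tau a b) * v b =
     c%:C%C * (\sum_a Num.conj (v a) * v a) - \sum_a \sum_b Num.conj (v a) * tau a b * v b.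
    rewrite mulr_sumr -sumrB; apply: eq_bigr => a _.
    rewrite (eq_bigr (fun b => (a == b)%:R * (c%:C%C * (Num.conj (v a) * v b)) -
       Num.conj (v a) * tau a b * v b)); last by move=> b _; rewrite /mid; ring.
    by rewrite sumrB sum_deltaV.
  by rewrite ReB Re_rM subr_ge0.
(* The deficit of the marginal, placed on the pure output state: $K+W$ has marginal $c\cdot1$, so
   dividing by [c] gives a channel. *)
pose W : mx R (I * J) (I * J) := fun p q => (c%:C%C * @mid R I p.1 q.1 - tau p.1 q.1) * w0 p.2 q.2.
have hW : psd W by exact: (psd_wt _ hct).
pose K2 : mx R (I * J) (I * J) := fun p q => (c^-1)%:C%C * (K p q + W p q).
have ci0 : 0 <= (c^-1)%:C%C :> C by rewrite ler0c invr_ge0 ltW.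
have hK2 : psd K2 by apply: psdZ => //; exact: psdD.
have cK2 : channel (kmap K2).
  apply: channel_kmap => // a b; rewrite /K2 -mulr_sumr big_split /= -/(tau a b).
  rewrite /W /= -mulr_sumr w0s mulr1 addrC subrK mulrA -rmorphM /= mulVf ?gt_eqF //.
  by rewrite mul1r.
have := ht _ cK2; rewrite cpair_kmap.
have -> : \sum_p \sum_q G p q * K2 p q = (c^-1)%:C%C *
   ((\sum_p \sum_q K p q * G p q) + \sum_p \sum_q G p q * W p q).
  rewrite -big_split mulr_sumr; apply: eq_bigr => p _ /=.
  by rewrite -big_split mulr_sumr; apply: eq_bigr => q _ /=; rewrite /K2; ring.
rewrite Re_rM ReD -/(pr G) ler_pdivrMl // => h.
have := Re_ge0 (psd_pr_ge0 hG hW).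
have e1 : c * t' = pr G - delta ^+ 2 / 2 by rewrite /c divfK ?gt_eqF.
have d2 : 0 < delta ^+ 2 by rewrite exprn_gt0.
have : c * t <= c * t' by rewrite ler_pM2l // /t'; lra.
move: h; lra.
Qed.

End Duality.

(** * Positive functionals and the diamond norm *)

Section DiamondNorm.
Variable R : realType.
Local Notation C := (R[i]).
Implicit Types (I J K L : finType).

(** The shift by [eta] makes the factor invertible. Any [s] with this $ss^\dagger$ serves as a
    square root, and $V\,\mathrm{diag}(\sqrt{\eta+q})$ is the simplest. *)
Lemma pos_factor I (X : mx R I I) (eta : R) : psd X -> 0 < eta ->
  exists s s' : mx R I I, [/\ mmul s s' = @mid R I, mmul s' s = @mid R I &
    mmul s (madj s) = fun a b => eta%:C%C * @mid R I a b + X a b].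
Proof.
move=> /psd_spectral[V [q [hq V1 V2 ->]]] eta0.
pose r k := sqrtC (eta%:C%C + q k).
have qe k : 0 < eta%:C%C + q k by rewrite ltr_wpDr // ltcR.
have r0 k : r k != 0 by rewrite sqrtC_eq0 gt_eqF.
have rc k : Num.conj (r k) = r k by apply/CrealP; rewrite ger0_real // sqrtC_ge0 ltW.
have rr k : r k * r k = eta%:C%C + q k by rewrite -expr2 sqrtCK.
exists (fun i k => V i k * r k), (fun k i => (r k)^-1 * Num.conj (V i k)); split.
- rewrite -V1; apply: mx_ext => i j; apply: eq_bigr => k _; rewrite /madj.
  by rewrite -mulrA (mulrA (r k)) mulfV // mul1r.
- apply: mx_ext => k l; rewrite /mmul.
  transitivity ((r k)^-1 * mmul (madj V) V k l * r l).
    by rewrite /mmul mulr_sumr mulr_suml; apply: eq_bigr => i _; rewrite /madj; ring.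
  rewrite V2 /mid; have [->|_] := eqVneq k l; first by rewrite mulr1 mulVf.
  by rewrite mulr0 mul0r.
- apply: mx_ext => i j; rewrite -V1 /mmul /madj mulr_sumr -big_split /=.
  apply: eq_bigr => k _; rewrite rmorphM /= rc.
  transitivity ((r k * r k) * (V i k * Num.conj (V j k))); first ring.
  rewrite rr; ring.
Qed.

Definition lin_fun I J (F : Lmap R I J -> C) := forall (a : C) (Phi Psi : Lmap R I J),
  F (fun X i j => a * Phi X i j + Psi X i j) = a * F Phi + F Psi.

Lemma lin_fun_sum I J K (F : Lmap R I J -> C) (c : K -> C) (Phi : K -> Lmap R I J) :
  lin_fun F -> F (fun X i j => \sum_k c k * Phi k X i j) = \sum_k c k * F (Phi k).
Proof.
move=> hF; have F0 : F (fun _ _ _ => 0) = 0.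
  have := hF (-1) (fun _ _ _ => 0) (fun _ _ _ => 0).
  rewrite (_ : (fun _ _ _ => -1 * 0 + 0) = fun _ _ _ => 0); last first.
    by apply/funext => X; apply: mx_ext => i j; rewrite mulr0 addr0.
  by move->; ring.
suff hs (s : seq K) : F (fun X i j => \sum_(k <- s) c k * Phi k X i j)
   = \sum_(k <- s) c k * F (Phi k) by exact: hs.
elim: s => [|k s IH].
  rewrite big_nil -[RHS]F0; congr F; apply/funext => X; apply: mx_ext => i j.
  by rewrite big_nil.
rewrite big_cons -IH -hF; congr F; apply/funext => X; apply: mx_ext => i j.
by rewrite big_cons.
Qed.

(** A linear map is the combination of the maps [kmap (munit p q)] with its Choi entries as
    coefficients. *)
Lemma lin_fun_repr I J (F : Lmap R I J -> C) (Phi : Lmap R I J) : lin_fun F -> lin_map Phi ->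
  F Phi = \sum_p \sum_q F (kmap (munit p q)) * jmx Phi p q.
Proof.
move=> hF hP; transitivity (\sum_u jmx Phi u.1 u.2 * F (kmap (munit u.1 u.2))).
  rewrite -lin_fun_sum //; congr F; rewrite -{1}(kmap_jmx hP).
  apply/funext => X; apply: mx_ext => s t; rewrite /kmap.
  under [RHS]eq_bigr do rewrite mulr_sumr.
  rewrite exchange_big; apply: eq_bigr => p _ /=.
  rewrite {1}(munit_sum (jmx Phi)) mulr_sumr; apply: eq_bigr => u _; ring.
by rewrite sum_pair; apply: eq_bigr => p _; apply: eq_bigr => q _; rewrite mulrC.
Qed.

Lemma psd_trnorm I (X : mx R I I) : psd X -> trnorm X <= complex.Re (mtr X).
Proof.
move=> hX; have h : psd (blk X X X).
  have := psd_relabel (@snd bool I) hX; congr psd.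
  by apply/funext => -[[] i]; apply/funext => -[[] j] //; rewrite /blk /= (psd_madj hX).
by have := blk_trnorm h; rewrite ReD; lra.
Qed.

(** With $G=(s\otimes1)E(s\otimes1)^\dagger$ and $ss^\dagger=\eta+\sigma$, the difference
    $F(\Phi)-F(\Psi)$ becomes $-\tau\,\mathrm{Tr}(E^TY)$, where $\tau=\mathrm{Tr}\,ss^\dagger$ and
    $Y$ is the image under $\Psi-\Phi$ of the pure state with amplitudes proportional to the entries
    of $s$. By [traceless_pair_le] the real part is at most $\tau\mu/2$. *)
Lemma lin_fun_dnorm I J (F : Lmap R I J -> C) (t mu : R) (a0 : I) (s0 : J)
    (Phi Psi : Lmap R I J) :
  lin_fun F -> (forall P, lcp P -> 0 <= F P) ->
  (forall g, channel g -> complex.Re (F g) <= t) -> 0 <= mu ->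
  channel Phi -> channel Psi -> (dnorm (map_sub Psi Phi) <= mu%:E)%E ->
  complex.Re (F Phi) <= complex.Re (F Psi) + mu / 2 * t.
Proof.
move=> hF F0 Ft mu0 cPhi cPsi hd.
have [lPhi kPhi tPhi] := cPhi; have [lPsi kPsi tPsi] := cPsi.
pose G p q := F (kmap (munit p q)).
have FE X : lin_map X -> F X = \sum_p \sum_q G p q * jmx X p q by exact: lin_fun_repr.
have hG : psd G.
  move=> v; have := F0 (kmap (fun p q => Num.conj (v p) * v q)).
  rewrite FE ?jmx_kmap; last exact: lin_kmap.
  have hp : psd (fun p q => Num.conj (v p) * v q).
    by have := psd_rank1 (fun a => Num.conj (v a)); congr psd; apply: mx_ext => a b; rewrite conjCK.
  move=> /(_ (conj (lin_kmap _) (cp_kmap hp))); congr (_ <= _).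
  by apply: eq_bigr => p _; apply: eq_bigr => q _; ring.
have Gt g : channel g -> complex.Re (cpair G g) <= t.
  by move=> hg; have [lg _ _] := hg; rewrite cpairE // -FE //; exact: Ft.
(* The trace of $\eta+\sigma$ exceeds [t] by at most $\eta(1+|I|)$; [eta] is then made small. *)
suff key eta : 0 < eta -> complex.Re (F Phi) <= complex.Re (F Psi) +
    mu / 2 * (t + eta * (1 + #|I|%:R)).
  apply/ler_addgt0Pr => e e0; pose c := mu / 2 * (1 + #|I|%:R).
  have c0 : 0 <= c by rewrite mulr_ge0 // ?divr_ge0 // addr_ge0 // ler0n.
  have eta0 : 0 < e / (c + 1) by rewrite divr_gt0 // ltr_wpDl.
  apply: le_trans (key _ eta0) _.
  have : e / (c + 1) * c <= e.
    by rewrite mulrAC ler_pdivrMr ?ltr_wpDl // ler_pM2l // lerDl.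
  have -> : mu / 2 * (t + e / (c + 1) * (1 + #|I|%:R)) = mu / 2 * t + e / (c + 1) * c.
    by rewrite [in RHS]/c; move: (e / _) => x; ring.
  by rewrite addrA lerD2l.
move=> eta0.
have [sg [hsg tsg hsG]] := cond_dnorm_dual a0 s0 hG Gt eta0.
have [s [s' [ss' s's ssE]]] := pos_factor hsg eta0.
pose T (x : mx R I I) : mx R (I * J) (I * J) := fun p q => x p.1 q.1 * (p.2 == q.2)%:R.
have TM x y : mmul (T x) (T y) = T (mmul x y).
  apply: mx_ext => p q; rewrite /mmul /T sum_pair mulr_suml; apply: eq_bigr => a _ /=.
  rewrite (eq_bigr (fun j => (p.2 == j)%:R * (x p.1 a * y a q.1 * (j == q.2)%:R))).
    by rewrite sum_deltaV.
  by move=> j _; ring.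
have TA x : madj (T x) = T (madj x).
  by apply: mx_ext => p q; rewrite /madj /T rmorphM /= conj_nat eq_sym.
have T1 : T (@mid R I) = @mid R (I * J)%type.
  by apply: mx_ext => p q; rewrite /T /mid -natrM mulnb.
pose S := T s'; pose E := mmul S (mmul G (madj S)).
have hE : psd E by exact: psd_congr.
have SU : mmul S (mmul (T (mmul s (madj s))) (madj S)) = @mid R (I * J)%type.
  rewrite /S TA !TM -!mmulA -madj_mul s's madj1 mmulx1 s's; exact: T1.
(* $G\le\sigma\otimes1\le ss^\dagger\otimes1$, and conjugation by [S] sends the last matrix to 1. *)
have hE1 : psd (fun p q => @mid R (I * J)%type p q - E p q).
  rewrite -SU /E.
  have h : psd (fun p q => T (mmul s (madj s)) p q - G p q).
    have hT : psd (T (@mid R I)).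
      by rewrite T1; have := psd_gram (@mid R (I * J)%type); rewrite madj1 mmul1x.
    have := psdD (psdZ (_ : 0 <= eta%:C%C) hT) hsG; move=> /(_ _)/wrap[|]; first by rewrite ler0c ltW.
    by congr psd; apply: mx_ext => p q; rewrite ssE /T; ring.
  by have := psd_congr S h; congr psd; rewrite mmulBl mmulBr.
have GE : G = mmul (T s) (mmul E (madj (T s))).
  rewrite /E /S -!mmulA -madj_mul !mmulA TM ss' T1 mmul1x.
  by rewrite madj1 mmulx1.
pose tau : R := complex.Re (mtr sg) + eta * #|I|%:R.
have trs : mtr (mmul s (madj s)) = tau%:C%C.
  rewrite ssE mtrD mtrZ /tau rmorphD rmorphM rmorph_nat /= Re_real; last first.
    by apply: sumr_ge0 => a _; exact: psd_diag_ge0.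
  rewrite addrC; congr (_ + _ * _); rewrite /mtr /mid.
  by under eq_bigr do rewrite eqxx; rewrite sumr_const.
have n1 : (1 : R) <= #|I|%:R by rewrite ler1n; apply/card_gt0P; exists a0.
have sg0 : 0 <= complex.Re (mtr sg).
  by apply: Re_ge0; apply: sumr_ge0 => a _; exact: psd_diag_ge0.
have tau0 : 0 < tau by rewrite /tau; nra.
(* Rows of [s] become the system and columns the ancilla: [X] is a pure state with system marginal
   $ss^\dagger/\tau$. *)
pose x (p : I * I) : C := s p.2 p.1.
pose X : mx R (I * I) (I * I) := fun p q => (tau^-1)%:C%C * (x p * Num.conj (x q)).
have hX : psd X by apply: psdZ; [rewrite ler0c invr_ge0 ltW | exact: psd_rank1].
have tX : mtr X = 1.
  rewrite mtrZ; have -> : mtr (fun p q => x p * Num.conj (x q)) = mtr (mmul s (madj s)).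
    by rewrite /mtr sum_pair exchange_big.
  by rewrite trs -rmorphM /= mulVf ?gt_eqF.
have nX : trnorm X <= 1 by have := psd_trnorm hX; rewrite tX.
pose Del := map_sub Psi Phi.
have lD : lin_map Del.
  by move=> a U V; apply: mx_ext => i j; rewrite /Del /map_sub lPsi lPhi; ring.
pose Y := idt (K:=I) Del X.
have nY : trnorm Y <= mu.
  rewrite -lee_fin; apply: le_trans hd; apply: ereal_sup_ubound.
  by exists X.
have tY : mtr Y = 0.
  rewrite /Y (@mtr_idt _ _ _ _ _ 0) ?mul0r // => Z.
  by rewrite /Del /map_sub mtrB tPsi tPhi subrr mul0r.
have hE' : psd (fun p q => E q p) by exact: psd_tr.
have hE1' : psd (fun p q => @mid R (I * J)%type p q - E q p).
  have := psd_tr hE1; congr psd; apply: mx_ext => p q; by rewrite /mid eq_sym.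
have key := traceless_pair_le hE' hE1' tY.
have FD : F Phi - F Psi = - (tau%:C%C * mtr (mmul (fun p q => E q p) Y)).
  rewrite !FE //.
  transitivity (- \sum_p \sum_q G p q * jmx Del p q).
    rewrite -sumrB -sumrN; apply: eq_bigr => p _; rewrite -sumrB -sumrN.
    by apply: eq_bigr => q _; rewrite /jmx /Del /map_sub; ring.
  congr (- _); rewrite {1}GE.
  have -> : mtr (mmul (fun p q => E q p) Y) = \sum_p \sum_q E p q * Y p q.
    by rewrite /mtr /mmul exchange_big.
  have YE p q : tau%:C%C * Y p q = \sum_p' \sum_q' T s p' p * Num.conj (T s q' q) * jmx Del p' q'.
    rewrite /Y /idt (lin_mapE _ _ _ lD) mulr_sumr sum_pair sum_pair.
    apply: eq_bigr => a _ /=.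
    under [RHS]eq_bigr => u _ do rewrite sum_pair exchange_big /=.
    transitivity (\sum_u (u == p.2)%:R * \sum_b s a p.1 * Num.conj (s b q.1) * jmx Del (a, u) (b, q.2)).
      rewrite sum_delta; apply: eq_bigr => b _; rewrite /X /x /jmx /=.
      rewrite mulrA mulrA -rmorphM /= mulfV ?gt_eqF // mul1r; ring.
    apply: eq_bigr => u _; rewrite mulr_sumr.
    transitivity (\sum_v (v == q.2)%:R * \sum_b T s (a, u) p * Num.conj (s b q.1) * jmx Del (a, u) (b, v)).
      by rewrite sum_delta; apply: eq_bigr => b _; rewrite /T /=; ring.
    apply: eq_bigr => v _; rewrite mulr_sumr; apply: eq_bigr => b _.
    by rewrite /T /= rmorphM /= conj_nat; ring.
  rewrite mulr_sumr.
  transitivity (\sum_p \sum_q \sum_p' \sum_q' T s p p' * E p' q' * Num.conj (T s q q') * jmx Del p q).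
    apply: eq_bigr => p _; apply: eq_bigr => q _; rewrite /mmul mulr_suml.
    apply: eq_bigr => p' _; rewrite mulr_sumr mulr_suml; apply: eq_bigr => q' _.
    by rewrite /madj; ring.
  transitivity (\sum_p' \sum_q' \sum_p \sum_q T s p p' * E p' q' * Num.conj (T s q q') * jmx Del p q).
    under eq_bigr => p _ do rewrite exchange_big /=.
    rewrite exchange_big; apply: eq_bigr => p' _ /=.
    under eq_bigr => p _ do rewrite exchange_big /=.
    by rewrite exchange_big.
  apply: eq_bigr => p' _; rewrite mulr_sumr; apply: eq_bigr => q' _.
  rewrite mulrCA YE [RHS]mulr_sumr; apply: eq_bigr => p _; rewrite [RHS]mulr_sumr.
  by apply: eq_bigr => q _; ring.
have := congr1 (@complex.Re R) FD; rewrite ReB ReN Re_rM => e.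
have htau : tau <= t + eta * (1 + #|I|%:R) by rewrite /tau; lra.
have : complex.Re (F Phi) - complex.Re (F Psi) <= tau * (mu / 2).
  by rewrite e -mulrN ler_pM2l //; apply: le_trans key _; rewrite ler_pM2r // invr_gt0.
have : tau * (mu / 2) <= (t + eta * (1 + #|I|%:R)) * (mu / 2).
  by apply: ler_wpM2r => //; rewrite divr_ge0.
by lra.
Qed.

(** Both maps are applied to a positive completion of [X], and the off-diagonal blocks of the image
    under [L] get a minus sign. The sum is a positive completion of the image of [X] under the
    difference, with diagonal trace [2 * k] times the old one. *)
Lemma dnorm_le I J (P L : Lmap R I J) (k : R) : lcp P -> lcp L ->
  (forall X, mtr (P X) = k%:C%C * mtr X) -> (forall X, mtr (L X) = k%:C%C * mtr X) -> 0 <= k ->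
  (dnorm (map_sub P L) <= (2 * k)%:E)%E.
Proof.
move=> hP hL tP tL k0; apply: ge_ereal_sup => _ [X hX <-]; rewrite lee_fin.
have [A [B [hM tAB]]] := trnorm_blk X.
pose P' := idt (K:=I) P; pose L' := idt (K:=I) L.
have h1 : psd (idt (K:=bool) P' (blk A X B)).
  by have [_ c] := lcp_idt I hP; exact: c.
have h2 : psd (idt (K:=bool) L' (blk A X B)).
  by have [_ c] := lcp_idt I hL; exact: c.
pose c (p : bool * (I * J)) : C := if p.1 then 1 else -1.
have h : psd (blk (fun i j => P' A i j + L' A i j) (idt (K:=I) (map_sub P L) X)
    (fun i j => P' B i j + L' B i j)).
  have := psdD h1 (psd_scale_diag c h2); congr psd.
  apply/funext => -[[] i]; apply/funext => -[[] j]; rewrite /c /blk /=.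
  - by rewrite rmorph1 mul1r mulr1.
  - by rewrite rmorphN rmorph1 mul1r mulrN mulr1.
  - rewrite (psd_herm (true, j) (false, i) h1) (psd_herm (true, j) (false, i) h2).
    by rewrite rmorph1 mulr1 mulN1r /madj /idt /map_sub rmorphB.
  - by rewrite rmorphN rmorph1 mulN1r mulrN mulr1 opprK.
have := blk_trnorm h; rewrite !mtrD.
have tP' Y : mtr (P' Y) = k%:C%C * mtr Y by exact: mtr_idt.
have tL' Y : mtr (L' Y) = k%:C%C * mtr Y by exact: mtr_idt.
rewrite !tP' !tL'.
have -> : k%:C%C * mtr A + k%:C%C * mtr A + (k%:C%C * mtr B + k%:C%C * mtr B) =
   k%:C%C * ((4 * trnorm X)%:C%C).
  rewrite rmorphM rmorph_nat; have -> : (4 * (trnorm X)%:C%C = 2 * (2 * (trnorm X)%:C%C) :> C) by ring.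
  rewrite -tAB; ring.
rewrite Re_rM /=; have : k * trnorm X <= k by rewrite ler_piMr.
move: (trnorm _) (trnorm _) => x y; lra.
Qed.

End DiamondNorm.

(** * LOCC instruments: composition, local operations, ancillas *)

Section LOCC.
Variable R : realType.
Local Notation C := (R[i]).
Implicit Types (I J K L O T U XA XB YA YB ZA ZB KA KB : finType).

Lemma sum_unit (S : nmodType) (F : unit -> S) : \sum_u F u = F tt.
Proof. by rewrite (bigD1 tt) //= big1 ?addr0 // => -[]. Qed.

Lemma big_sigT (S : nmodType) O1 (O2 : O1 -> finType) (P : pred {x : O1 & O2 x})
    (F : {x : O1 & O2 x} -> S) :
  \sum_(p | P p) F p = \sum_x \sum_(o : O2 x | P (Tagged O2 o)) F (Tagged O2 o).
Proof.
rewrite (sig_big_dep (fun=> true) (fun x o => P (Tagged O2 o)) (fun x o => F (Tagged O2 o))) /=.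
by apply: eq_big => -[x o].
Qed.

Lemma locc_inst_instrument XA XB YA YB O (G : O -> Lmap R (XA * XB) (YA * YB)) :
  locc_inst G -> instrument G.
Proof.
elim=> {XA XB YA YB O G}.
- move=> XA XB; split=> [_|X]; first exact: lcp_id.
  by congr mtr; apply: mx_ext => i j; rewrite sum_unit.
- move=> XA XB ZA YA YB O1 E O2 F [hE tE] _ IH; split=> [p|X].
    by apply: lcp_comp; [apply: lcp_tid; exact: hE | exact: (IH _).1].
  rewrite mtr_sum big_sigT /=.
  transitivity (\sum_x mtr (tid (K:=XB) (E x) X)).
    apply: eq_bigr => x _; have := (IH x).2 (tid (K:=XB) (E x) X).
    by rewrite mtr_sum.
  by rewrite -mtr_sum; exact: (@tp_tid R XB _ _ _ tE X).
- move=> XA XB ZB YA YB O1 E O2 F [hE tE] _ IH; split=> [p|X].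
    by apply: lcp_comp; [apply: lcp_idt; exact: hE | exact: (IH _).1].
  rewrite mtr_sum big_sigT /=.
  transitivity (\sum_x mtr (idt (K:=XA) (E x) X)).
    apply: eq_bigr => x _; have := (IH x).2 (idt (K:=XA) (E x) X).
    by rewrite mtr_sum.
  by rewrite -mtr_sum; exact: (@tp_idt R XA _ _ _ tE X).
Qed.

(* LOCC instruments up to coarse-graining: unlike [locc_inst], closed under relabelling
   of the outcomes, with LOCC channels as the case [T = unit]. *)
Definition locc_fam XA XB YA YB T (G : T -> Lmap R (XA * XB) (YA * YB)) :=
  exists (O : finType) (G' : O -> Lmap R (XA * XB) (YA * YB)) (f : O -> T),
    locc_inst G' /\ forall t, G t = fun X i j => \sum_(o | f o == t) G' o X i j.

Lemma locc_fam_instrument XA XB YA YB T (G : T -> Lmap R (XA * XB) (YA * YB)) :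
  locc_fam G -> instrument G.
Proof.
move=> [O [G' [f [/locc_inst_instrument[h t] GE]]]]; split=> [u|X].
  by rewrite GE; apply: lcp_sum => o _; exact: h.
rewrite -[RHS]t; congr mtr; apply: mx_ext => i j.
by rewrite [RHS](partition_big f xpredT) //=; apply: eq_bigr => u _; rewrite GE.
Qed.

Lemma locc_fam_inst XA XB YA YB O (G : O -> Lmap R (XA * XB) (YA * YB)) :
  locc_inst G -> locc_fam G.
Proof.
move=> h; exists O, G, id; split => // t; apply/funext => X; apply: mx_ext => i j.
by rewrite (big_pred1 t).
Qed.

Lemma locc_fam_coarse XA XB YA YB T U (h : T -> U) (G : T -> Lmap R (XA * XB) (YA * YB)) :
  locc_fam G -> locc_fam (fun u X i j => \sum_(t | h t == u) G t X i j).
Proof.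
move=> [O [G' [f [hG GE]]]]; exists O, G', (h \o f); split => // u.
apply/funext => X; apply: mx_ext => i j.
rewrite [RHS](partition_big f (fun t => h t == u)) //=; apply: eq_bigr => t /eqP <-.
rewrite GE; apply: eq_bigl => o; case: eqP => [->|]; by rewrite ?eqxx ?andbF.
Qed.

(** A protocol step needs one [locc_inst] per outcome, with an outcome type that depends on it;
    bundling type and data in one sigma type lets functional choice apply. *)
Lemma locc_fam_choice O XA XB YA YB T (G : O -> T -> Lmap R (XA * XB) (YA * YB)) :
  (forall o, locc_fam (G o)) ->
  exists (Q : O -> finType) (G' : forall o, Q o -> Lmap R (XA * XB) (YA * YB))
    (f : forall o, Q o -> T), forall o, locc_inst (G' o) /\
    forall t, G o t = fun X i j => \sum_(u | f o u == t) G' o u X i j.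
Proof.
pose S := {Q : finType & ((Q -> Lmap R (XA * XB) (YA * YB)) * (Q -> T))%type}.
move=> h; have hs o : exists y : S, locc_inst (projT2 y).1 /\
    forall t, G o t = fun X i j => \sum_(u | (projT2 y).2 u == t) (projT2 y).1 u X i j.
  by have [Q [G' [f hf]]] := h o; exists (existT _ Q (G', f)).
have [y yP] := boolp.choice hs.
exists (fun o => projT1 (y o)), (fun o => (projT2 (y o)).1), (fun o => (projT2 (y o)).2).
exact: yP.
Qed.

(** Sequential composition with feed-forward, by induction on the first protocol: the continuation
    [K o] is grafted at the leaf [o]. [K] is quantified inside the induction because each branch has
    its own outcome type. *)
Lemma locc_inst_bind XA XB YA YB O (G : O -> Lmap R (XA * XB) (YA * YB)) :
  locc_inst G -> forall ZA ZB T (K : O -> T -> Lmap R (YA * YB) (ZA * ZB)),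
  (forall o, locc_fam (K o)) ->
  locc_fam (fun t X i j => \sum_o K o t (G o X) i j).
Proof.
elim=> {XA XB YA YB O G}.
- move=> XA XB ZA ZB T K hK; have [O [G' [f [h1 h2]]]] := hK tt.
  exists O, G', f; split => // t; rewrite -h2; apply/funext => X; apply: mx_ext => i j.
  by rewrite sum_unit.
- move=> XA XB ZA' YA YB O1 E O2 F hE _ IH ZA ZB T K hK.
  have [Q [G' [f hf]]] := locc_fam_choice (fun x => IH x ZA ZB T
    (fun o => K (Tagged O2 o)) (fun o => hK (Tagged O2 o))).
  exists {x : O1 & Q x}; eexists; exists (fun p => f (tag p) (tagged p)); split.
    exact: (locc_stepA hE (fun x => (hf x).1)).
  move=> t; apply/funext => X; apply: mx_ext => i j; rewrite !big_sigT /=.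
  apply: eq_bigr => x _; have := (hf x).2 t => /(congr1 (fun H => H (tid (K:=XB) (E x) X) i j)).
  by [].
- move=> XA XB ZB' YA YB O1 E O2 F hE _ IH ZA ZB T K hK.
  have [Q [G' [f hf]]] := locc_fam_choice (fun x => IH x ZA ZB T
    (fun o => K (Tagged O2 o)) (fun o => hK (Tagged O2 o))).
  exists {x : O1 & Q x}; eexists; exists (fun p => f (tag p) (tagged p)); split.
    exact: (locc_stepB hE (fun x => (hf x).1)).
  move=> t; apply/funext => X; apply: mx_ext => i j; rewrite !big_sigT /=.
  apply: eq_bigr => x _; have := (hf x).2 t => /(congr1 (fun H => H (idt (K:=XA) (E x) X) i j)).
  by [].
Qed.

Lemma locc_fam_bind XA XB YA YB ZA ZB T U (G : T -> Lmap R (XA * XB) (YA * YB))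
    (K : T -> U -> Lmap R (YA * YB) (ZA * ZB)) :
  locc_fam G -> (forall t, locc_fam (K t)) ->
  locc_fam (fun u X i j => \sum_t K t u (G t X) i j).
Proof.
move=> [O [G' [f [hG GE]]]] hK.
have := locc_inst_bind hG (fun o => hK (f o)); congr locc_fam.
apply/funext => u; apply/funext => X; apply: mx_ext => i j.
rewrite [LHS](partition_big f xpredT) //=; apply: eq_bigr => t _.
have [l _] := (locc_fam_instrument (hK t)).1 u.
by rewrite GE lin_map_sum //; apply: eq_bigr => o /eqP <-.
Qed.

Lemma locc_channelP XA XB YA YB (Phi : Lmap R (XA * XB) (YA * YB)) :
  locc_channel Phi <-> locc_fam (fun _ : unit => Phi).
Proof.
split=> [[O [G [hG h]]]|[O [G [f [hG h]]]]].
  exists O, G, (fun=> tt); split => // -[]; apply/funext => X; rewrite h.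
  by apply: mx_ext => i j; apply: eq_bigl => o; rewrite eqxx.
exists O, G; split => // X; rewrite (h tt); apply: mx_ext => i j.
by apply: eq_bigl => o; case: (f o); rewrite eqxx.
Qed.

Lemma locc_channel_channel XA XB YA YB (Phi : Lmap R (XA * XB) (YA * YB)) :
  locc_channel Phi -> channel Phi.
Proof.
move=> /locc_channelP/locc_fam_instrument[/(_ tt)[l c] t]; split => // X.
by rewrite -[RHS]t; congr mtr; apply: mx_ext => i j; rewrite sum_unit.
Qed.

Lemma locc_fam_then XA XB YA YB ZA ZB T (G : T -> Lmap R (XA * XB) (YA * YB))
    (K : T -> Lmap R (YA * YB) (ZA * ZB)) :
  locc_fam G -> (forall t, locc_channel (K t)) ->
  locc_channel (fun X i j => \sum_t K t (G t X) i j).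
Proof.
move=> hG hK; apply/locc_channelP.
exact: (locc_fam_bind hG (fun t => (locc_channelP (K t)).1 (hK t))).
Qed.

Lemma locc_fam_after XA XB YA YB ZA ZB T (Phi : Lmap R (XA * XB) (YA * YB))
    (K : T -> Lmap R (YA * YB) (ZA * ZB)) :
  locc_channel Phi -> locc_fam K -> locc_fam (fun t X => K t (Phi X)).
Proof.
move=> /locc_channelP hP hK; have := locc_fam_bind hP (fun=> hK); congr locc_fam.
apply/funext => t; apply/funext => X; apply: mx_ext => i j.
by rewrite sum_unit.
Qed.

Lemma locc_channel_comp XA XB YA YB ZA ZB (Phi : Lmap R (XA * XB) (YA * YB))
    (Psi : Lmap R (YA * YB) (ZA * ZB)) :
  locc_channel Phi -> locc_channel Psi -> locc_channel (fun X => Psi (Phi X)).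
Proof. by move=> h1 /locc_channelP h2; apply/locc_channelP; exact: (locc_fam_after (K:=fun=> Psi)). Qed.

Lemma locc_fam_localA XA XB YA T (E : T -> Lmap R XA YA) : instrument E ->
  locc_fam (fun t => tid (K:=XB) (E t)).
Proof.
move=> hE; have h := locc_stepA hE (fun _ : T => locc_nil R YA XB).
(* The empty protocol after the step contributes an outcome in [unit]; keeping only the tag removes
   it. *)
have := locc_fam_coarse (fun p => tag p) (locc_fam_inst h); congr locc_fam.
apply/funext => t; apply/funext => X; apply: mx_ext => i j; rewrite big_sigT /=.
rewrite (bigD1 t) //= [X in _ + X]big1 ?addr0 => [|x /negPf hx].
  by rewrite eqxx sum_unit.
by rewrite hx big_pred0.
Qed.

Lemma locc_fam_localB XA XB YB T (E : T -> Lmap R XB YB) : instrument E ->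
  locc_fam (fun t => idt (K:=XA) (E t)).
Proof.
move=> hE; have h := locc_stepB hE (fun _ : T => locc_nil R XA YB).
have := locc_fam_coarse (fun p => tag p) (locc_fam_inst h); congr locc_fam.
apply/funext => t; apply/funext => X; apply: mx_ext => i j; rewrite big_sigT /=.
rewrite (bigD1 t) //= [X in _ + X]big1 ?addr0 => [|x /negPf hx].
  by rewrite eqxx sum_unit.
by rewrite hx big_pred0.
Qed.

Lemma channel_instrument I J (E : Lmap R I J) : channel E -> instrument (fun _ : unit => E).
Proof.
move=> [l c t]; split => // X; rewrite -[RHS]t; congr mtr; apply: mx_ext => i j.
by rewrite sum_unit.
Qed.

Lemma locc_localA XA XB YA (E : Lmap R XA YA) : channel E -> locc_channel (tid (K:=XB) E).
Proof. by move=> h; apply/locc_channelP; exact: (locc_fam_localA XB (channel_instrument h)). Qed.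

Lemma locc_localB XA XB YB (E : Lmap R XB YB) : channel E -> locc_channel (idt (K:=XA) E).
Proof. by move=> h; apply/locc_channelP; exact: (locc_fam_localB XA (channel_instrument h)). Qed.

Lemma locc_relabel XA XB YA YB (f : YA -> XA) (g : YB -> XB) : bijective f -> bijective g ->
  locc_channel (@relabel R (YA * YB)%type (XA * XB)%type (fun p => (f p.1, g p.2))).
Proof.
move=> hf hg; have h := locc_channel_comp (locc_localA XB (channel_relabel R hf))
  (locc_localB YA (channel_relabel R hg)); exact h.
Qed.

(* [id_KA (x) G (x) id_KB], with each ancilla on the outer side of its party. *)
Definition anc KA KB XA XB YA YB (G : Lmap R (XA * XB) (YA * YB)) :
    Lmap R ((KA * XA) * (XB * KB)) ((KA * YA) * (YB * KB)) :=
  fun X p q => G (fun i j => X ((p.1.1, i.1), (i.2, p.2.2)) ((q.1.1, j.1), (j.2, q.2.2)))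
    (p.1.2, p.2.1) (q.1.2, q.2.1).

Arguments anc KA KB {XA XB YA YB} G _ _ _.

Lemma instrument_idt L I J T (E : T -> Lmap R I J) : instrument E ->
  instrument (fun t => idt (K:=L) (E t)).
Proof. by move=> [h t]; split=> [u|]; [exact: lcp_idt | exact: (tp_idt (L:=L) t)]. Qed.

Lemma instrument_tid L I J T (E : T -> Lmap R I J) : instrument E ->
  instrument (fun t => tid (K:=L) (E t)).
Proof. by move=> [h t]; split=> [u|]; [exact: lcp_tid | exact: (tp_tid (L:=L) t)]. Qed.

(** An ancilla turns a local step into the step whose instrument is extended by the identity, and
    both sides agree by conversion. Only the empty protocol needs a case analysis, to expand
    pairs. *)
Lemma locc_inst_anc KA KB XA XB YA YB O (G : O -> Lmap R (XA * XB) (YA * YB)) :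
  locc_inst G -> locc_inst (fun o => anc KA KB (G o)).
Proof.
elim=> {XA XB YA YB O G}.
- move=> XA XB; have := locc_nil R (KA * XA)%type (XB * KB)%type; congr locc_inst.
  by apply/funext => _; apply/funext => X; apply: mx_ext => -[[a b] [c d]] [[a' b'] [c' d']].
- move=> XA XB ZA YA YB O1 E O2 F hE _ IH.
  exact: (locc_stepA (XB:=(XB * KB)%type) (instrument_idt KA hE) IH).
- move=> XA XB ZB YA YB O1 E O2 F hE _ IH.
  exact: (locc_stepB (XA:=(KA * XA)%type) (instrument_tid KB hE) IH).
Qed.

Lemma locc_fam_anc KA KB XA XB YA YB T (G : T -> Lmap R (XA * XB) (YA * YB)) :
  locc_fam G -> locc_fam (fun t => anc KA KB (G t)).
Proof.
move=> [O [G' [f [h GE]]]]; exists O, (fun o => anc KA KB (G' o)), f.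
by split=> [|t]; [exact: locc_inst_anc | rewrite GE].
Qed.

Lemma locc_channel_anc KA KB XA XB YA YB (Phi : Lmap R (XA * XB) (YA * YB)) :
  locc_channel Phi -> locc_channel (anc KA KB Phi).
Proof. by move=> /locc_channelP h; apply/locc_channelP; exact: locc_fam_anc. Qed.

End LOCC.

Arguments anc {R} KA KB {XA XB YA YB} G _ _ _.

(** * LOCC superchannels: composition, classical flags, convexity *)

Section Superchannels.
Variable R : realType.
Local Notation C := (R[i]).
Implicit Types (I J K L O T U XA XB YA YB ZA ZB KA KB UA UB VA VB WA WB : finType).
Implicit Types (A B D E RA RB W : finType).

Lemma super_apply_lcp UA UB A0 B0 A1 B1 D0 E0 D1 E1
    (pre : Lmap R (D0 * E0) ((UA * A0) * (B0 * UB)))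
    (post : Lmap R ((UA * A1) * (B1 * UB)) (D1 * E1)) (Phi : Lmap R (A0 * B0) (A1 * B1)) :
  lcp pre -> lcp post -> lcp Phi -> lcp (super_apply pre post Phi).
Proof.
move=> h1 h2 h3; apply: (lcp_comp _ h2); apply: (lcp_comp _ (lcp_relabel _ _)).
by apply: (lcp_comp _ (lcp_idt _ h3)); apply: (lcp_comp h1 (lcp_relabel _ _)).
Qed.

Lemma super_apply_channel UA UB A0 B0 A1 B1 D0 E0 D1 E1
    (pre : Lmap R (D0 * E0) ((UA * A0) * (B0 * UB)))
    (post : Lmap R ((UA * A1) * (B1 * UB)) (D1 * E1)) (Phi : Lmap R (A0 * B0) (A1 * B1)) :
  channel pre -> channel post -> channel Phi -> channel (super_apply pre post Phi).
Proof.
move=> h1 h2 h3; apply: (channel_comp _ h2).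
apply: (channel_comp _ (channel_relabel R _)); last first.
  by exists (fun q : (UA * UB) * (A1 * B1) => ((q.1.1, q.2.1), (q.2.2, q.1.2)))
    => -[[? ?] [? ?]].
apply: (channel_comp _ (channel_idt _ h3)); apply: (channel_comp h1 (channel_relabel R _)).
by exists (fun p : (UA * A0) * (B0 * UB) => ((p.1.1, p.2.2), (p.1.2, p.2.1)))
  => -[[? ?] [? ?]].
Qed.

Lemma super_image_channel A0 B0 A1 B1 D0 E0 D1 E1
    (Phi : Lmap R (A0 * B0) (A1 * B1)) (Psi : Lmap R (D0 * E0) (D1 * E1)) :
  channel Phi -> locc_super_image Phi Psi -> channel Psi.
Proof.
move=> h [UA [UB [pre [post [h1 h2 ->]]]]].
by apply: super_apply_channel => //; exact: locc_channel_channel.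
Qed.

Lemma super_apply_lin UA UB A0 B0 A1 B1 D0 E0 D1 E1
    (pre : Lmap R (D0 * E0) ((UA * A0) * (B0 * UB)))
    (post : Lmap R ((UA * A1) * (B1 * UB)) (D1 * E1)) (a : C)
    (Phi Psi : Lmap R (A0 * B0) (A1 * B1)) : lin_map post ->
  super_apply pre post (fun X i j => a * Phi X i j + Psi X i j) =
  fun X i j => a * super_apply pre post Phi X i j + super_apply pre post Psi X i j.
Proof. by move=> l; apply/funext => X; rewrite /super_apply -l. Qed.

Lemma super_refl A0 B0 A1 B1 (Phi : Lmap R (A0 * B0) (A1 * B1)) : locc_super_image Phi Phi.
Proof.
exists unit, unit.
exists (@relabel R ((unit * A0) * (B0 * unit))%type (A0 * B0)%type (fun p => (snd p.1, fst p.2))).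
exists (@relabel R (A1 * B1)%type ((unit * A1) * (B1 * unit))%type (fun p => ((tt, p.1), (p.2, tt)))).
split.
- apply: (locc_relabel R (f:=@snd unit A0) (g:=@fst B0 unit)).
    by exists (fun a => (tt, a)) => // -[[] ?].
  by exists (fun a => (a, tt)) => // -[? []].
- apply: (locc_relabel R (f:=fun a : A1 => (tt, a)) (g:=fun a : B1 => (a, tt))).
    by exists snd => // -[[] ?].
  by exists fst => // -[? []].
apply/funext => X; apply: mx_ext => -[a b] [a' b']; rewrite /super_apply /relabel /idt /=.
by congr (Phi _ _ _); apply: mx_ext => -[? ?] [? ?].
Qed.

(** Pre-processing of a composite: the outer superchannel runs first, its ancillas are carried along
    on the outer sides, and the nested ancillas merge into [VA * UA] and [UB * VB]. *)
Definition pre_comp UA UB VA VB A0 B0 D0 E0 RA0 RB0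
    (pre : Lmap R (D0 * E0) ((UA * A0) * (B0 * UB)))
    (pre' : Lmap R (RA0 * RB0) ((VA * D0) * (E0 * VB))) :
    Lmap R (RA0 * RB0) (((VA * UA) * A0) * (B0 * (UB * VB))) :=
  fun X => relabel (fun p : ((VA * UA) * A0) * (B0 * (UB * VB)) =>
      ((p.1.1.1, (p.1.1.2, p.1.2)), ((p.2.1, p.2.2.1), p.2.2.2))) (anc VA VB pre (pre' X)).

(** With the ancillas of A on the far left and those of B on the far right, merging nested ancillas
    never crosses the cut. *)
Lemma locc_assocl (XA YA ZA XB YB ZB : finType) :
  locc_channel (@relabel R (((XA * YA) * ZA) * (XB * (YB * ZB)))%type
     ((XA * (YA * ZA)) * ((XB * YB) * ZB))%type
     (fun p => ((p.1.1.1, (p.1.1.2, p.1.2)), ((p.2.1, p.2.2.1), p.2.2.2)))).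
Proof.
apply: (locc_relabel R (f:=fun a : (XA * YA) * ZA => (a.1.1, (a.1.2, a.2)))
  (g:=fun b : XB * (YB * ZB) => ((b.1, b.2.1), b.2.2))).
  by exists (fun a => ((a.1, a.2.1), a.2.2)) => [[[? ?] ?]|[? [? ?]]].
by exists (fun a => (a.1.1, (a.1.2, a.2))) => [[? [? ?]]|[[? ?] ?]].
Qed.

Lemma locc_assocr (XA YA ZA XB YB ZB : finType) :
  locc_channel (@relabel R ((XA * (YA * ZA)) * ((XB * YB) * ZB))%type
     (((XA * YA) * ZA) * (XB * (YB * ZB)))%type
     (fun p => (((p.1.1, p.1.2.1), p.1.2.2), (p.2.1.1, (p.2.1.2, p.2.2))))).
Proof.
apply: (locc_relabel R (f:=fun a : XA * (YA * ZA) => ((a.1, a.2.1), a.2.2))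
  (g:=fun b : (XB * YB) * ZB => (b.1.1, (b.1.2, b.2)))).
  by exists (fun a => (a.1.1, (a.1.2, a.2))) => [[? [? ?]]|[[? ?] ?]].
by exists (fun a => ((a.1, a.2.1), a.2.2)) => [[[? ?] ?]|[? [? ?]]].
Qed.

Lemma locc_pre_comp UA UB VA VB A0 B0 D0 E0 RA0 RB0
    (pre : Lmap R (D0 * E0) ((UA * A0) * (B0 * UB)))
    (pre' : Lmap R (RA0 * RB0) ((VA * D0) * (E0 * VB))) :
  locc_channel pre -> locc_channel pre' -> locc_channel (pre_comp pre pre').
Proof.
move=> h h'; apply: (locc_channel_comp _ (locc_assocl _ _ _ _ _ _)).
by apply: (locc_channel_comp h'); exact: locc_channel_anc.
Qed.

Lemma super_trans A0 B0 A1 B1 D0 E0 D1 E1 RA0 RB0 RA1 RB1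
    (Phi : Lmap R (A0 * B0) (A1 * B1)) (Psi : Lmap R (D0 * E0) (D1 * E1))
    (Xi : Lmap R (RA0 * RB0) (RA1 * RB1)) :
  locc_super_image Phi Psi -> locc_super_image Psi Xi -> locc_super_image Phi Xi.
Proof.
move=> [UA [UB [pre [post [h1 h2 ->]]]]] [VA [VB [pre' [post' [h1' h2' ->]]]]].
exists (VA * UA)%type, (UB * VB)%type, (pre_comp pre pre').
exists (fun X => post' (anc VA VB post (relabel (fun p : (VA * (UA * A1)) * ((B1 * UB) * VB) =>
  (((p.1.1, p.1.2.1), p.1.2.2), (p.2.1.1, (p.2.1.2, p.2.2)))) X))); split.
- exact: locc_pre_comp.
- apply: (locc_channel_comp _ h2'); apply: (locc_channel_comp (locc_assocr _ _ _ _ _ _)).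
  exact: locc_channel_anc.
- by [].
Qed.

(** Ancillas are parameters here, so that two superchannels can be brought to the same pair before
    being mixed. *)
Definition super_with UA UB A0 B0 A1 B1 D0 E0 D1 E1
    (Phi : Lmap R (A0 * B0) (A1 * B1)) (Psi : Lmap R (D0 * E0) (D1 * E1)) :=
  exists (pre : Lmap R (D0 * E0) ((UA * A0) * (B0 * UB)))
    (post : Lmap R ((UA * A1) * (B1 * UB)) (D1 * E1)),
    [/\ locc_channel pre, locc_channel post & Psi = super_apply pre post Phi].

Arguments super_with (UA UB)%_type {A0 B0 A1 B1 D0 E0 D1 E1} Phi Psi.

(** Preparation of a register in the basis state [w]; [detach] is the branch [w] of measuring the
    register in that basis and discarding it. *)
Definition attach I W (w : W) : Lmap R I (W * I) :=
  fun X p q => (p.1 == w)%:R * X p.2 q.2 * (q.1 == w)%:R.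
Definition detach I W (w : W) : Lmap R (W * I) I := fun X i j => X (w, i) (w, j).

Lemma channel_attach I W (w : W) : channel (@attach I W w).
Proof.
split.
- by move=> a X Y; apply: mx_ext => p q; rewrite /attach; ring.
- move=> K X hX; have := psd_scale_diag (fun p : K * (W * I) => (p.2.1 == w)%:R)
    (psd_relabel (fun p : K * (W * I) => (p.1, p.2.2)) hX).
  congr psd; apply: mx_ext => -[k [v i]] [l [u j]]; rewrite /attach /idt /relabel /=.
  by rewrite conj_nat.
- move=> X; rewrite /mtr sum_pair /attach /=.
  under eq_bigr => v _ do (under eq_bigr => i _ do rewrite -mulrA; rewrite -mulr_sumr).
  by rewrite sum_delta; apply: eq_bigr => i _; rewrite eqxx mulr1.
Qed.

Lemma instrument_detach I W : instrument (fun w : W => @detach I W w).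
Proof.
split=> [w|X]; first exact: (lcp_relabel R (fun i : I => (w, i))).
by rewrite /mtr [RHS]sum_pair exchange_big.
Qed.

Lemma ptrace_channel I W : channel (fun X i j => \sum_w @detach I W w X i j).
Proof.
have [h t] := instrument_detach I W; split => //.
  by have [] := @lcp_sum R _ _ W xpredT (fun w => @detach I W w) (fun w _ => h w).
by have [] := @lcp_sum R _ _ W xpredT (fun w => @detach I W w) (fun w _ => h w).
Qed.

(* The outcome x is kept by A in a classical register and read off before [post x]. *)
Lemma super_flag T UA UB A0 B0 A1 B1 D0 E0 D1 E1
    (pre : T -> Lmap R (D0 * E0) ((UA * A0) * (B0 * UB)))
    (post : T -> Lmap R ((UA * A1) * (B1 * UB)) (D1 * E1))
    (Phi : Lmap R (A0 * B0) (A1 * B1)) :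
  locc_fam pre -> (forall x, locc_channel (post x)) -> lin_map Phi ->
  super_with (T * UA) UB Phi (fun X i j => \sum_x super_apply (pre x) (post x) Phi X i j).
Proof.
move=> h1 h2 l.
pose aL (XA : finType) := @relabel R ((T * UA) * XA)%type (T * (UA * XA))%type
  (fun a => (a.1.1, (a.1.2, a.2))).
pose aR (XA : finType) := @relabel R (T * (UA * XA))%type ((T * UA) * XA)%type
  (fun a => ((a.1, a.2.1), a.2.2)).
have caL XA : channel (aL XA).
  by apply: channel_relabel; exists (fun a => ((a.1, a.2.1), a.2.2)) => [[[? ?] ?]|[? [? ?]]].
have caR XA : channel (aR XA).
  by apply: channel_relabel; exists (fun a => (a.1.1, (a.1.2, a.2))) => [[? [? ?]]|[[? ?] ?]].
pose pre' X i j := \sum_x tid (K:=(B0 * UB)%type) (aL A0) (tid (K:=(B0 * UB)%type) (attach x) (pre x X)) i j.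
pose post' X i j :=
   \sum_x post x (tid (K:=(B1 * UB)%type) (detach x) (tid (K:=(B1 * UB)%type) (aR A1) X)) i j.
exists pre', post'; split.
- apply: (locc_fam_then (K:=fun x Y =>
     tid (K:=(B0 * UB)%type) (aL A0) (tid (K:=(B0 * UB)%type) (attach x) Y)) h1) => x.
  by apply: locc_channel_comp; apply: locc_localA => //; exact: channel_attach.
- have h3 : locc_fam (fun x X =>
       tid (K:=(B1 * UB)%type) (@detach (UA * A1)%type T x) (tid (K:=(B1 * UB)%type) (aR A1) X)).
    apply: (locc_fam_after (K:=fun x => tid (K:=(B1 * UB)%type) (@detach (UA * A1)%type T x))).
      exact: locc_localA.
    exact: locc_fam_localA (instrument_detach _ _).
  exact: (locc_fam_then h3 h2).
apply/funext => X; apply: mx_ext => i j; rewrite /super_apply /post'.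
apply: eq_bigr => x _; congr (post x _ i j); apply: mx_ext => -[[u a] [b v]] [[u' a'] [b' v']].
rewrite /tid /detach /aR /relabel /idt /=.
congr (Phi _ _ _); apply: mx_ext => -[c d] [c' d']; rewrite /pre' /tid /aL /attach /relabel /=.
(* [pre'] sums over all flags, but the block at flag [x] receives only the term [x]. *)
rewrite (bigD1 x) //= big1 ?addr0 => [|y /negPf hy].
  by rewrite eqxx mul1r mulr1.
by rewrite eq_sym hy mul0r mul0r.
Qed.

(** A dummy register is attached on each side before [Phi], in the basis states [wA] and [wB], and
    traced out afterwards. *)
Lemma super_enlarge WA WB UA UB A0 B0 A1 B1 D0 E0 D1 E1 (wA : WA) (wB : WB)
    (Phi : Lmap R (A0 * B0) (A1 * B1)) (Psi : Lmap R (D0 * E0) (D1 * E1)) : lin_map Phi ->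
  super_with UA UB Phi Psi -> super_with (WA * UA) (UB * WB) Phi Psi.
Proof.
move=> l [pre [post [h1 h2 ->]]].
pose cA := @attach (UA * A0)%type WA wA.
pose cB := fun X => @relabel R (B0 * UB * WB)%type (WB * (B0 * UB))%type (fun p => (p.2, p.1))
  (@attach (B0 * UB)%type WB wB X).
pose dA := fun X i j => \sum_w @detach (UA * A1)%type WA w X i j.
pose dB := fun X i j => \sum_w @detach (B1 * UB)%type WB w
  (@relabel R (WB * (B1 * UB))%type (B1 * UB * WB)%type (fun p => (p.2, p.1)) X) i j.
have hcB : channel cB.
  apply: (channel_comp (channel_attach _ _)); apply: channel_relabel.
  by exists (fun p => (p.2, p.1)) => -[].
have hdB : channel dB.
  have hc : channel (@relabel R (WB * (B1 * UB))%type (B1 * UB * WB)%type (fun p => (p.2, p.1))).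
    by apply: channel_relabel; exists (fun p => (p.2, p.1)) => -[].
  exact: (channel_comp hc (ptrace_channel _ _)).
exists (fun X => relabel (fun p : ((WA * UA) * A0) * (B0 * (UB * WB)) =>
      ((p.1.1.1, (p.1.1.2, p.1.2)), ((p.2.1, p.2.2.1), p.2.2.2)))
      (idt (K:=(WA * (UA * A0))%type) cB (tid (K:=(B0 * UB)%type) cA (pre X)))).
exists (fun X => post (idt (K:=(UA * A1)%type) dB (tid (K:=(B1 * UB * WB)%type) dA
  (relabel (fun p : (WA * (UA * A1)) * ((B1 * UB) * WB) =>
  (((p.1.1, p.1.2.1), p.1.2.2), (p.2.1.1, (p.2.1.2, p.2.2)))) X)))); split.
- have hcA : channel cA by exact: channel_attach.
  have h := locc_channel_comp (locc_localA _ hcA) (locc_localB _ hcB).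
  exact: (locc_channel_comp (locc_channel_comp h1 h) (locc_assocl _ _ _ _ _ _)).
- have hdA : channel dA by exact: ptrace_channel.
  have h := locc_channel_comp (locc_localA _ hdA) (locc_localB _ hdB).
  exact: (locc_channel_comp (locc_channel_comp (locc_assocr _ _ _ _ _ _) h) h2).
apply/funext => X; rewrite /super_apply; congr post.
apply: mx_ext => -[[u a] [b v]] [[u' a'] [b' v']].
transitivity (\sum_w \sum_w' Phi (fun i j => (w == wB)%:R * ((w' == wA)%:R *
   pre X ((u, i.1), (i.2, v)) ((u', j.1), (j.2, v')) * (w' == wA)%:R) * (w == wB)%:R)
   (a, b) (a', b')); last by [].
(* In the two partial traces only the terms at the prepared labels survive. *)
rewrite (bigD1 wB) //= (bigD1 wA) //= [X in _ = _ + X + _]big1 ?addr0; last first.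
  move=> w /negPf hw; rewrite hw.
  under eq_fun do under eq_fun do rewrite !mul0r !mulr0 mul0r.
  by rewrite lin_map0.
rewrite [X in _ = _ + X]big1 ?addr0; last first.
  move=> w /negPf hw; rewrite big1 // => w' _; rewrite hw.
  under eq_fun do under eq_fun do rewrite mul0r mul0r.
  by rewrite lin_map0.
rewrite !eqxx; congr (Phi _ _ _); apply: mx_ext => -[c d] [c' d'].
by rewrite !mul1r !mulr1.
Qed.

(** [super_enlarge] puts new registers on the outer side, so two superchannels enlarged by each
    other's ancillas carry the factors in opposite orders. *)
Lemma super_anc_swap VA WA VB WB A0 B0 A1 B1 D0 E0 D1 E1
    (Phi : Lmap R (A0 * B0) (A1 * B1)) (Psi : Lmap R (D0 * E0) (D1 * E1)) :
  super_with (VA * WA) (VB * WB) Phi Psi -> super_with (WA * VA) (WB * VB) Phi Psi.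
Proof.
move=> [pre [post [h1 h2 ->]]].
exists (fun X => relabel (fun p : ((WA * VA) * A0) * (B0 * (WB * VB)) =>
  (((p.1.1.2, p.1.1.1), p.1.2), (p.2.1, (p.2.2.2, p.2.2.1)))) (pre X)).
exists (fun X => post (relabel (fun p : ((VA * WA) * A1) * (B1 * (VB * WB)) =>
  (((p.1.1.2, p.1.1.1), p.1.2), (p.2.1, (p.2.2.2, p.2.2.1)))) X)).
have bl (X Y Z : finType) : bijective (fun a : (X * Y) * Z => ((a.1.2, a.1.1), a.2)).
  by exists (fun a => ((a.1.2, a.1.1), a.2)) => -[[]].
have br (X Y Z : finType) : bijective (fun a : Z * (X * Y) => (a.1, (a.2.2, a.2.1))).
  by exists (fun a => (a.1, (a.2.2, a.2.1))) => -[? []].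
split.
- exact: (locc_channel_comp h1 (locc_relabel R (bl WA VA A0) (br WB VB B0))).
- exact: (locc_channel_comp (locc_relabel R (bl VA WA A1) (br VB WB B1)) h2).
apply/funext => X; rewrite /super_apply; congr post.
apply: mx_ext => -[[[u a] ?] [b [? ?]]] [[[u' a'] ?] [b' [? ?]]].
by rewrite /relabel /idt /=.
Qed.

(** A tosses a coin of bias [t], stores the result as a flag, and both parties follow the chosen
    superchannel. [super_flag] asks for common ancillas, so each pair is first enlarged by the
    other. *)
Lemma super_image_convex A0 B0 A1 B1 D0 E0 D1 E1
    (Phi : Lmap R (A0 * B0) (A1 * B1)) (Psi1 Psi2 : Lmap R (D0 * E0) (D1 * E1)) (t : R)
    (a0 : D0) (b0 : E0) :
  channel Phi -> locc_super_image Phi Psi1 -> locc_super_image Phi Psi2 -> 0 <= t <= 1 ->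
  locc_super_image Phi (fun X i j => t%:C%C * Psi1 X i j + (1 - t)%:C%C * Psi2 X i j).
Proof.
move=> cPhi [UA [UB h1]] [VA [VB h2]] /andP[t0 t1]; have [l _ _] := cPhi.
(* [super_enlarge] takes labels of the ancillas; they exist because a channel from a nonempty system
   cannot have an empty output. *)
have ne (XA XB : finType) (Xi : Lmap R (D0 * E0) (XA * XB)) :
    channel Xi -> exists x : XA * XB, true.
  move=> [_ _ /(_ (munit (a0, b0) (a0, b0)))]; rewrite [RHS]/mtr /munit sum_delta eqxx => e.
  have [x _|h] := pickP (fun _ : XA * XB => true); first by exists x.
  by move: e => /eqP; rewrite /mtr big_pred0 // eq_sym oner_eq0.
have [pre1 [post1 [g1 _ _]]] := h1; have [pre2 [post2 [g2 _ _]]] := h2.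
have [[[u1 _] [_ v1]] _] := ne _ _ _ (locc_channel_channel g1).
have [[[u2 _] [_ v2]] _] := ne _ _ _ (locc_channel_channel g2).
have k1 : super_with (VA * UA) (UB * VB) Phi Psi1 by exact: (super_enlarge u2 v2 l h1).
have k2 : super_with (VA * UA) (UB * VB) Phi Psi2.
  by apply: super_anc_swap; exact: (super_enlarge u1 v1 l h2).
move: k1 k2 => {h1 h2 g1 g2 pre1 pre2 post1 post2}.
move=> [pre1 [post1 [g1 e1 ->]]] [pre2 [post2 [g2 e2 ->]]].
(* The coin: an instrument of A that only rescales by the two probabilities. *)
pose w (x : bool) : C := if x then t%:C%C else (1 - t)%:C%C.
have w0 x : 0 <= w x by rewrite /w; case: x; rewrite ler0c // subr_ge0.
have hE : instrument (fun x (X : mx R D0 D0) i j => w x * X i j).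
  split=> [x|X]; first by apply: lcpZ => //; exact: lcp_id.
  congr mtr; apply: mx_ext => i j; rewrite big_bool /= /w rmorphB rmorph1 /=; ring.
have hf : locc_fam (fun x X => (if x then pre1 else pre2) (tid (K:=E0) (fun X i j => w x * X i j) X)).
  have := locc_fam_bind (locc_fam_localA E0 hE)
     (K:=fun x y X i j => (x == y)%:R * (if x then pre1 else pre2) X i j).
  move=> /(_ _)/wrap[x|].
    have hx : locc_channel (if x then pre1 else pre2) by case: x.
    move/locc_channelP/(locc_fam_coarse (fun=> x)): hx; congr locc_fam.
    apply/funext => y; apply/funext => X; apply: mx_ext => i j.
    by rewrite big_mkcond sum_unit; case: (x == y); rewrite ?mul1r ?mul0r.
  congr locc_fam; apply/funext => y; apply/funext => X; apply: mx_ext => i j.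
  by rewrite big_bool; case: y; rewrite /= ?mul1r ?mul0r ?addr0 ?add0r.
have hpost x : locc_channel (if x then post1 else post2) by case: x.
have h := super_flag hf hpost l.
exists (bool * (VA * UA))%type, (UB * VB)%type; move: h; congr super_with.
have lin x : lin_map (super_apply (if x then pre1 else pre2) (if x then post1 else post2) Phi).
  apply: (super_apply_lcp _ _ (channel_lcp cPhi)).1; apply: channel_lcp;
    by apply: locc_channel_channel; case: x.
apply/funext => X; apply: mx_ext => i j; rewrite big_bool.
have sc a : tid (K:=E0) (fun (Y : mx R D0 D0) i j => a * Y i j) X = fun p q => a * X p q.
  by apply: mx_ext => -[? ?] [? ?].
congr (_ + _).
  have := congr1 (fun H => H i j) (lin_mapZ (w true) X (lin true)) => /= <-.
  by rewrite /super_apply sc.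
have := congr1 (fun H => H i j) (lin_mapZ (w false) X (lin false)) => /= <-.
by rewrite /super_apply sc.
Qed.

End Superchannels.

(** * From guessing inequalities to a superchannel close to the target *)

Section Minimax.
Variable R : realType.
Local Notation C := (R[i]).
Implicit Types (I J A B D E : finType).

Lemma channel_convex I J (Phi Psi : Lmap R I J) (t : R) : channel Phi -> channel Psi ->
  0 <= t <= 1 -> channel (fun X i j => t%:C%C * Phi X i j + (1 - t)%:C%C * Psi X i j).
Proof.
move=> h1 h2 /andP[t0 t1].
have h3 : 0 <= (1 - t)%:C%C :> C by rewrite ler0c subr_ge0.
have [|l c] := cp_addZ (_ : 0 <= t%:C%C) (channel_lcp h1) (lcpZ h3 (channel_lcp h2)).
  by rewrite ler0c.
split => // X; rewrite mtrD !mtrZ; case: h1 h2 => [_ _ ->] [_ _ ->].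
by rewrite rmorphB rmorph1; ring.
Qed.

(** The hypothesis is what (ii) and (iii) have in common: an upper bound [t] stands for
    $\|\rho\|^\diamond$, and [eta] accounts for the unattained supremum. *)
Lemma dnorm_le_delta A0 B0 A1 B1 D0 E0 D1 E1
    (Phi1 : Lmap R (A0 * B0) (A1 * B1)) (Phi2 : Lmap R (D0 * E0) (D1 * E1))
    (eps : R) (a0 : D0) (b0 : E0) (a1 : D1) (b1 : E1) :
  channel Phi1 -> channel Phi2 -> 0 <= eps ->
  (forall rho t eta, state rho -> (forall g, channel g -> complex.Re (cpair rho g) <= t) ->
    0 < eta -> exists Psi, locc_super_image Phi1 Psi /\
    complex.Re (cpair rho Phi2) <= complex.Re (cpair rho Psi) + eps / 2 * t + eta) ->
  (delta_locc Phi1 Phi2 <= eps%:E)%E.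
Proof.
move=> c1 c2 eps0 hyp; have [l2 k2 t2] := c2.
pose S0 : finType := (D0 * E0)%type; pose S1 : finType := (D1 * E1)%type.
apply/lee_addgt0Pr => eta eta0; rewrite -EFinD.
suff [Psi [hPsi hd]] : exists Psi, locc_super_image Phi1 Psi /\
    (dnorm (map_sub Psi Phi2) <= (eps + eta)%:E)%E.
  by apply: le_trans hd; apply: ereal_inf_lbound; exists Psi.
pose nn : R := #|{: S0 * S1}|%:R; pose n : R := #|S1|%:R.
have nn0 : 0 <= nn by rewrite ler0n.
have n0 : 0 <= n by rewrite ler0n.
(* Chosen so that the repair map, with Choi matrix [nn * delta] times the identity and trace factor
   [nn * delta * n], costs at most [eta] in diamond norm. *)
pose delta := eta / (2 * (nn * n) + 1).
have dd0 : 0 < 2 * (nn * n) + 1 by rewrite ltr_wpDl // mulr_ge0 // mulr_ge0.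
have delta0 : 0 < delta by rewrite /delta divr_gt0.
have deltaE : 2 * (nn * delta * n) <= eta.
  rewrite /delta; have -> : 2 * (nn * (eta / (2 * (nn * n) + 1)) * n)
     = eta * (2 * (nn * n)) / (2 * (nn * n) + 1).
    by field; rewrite gt_eqF.
  rewrite ler_pdivrMr //; have := mulr_ge0 nn0 n0; nra.
pose lam := eps / 2; have lam0 : 0 <= lam by rewrite divr_ge0.
have d2 : 0 < delta ^+ 2 by rewrite exprn_gt0.
pose D (d : mx R (S0 * S1) (S0 * S1)) := exists (Psi al : Lmap R S0 S1) P,
  [/\ locc_super_image Phi1 Psi, channel al, psd P &
   d = fun p q => jmx Psi p q - jmx Phi2 p q + lam%:C%C * jmx al p q - P p q].
have Dh d : D d -> forall p q, d q p = Num.conj (d p q).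
  move=> [Psi [al [P [h1 h2 h3 ->]]]] p q.
  have [_ kP _] := super_image_channel c1 h1; have [_ ka _] := h2.
  rewrite (psd_herm p q (cp_jmx kP)) (psd_herm p q (cp_jmx k2)) (psd_herm p q (cp_jmx ka)).
  rewrite (psd_herm p q h3); move: (jmx Psi p q) (jmx Phi2 p q) (jmx al p q) (P p q) => x y z w.
  have -> : x - y + lam%:C%C * z - w = lam%:C%C * z - (w + y - x) by ring.
  by rewrite conj_affine rmorphB rmorphD /=; ring.
(* At a point of norm below [delta], the map $\Psi-\Phi_2+L$ is completely positive for
   $L=\lambda\alpha+|S_0S_1|\,\delta\,T$. It scales traces by the same factor as $L$, so [dnorm_le]
   applies to this pair, whose difference is $\Psi-\Phi_2$. *)
have [[d [Dd]]|hno] := pselect (exists d, D d /\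
    ~ (delta ^+ 2 <= \sum_p \sum_q (complex.Re (d p q) ^+ 2 + complex.Im (d p q) ^+ 2))).
  move=> /negP; rewrite -ltNge => small.
  have hb p q : `|d p q| <= delta%:C%C.
    have dE : delta = Num.sqrt (delta ^+ 2) by rewrite sqrtr_sqr ger0_norm // ltW.
    rewrite normc_def lecR [X in _ <= X]dE; apply: ler_wsqrtr.
    apply: le_trans (ltW small); rewrite (bigD1 p) //= (bigD1 q) //= -addrA lerDl addr_ge0 //.
      by apply: sumr_ge0 => q' _; rewrite addr_ge0 // sqr_ge0.
    by apply: sumr_ge0 => p' _; apply: sumr_ge0 => q' _; rewrite addr_ge0 // sqr_ge0.
  have hp := small_herm_psd (Dh d Dd) hb.
  have [Psi [al [P [h1 h2 h3 dE]]]] := Dd; exists Psi; split => //.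
  have cPsi := super_image_channel c1 h1; have [lP kP tP] := cPsi; have [la ka ta] := h2.
  have h1p : psd (@mid R (S0 * S1)%type).
    by have := psd_gram (@mid R (S0 * S1)%type); rewrite madj1 mmul1x.
  (* [T] is $X\mapsto\mathrm{Tr}(X)\,1$. *)
  pose T := kmap (@mid R (S0 * S1)%type).
  have hT : lcp T by split; [exact: lin_kmap | exact: cp_kmap].
  have tT X : mtr (T X) = n%:C%C * mtr X.
    rewrite mtr_kmap sum_pair /mtr mulr_sumr; apply: eq_bigr => a _ /=.
    transitivity (\sum_b (a == b)%:R * (n%:C%C * X a b)); last by rewrite sum_deltaV.
    apply: eq_bigr => b _; rewrite /mid (eq_bigr (fun=> (a == b)%:R)); last first.
      by move=> s _; rewrite xpair_eqE eqxx andbT.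
    by rewrite sumr_const -mulr_natl /n rmorph_nat; ring.
  pose L : Lmap R S0 S1 := fun X i j => lam%:C%C * al X i j + (nn * delta)%:C%C * T X i j.
  have nd0 : 0 <= (nn * delta)%:C%C :> C by rewrite ler0c mulr_ge0 // ltW.
  have hL : lcp L.
    apply: cp_addZ; [by rewrite ler0c | exact: (conj la ka) | exact: lcpZ].
  have [lL _] := hL.
  pose P' : Lmap R S0 S1 := fun X i j => L X i j + (Psi X i j - Phi2 X i j).
  have lP' : lin_map P'.
    by move=> a X Y; apply: mx_ext => i j; rewrite /P' lL lP l2; ring.
  have hP' : lcp P'.
    split => //; rewrite -(kmap_jmx lP'); apply: cp_kmap.
    have := psdD hp h3; congr psd; apply: mx_ext => p q.
    rewrite dE /jmx /P' /L -/(jmx T p q) jmx_kmap; ring.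
  pose k := lam + nn * delta * n.
  have k0 : 0 <= k by rewrite addr_ge0 // mulr_ge0 // mulr_ge0 // ltW.
  have tL X : mtr (L X) = k%:C%C * mtr X.
    by rewrite mtrD !mtrZ ta tT /k rmorphD (rmorphM _ (nn * delta)) /=; ring.
  have tP' X : mtr (P' X) = k%:C%C * mtr X.
    by rewrite mtrD mtrB tL tP t2 subrr addr0.
  have -> : map_sub Psi Phi2 = map_sub P' L.
    apply/funext => X; apply: mx_ext => i j; rewrite /map_sub /P'; ring.
  apply: le_trans (dnorm_le hP' hL tP' tL k0) _; rewrite lee_fin /k /lam; lra.
exfalso; have {hno}big d : D d -> delta ^+ 2 <=
    \sum_p \sum_q (complex.Re (d p q) ^+ 2 + complex.Im (d p q) ^+ 2).
  by move=> Dd; apply/negPn/negP => h; apply: hno; exists d; split => //; apply/negP.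
(* The hypothesis itself produces an image: any state will do, with the dimension bound for [t]. *)
have [Psi0 hPsi0] : exists Psi, @locc_super_image R A0 B0 A1 B1 D0 E0 D1 E1 Phi1 Psi.
  pose p0 : S0 * S1 := ((a0, b0), (a1, b1)).
  have hs : state (@munit R _ p0 p0).
    split; last by rewrite /mtr /munit sum_delta eqxx.
    have := psd_rank1 (fun p : S0 * S1 => (p == p0)%:R : C); congr psd.
    by apply: mx_ext => p q; rewrite conj_nat.
  have [Psi [h _]] := hyp _ _ 1 hs (fun g hg => cpair_channel_le hs hg) ltr01.
  by exists Psi.
have Dne : exists d, D d.
  by eexists; exists Psi0, Phi2, (fun _ _ => 0); split=> //; exact: psd0.
have Dcv X Y u : D X -> D Y -> 0 <= u <= 1 ->
    D (fun i j => u%:C%C * X i j + (1 - u)%:C%C * Y i j).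
  move=> [s1 [al1 [P1 [x1 y1 z1 ->]]]] [s2 [al2 [P2 [x2 y2 z2 ->]]]] hu.
  have /andP[u0 u1] := hu.
  have u0' : 0 <= u%:C%C :> C by rewrite ler0c.
  have u1' : 0 <= (1 - u)%:C%C :> C by rewrite ler0c subr_ge0.
  exists (fun X i j => u%:C%C * s1 X i j + (1 - u)%:C%C * s2 X i j).
  exists (fun X i j => u%:C%C * al1 X i j + (1 - u)%:C%C * al2 X i j).
  exists (fun a b => u%:C%C * P1 a b + (1 - u)%:C%C * P2 a b); split.
  - exact: super_image_convex.
  - exact: channel_convex.
  - by apply: psdD; exact: psdZ.
  - apply: mx_ext => p q; rewrite /jmx (rmorphB _ 1) rmorph1; ring.
have [H [Hh HP]] := herm_separation Dne Dh Dcv big.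
pose K : mx R (S0 * S1) (S0 * S1) := fun p q => - H p q.
have Kh p q : K q p = Num.conj (K p q) by rewrite /K rmorphN /= (Hh p q).
pose pr (X : mx R (S0 * S1) (S0 * S1)) := complex.Re (\sum_p \sum_q K p q * X p q).
have KP Psi al P : locc_super_image Phi1 Psi -> channel al -> psd P ->
    pr (jmx Psi) + lam * pr (jmx al) + delta ^+ 2 <= pr (jmx Phi2) + pr P.
  move=> h1 h2 h3; have := HP _ (ex_intro _ Psi (ex_intro _ al (ex_intro _ P (And4 h1 h2 h3 erefl)))).
  set z := (X in complex.Re X).
  have -> : z = (\sum_p \sum_q K p q * jmx Phi2 p q) + (\sum_p \sum_q K p q * P p q)
     - ((\sum_p \sum_q K p q * jmx Psi p q) + lam%:C%C * (\sum_p \sum_q K p q * jmx al p q)).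
    rewrite /z mulr_sumr -!big_split -sumrB; apply: eq_bigr => p _ /=.
    by rewrite mulr_sumr -!big_split -sumrB; apply: eq_bigr => q _ /=; rewrite /K; ring.
  by rewrite ReB !ReD Re_rM /pr; lra.
have hK : psd K.
  apply: psd_herm_form => // v.
  apply: (@lin_bound _ (pr (jmx Phi2) - pr (jmx Psi0) - lam * pr (jmx Phi2))) => s s_ge0.
  pose P0 : mx R (S0 * S1) (S0 * S1) := fun p q => Num.conj (v p) * v q.
  have hP0 : psd P0.
    by have := psd_rank1 (fun a => Num.conj (v a)); congr psd; apply: mx_ext => a b; rewrite conjCK.
  have hP : psd (fun p q => s%:C%C * P0 p q) by apply: psdZ => //; rewrite ler0c.
  have := KP _ _ _ hPsi0 c2 hP.
  have -> : pr (fun p q => s%:C%C * P0 p q) = s * complex.Re (\sum_i \sum_j Num.conj (v i) * K i j * v j).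
    rewrite /pr -Re_rM mulr_sumr; congr complex.Re; apply: eq_bigr => p _.
    by rewrite mulr_sumr; apply: eq_bigr => q _; rewrite /P0; ring.
  move: d2; lra.
have pr0 : pr (fun _ _ => 0) = 0.
  by rewrite /pr big1 // => p _; rewrite big1 // => q _; rewrite mulr0.
pose tau := complex.Re (mtr K).
have trK0 : 0 <= mtr K by apply: sumr_ge0 => p _; exact: psd_diag_ge0.
(* A positive [K] of trace zero would pair to zero with every positive matrix, and the strict margin
   would fail. *)
have tau0 : 0 < tau.
  rewrite lt_neqAle Re_ge0 // andbT; apply/negP => /eqP e.
  have h0 X : psd X -> pr X = 0.
    move=> hX; have := psd_pr_ge0 (psd_le_mtr hK) hX; rewrite -(Re_real trK0) -/tau -e.
    have -> : \sum_i \sum_j ((0 : R)%:C%C * @mid R _ i j - K i j) * X i j = - \sum_i \sum_j K i j * X i j.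
      by rewrite -sumrN; apply: eq_bigr => i _; rewrite -sumrN; apply: eq_bigr => j _; ring.
    move=> /Re_ge0; rewrite ReN -/(pr X) oppr_ge0 => h1.
    by apply/eqP; rewrite eq_le h1 Re_ge0 // psd_pr_ge0.
  have := KP _ _ _ hPsi0 c2 (@psd0 R _).
  have [_ kP0 _] := super_image_channel c1 hPsi0.
  by rewrite pr0 (h0 _ (cp_jmx kP0)) (h0 _ (cp_jmx k2)); move: d2; lra.
pose rho : mx R (S0 * S1) (S0 * S1) := fun p q => (tau^-1)%:C%C * K p q.
have hrho : state rho.
  split; first by apply: psdZ => //; rewrite ler0c invr_ge0 ltW.
  by rewrite mtrZ -(Re_real trK0) -/tau -rmorphM /= mulVf ?gt_eqF.
have prE (X : Lmap R S0 S1) : lin_map X -> complex.Re (cpair rho X) = tau^-1 * pr (jmx X).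
  move=> lX; rewrite cpairE // /pr -Re_rM; congr complex.Re; rewrite mulr_sumr.
  by apply: eq_bigr => p _; rewrite mulr_sumr; apply: eq_bigr => q _; rewrite /rho mulrA.
pose V := [set x | exists2 g : Lmap R S0 S1, channel g & x = complex.Re (cpair rho g)]%classic.
have hV : has_sup V.
  split; first by exists (complex.Re (cpair rho Phi2)); exists Phi2.
  by exists #|S0|%:R => _ [g hg ->]; exact: cpair_channel_le.
(* [sup V] is $\|\rho\|^\diamond$. Half of the normalized margin is used as [eta], so the resulting
   [Psi] contradicts the separation. *)
have [||Psi [hPsi]] := hyp rho (sup V) (delta ^+ 2 / tau / 2) hrho.
- by move=> g hg; apply: sup_upper_bound => //; exists g.
- by rewrite !divr_gt0.
have [lPsi _ _] := super_image_channel c1 hPsi.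
rewrite !prE //; apply/negP; rewrite -ltNge.
have key : lam * sup V <= tau^-1 * (pr (jmx Phi2) - delta ^+ 2 - pr (jmx Psi)).
  (* The bound on [sup V] comes from dividing by $\lambda$, so $\lambda=0$ is treated apart. *)
  have [->|lamN] := eqVneq lam 0.
    rewrite mul0r mulr_ge0 ?invr_ge0 ?(ltW tau0) //.
    have := KP _ _ _ hPsi c2 (@psd0 R _); rewrite pr0.
    have : 0 <= lam * pr (jmx Phi2).
      by rewrite mulr_ge0 // Re_ge0 // psd_pr_ge0 //; exact: cp_jmx.
    lra.
  have lamP : 0 < lam by rewrite lt_def lamN.
  rewrite mulrC -ler_pdivlMr //; apply: ge_sup; first exact: hV.1.
  move=> _ [g hg ->]; have [lg _ _] := hg; rewrite prE // ler_pdivlMr // -mulrA.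
  rewrite ler_pM2l ?invr_gt0 //; have := KP _ _ _ hPsi hg (@psd0 R _); rewrite pr0; lra.
have e : tau^-1 * (pr (jmx Phi2) - delta ^+ 2 - pr (jmx Psi)) =
   tau^-1 * pr (jmx Phi2) - delta ^+ 2 / tau - tau^-1 * pr (jmx Psi) by ring.
have h2 : 0 < delta ^+ 2 / tau by rewrite divr_gt0.
by rewrite -/lam; move: key; rewrite e; lra.
Qed.

End Minimax.

(** * Guessing strategies and the consequences of (i) *)

Section Strategies.
Variable R : realType.
Local Notation C := (R[i]).
Implicit Types (I J K T XA XB YA YB UA UB VA VB : finType).
Implicit Types (A B D E RA RB : finType).

Lemma locc_measP k XA XB (M : 'I_k -> mx R (XA * XB) (XA * XB)) :
  locc_meas M <-> povm M /\ exists H : 'I_k -> Lmap R (XA * XB) (unit * unit),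
    locc_fam H /\ forall i X, mtr (mmul X (M i)) = mtr (H i X).
Proof.
split=> [[hM [O [G [f [hG h]]]]]|[hM [H [[O [G [f [hG HE]]]] h]]]]; split => //.
  exists (fun i X a b => \sum_(o | f o == i) G o X a b); split; first by exists O, G, f.
  by move=> i X; rewrite h mtr_sum.
by exists O, G, f; split => // i X; rewrite h HE mtr_sum.
Qed.

Lemma locc_meas_pullback k XA XB YA YB (Xi : Lmap R (XA * XB) (YA * YB))
    (M : 'I_k -> mx R (YA * YB) (YA * YB)) : locc_channel Xi -> locc_meas M ->
  exists N : 'I_k -> mx R (XA * XB) (XA * XB), locc_meas N /\
    forall i X, mtr (mmul X (N i)) = mtr (mmul (Xi X) (M i)).
Proof.
move=> hXi /locc_measP[hM [H [hH HE]]].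
have [N [hN NE]] := povm_pullback (locc_channel_channel hXi) hM.
exists N; split => //; apply/locc_measP; split => //.
exists (fun i X => H i (Xi X)); split; first exact: locc_fam_after.
by move=> i X; rewrite NE HE.
Qed.

(** The state measured in [p_locc], as a map of the encoded state, kept apart from the measurement
    so that the latter can be pulled back through it. *)
Definition strat UA UB A0 B0 A1 B1 RA0 RB0 RA1 RB1
    (alpha : Lmap R (RA0 * RB0) ((UA * A0) * (B0 * UB))) (Phi : Lmap R (A0 * B0) (A1 * B1)) :
    Lmap R ((RA0 * RB0) * (RA1 * RB1)) (((UA * A1) * RA1) * ((RB1 * B1) * UB)) :=
  fun X => relabel (fun p : ((UA * A1) * RA1) * ((RB1 * B1) * UB) =>
                      (((p.1.1.1, p.2.2), (p.1.1.2, p.2.1.2)), (p.1.2, p.2.1.1)))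
    (tid (K:=(RA1 * RB1)%type)
      (fun X => idt (K:=(UA * UB)%type) Phi
         (relabel (fun q : (UA * UB) * (A0 * B0) =>
                     ((q.1.1, q.2.1), (q.2.2, q.1.2))) (alpha X))) X).

Lemma strat_lcp UA UB A0 B0 A1 B1 RA0 RB0 RA1 RB1
    (alpha : Lmap R (RA0 * RB0) ((UA * A0) * (B0 * UB))) (Phi : Lmap R (A0 * B0) (A1 * B1)) :
  lcp alpha -> lcp Phi -> lcp (@strat UA UB A0 B0 A1 B1 RA0 RB0 RA1 RB1 alpha Phi).
Proof.
move=> h1 h2; apply: (lcp_comp _ (lcp_relabel _ _)); apply: lcp_tid.
by apply: (lcp_comp _ (lcp_idt _ h2)); apply: (lcp_comp h1 (lcp_relabel _ _)).
Qed.

Lemma strat_channel UA UB A0 B0 A1 B1 RA0 RB0 RA1 RB1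
    (alpha : Lmap R (RA0 * RB0) ((UA * A0) * (B0 * UB))) (Phi : Lmap R (A0 * B0) (A1 * B1)) :
  channel alpha -> channel Phi -> channel (@strat UA UB A0 B0 A1 B1 RA0 RB0 RA1 RB1 alpha Phi).
Proof.
move=> h1 h2; apply: (channel_comp _ (channel_relabel R _)); last first.
  by exists (fun p : ((UA * UB) * (A1 * B1)) * (RA1 * RB1) =>
    (((p.1.1.1, p.1.2.1), p.2.1), ((p.2.2, p.1.2.2), p.1.1.2)))
    => [[[[? ?] ?] [[? ?] ?]]|[[[? ?] [? ?]] [? ?]]].
apply: channel_tid; apply: (channel_comp _ (channel_idt _ h2)).
apply: (channel_comp h1 (channel_relabel R _)).
by exists (fun p : (UA * A0) * (B0 * UB) => ((p.1.1, p.2.2), (p.1.2, p.2.1)))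
  => -[[? ?] [? ?]].
Qed.

(** A strategy absorbs a superchannel: [pre] joins [alpha], and [post] becomes an LOCC channel ahead
    of the measurement, because with [RA1] and [RB1] counted among the local ancillas it acts
    through [anc]. *)
Lemma strat_super UA UB VA VB A0 B0 A1 B1 D0 E0 D1 E1 RA0 RB0 RA1 RB1
    (pre : Lmap R (D0 * E0) ((VA * A0) * (B0 * VB)))
    (post : Lmap R ((VA * A1) * (B1 * VB)) (D1 * E1))
    (alpha : Lmap R (RA0 * RB0) ((UA * D0) * (E0 * UB))) (Phi : Lmap R (A0 * B0) (A1 * B1)) :
  locc_channel post -> exists Xi, locc_channel Xi /\
    forall X, @strat UA UB _ _ _ _ _ _ RA1 RB1 alpha (super_apply pre post Phi) X =
      Xi (strat (pre_comp pre alpha) Phi X).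
Proof.
move=> hpost.
pose r1A (p : (UA * RA1) * (VA * A1)) : ((UA * VA) * A1) * RA1 :=
  (((p.1.1, p.2.1), p.2.2), p.1.2).
pose r1B (p : (B1 * VB) * (RB1 * UB)) : (RB1 * B1) * (VB * UB) :=
  ((p.2.1, p.1.1), (p.1.2, p.2.2)).
pose r2A (p : (UA * D1) * RA1) : (UA * RA1) * D1 := ((p.1.1, p.2), p.1.2).
pose r2B (p : (RB1 * E1) * UB) : E1 * (RB1 * UB) := (p.1.2, (p.1.1, p.2)).
exists (fun X => relabel (fun p => (r2A p.1, r2B p.2)) (anc (UA * RA1)%type (RB1 * UB)%type post
   (relabel (fun p => (r1A p.1, r1B p.2)) X))); split.
  have h1 := @locc_relabel R _ _ _ _ r1A r1B; have h2 := @locc_relabel R _ _ _ _ r2A r2B.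
  apply: (locc_channel_comp (locc_channel_comp (h1 _ _) (locc_channel_anc _ _ hpost)) (h2 _ _)).
  - by exists (fun p => ((p.1.1.1, p.2), (p.1.1.2, p.1.2))) => [[[? ?] [? ?]]|[[[? ?] ?] ?]].
  - by exists (fun p => ((p.1.2, p.2.1), (p.1.1, p.2.2))) => [[[? ?] [? ?]]|[[? ?] [? ?]]].
  - by exists (fun p => ((p.1.1, p.2), p.1.2)) => -[[? ?] ?].
  - by exists (fun p => ((p.2.1, p.1), p.2.2)) => [[[? ?] ?]|[? [? ?]]].
by [].
Qed.

(** Complex-valued, so that it is linear in [Phi] as [lin_fun_dnorm] requires. *)
Definition stval UA UB A0 B0 A1 B1 RA0 RB0 RA1 RB1 k
    (lam : 'I_k -> R) (rho : 'I_k -> mx R ((RA0 * RB0) * (RA1 * RB1)) ((RA0 * RB0) * (RA1 * RB1)))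
    (alpha : Lmap R (RA0 * RB0) ((UA * A0) * (B0 * UB)))
    (M : 'I_k -> mx R (((UA * A1) * RA1) * ((RB1 * B1) * UB)) (((UA * A1) * RA1) * ((RB1 * B1) * UB)))
    (Phi : Lmap R (A0 * B0) (A1 * B1)) : C :=
  \sum_(i < k) (lam i)%:C%C * mtr (mmul (strat alpha Phi (rho i)) (M i)).

Lemma Re_stval UA UB A0 B0 A1 B1 RA0 RB0 RA1 RB1 k
    (lam : 'I_k -> R) (rho : 'I_k -> mx R ((RA0 * RB0) * (RA1 * RB1)) ((RA0 * RB0) * (RA1 * RB1)))
    (alpha : Lmap R (RA0 * RB0) ((UA * A0) * (B0 * UB)))
    (M : 'I_k -> mx R (((UA * A1) * RA1) * ((RB1 * B1) * UB)) (((UA * A1) * RA1) * ((RB1 * B1) * UB)))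
    (Phi : Lmap R (A0 * B0) (A1 * B1)) :
  complex.Re (stval lam rho alpha M Phi) =
  \sum_(i < k) lam i * complex.Re (mtr (mmul (strat alpha Phi (rho i)) (M i))).
Proof. by rewrite Re_sum; apply: eq_bigr => i _; rewrite Re_rM. Qed.

Lemma stval_lin UA UB A0 B0 A1 B1 RA0 RB0 RA1 RB1 k
    (lam : 'I_k -> R) (rho : 'I_k -> mx R ((RA0 * RB0) * (RA1 * RB1)) ((RA0 * RB0) * (RA1 * RB1)))
    (alpha : Lmap R (RA0 * RB0) ((UA * A0) * (B0 * UB)))
    (M : 'I_k -> mx R (((UA * A1) * RA1) * ((RB1 * B1) * UB)) (((UA * A1) * RA1) * ((RB1 * B1) * UB))) :
  lin_fun (stval lam rho alpha M).
Proof.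
move=> a Phi Psi; rewrite /stval mulr_sumr -big_split; apply: eq_bigr => i _ /=.
rewrite mulrCA -mulrDr; congr (_ * _); rewrite /mtr mulr_sumr -big_split.
apply: eq_bigr => p _ /=; rewrite /mmul mulr_sumr -big_split; apply: eq_bigr => q _ /=.
by rewrite mulrA -mulrDl.
Qed.

(** $1-M_i$ is the sum of the other operators, hence positive, and each term is at most
    $\lambda_i$. *)
Lemma psucc_le1 k I (lam : 'I_k -> R) (rho : 'I_k -> mx R I I) M :
  ensemble lam rho -> povm M -> psucc_with lam rho M <= 1.
Proof.
move=> [l0 l1 hr] [hM M1]; rewrite -l1; apply: ler_sum => i _.
rewrite -[X in _ <= X]mulr1; apply: ler_wpM2l => //.
have h : psd (fun a b => @mid R I a b - M i a b).
  have := @psd_sum R I _ (fun j => j != i) M (fun j _ => hM j); congr psd.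
  apply: mx_ext => a b; have := congr1 (fun f => f a b) M1 => /= <-.
  by rewrite [in RHS](bigD1 i) //= [X in X - _]addrC addrK.
have [hp tp] := hr i.
have := psd_mtr_mul_ge0 hp h; rewrite mmulBr mtrB mmulx1 tp subr_ge0 => /Re_le.
by [].
Qed.

(** For a channel [g] the whole strategy is one measurement of the encoded state, obtained by
    pulling [M] back through [strat alpha g]. *)
Lemma stval_bounds UA UB A0 B0 A1 B1 RA0 RB0 RA1 RB1 k
    (lam : 'I_k -> R) (rho : 'I_k -> mx R ((RA0 * RB0) * (RA1 * RB1)) ((RA0 * RB0) * (RA1 * RB1)))
    (alpha : Lmap R (RA0 * RB0) ((UA * A0) * (B0 * UB)))
    (M : 'I_k -> mx R (((UA * A1) * RA1) * ((RB1 * B1) * UB)) (((UA * A1) * RA1) * ((RB1 * B1) * UB))) :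
  ensemble lam rho -> channel alpha -> povm M ->
  (forall P : Lmap R (A0 * B0) (A1 * B1), lcp P -> 0 <= stval lam rho alpha M P) /\
  (forall g, channel g -> ((complex.Re (stval lam rho alpha M g))%:E <= psucc lam rho)%E).
Proof.
move=> [l0 l1 hr] ha hM; split=> [P hP|g hg].
  apply: sumr_ge0 => i _; apply: mulr_ge0; first by rewrite ler0c.
  apply: psd_mtr_mul_ge0; last exact: hM.1.
  by apply: lcp_psd; [apply: strat_lcp => //; exact: channel_lcp | case: (hr i)].
have [N [hN NE]] := povm_pullback (strat_channel _ _ ha hg) hM.
rewrite Re_stval; apply: ereal_sup_ubound; exists N => //.
by congr (_%:E); apply: eq_bigr => i _; rewrite NE.
Qed.

(** Shared by (ii) and (iii). The infimum may not be attained, so an image within [eps + eta] is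
    used, and [eta = e / (t + 1)] keeps the loss below [e]. *)
Lemma delta_lin_fun A0 B0 A1 B1 D0 E0 D1 E1
    (Phi1 : Lmap R (A0 * B0) (A1 * B1)) (Phi2 : Lmap R (D0 * E0) (D1 * E1)) (eps : R)
    (a0 : D0) (b0 : E0) (a1 : D1) (b1 : E1) (F : Lmap R (D0 * E0) (D1 * E1) -> C) (s V : \bar R) :
  channel Phi1 -> channel Phi2 -> 0 <= eps -> (delta_locc Phi1 Phi2 <= eps%:E)%E ->
  lin_fun F -> (forall P, lcp P -> 0 <= F P) ->
  (forall g, channel g -> ((complex.Re (F g))%:E <= s)%E) -> s \is a fin_num ->
  (forall Psi, locc_super_image Phi1 Psi -> ((complex.Re (F Psi))%:E <= V)%E) ->
  ((complex.Re (F Phi2))%:E <= V + (eps / 2)%:E * s)%E.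
Proof.
move=> c1 c2 eps0 hdel Fl F0 Fs sf FV.
pose t := fine s; have sE : s = t%:E by rewrite /t fineK.
have Ft g : channel g -> complex.Re (F g) <= t.
  by move=> hg; rewrite -lee_fin -sE; exact: Fs.
have t0 : 0 <= t by apply: le_trans (Ft _ c2); apply: Re_ge0; apply: F0; exact: channel_lcp.
rewrite sE -EFinM; apply/lee_addgt0Pr => e e0.
pose eta := e / (t + 1).
have eta0 : 0 < eta by rewrite divr_gt0 // ltr_wpDl.
have : (delta_locc Phi1 Phi2 < (eps + eta)%:E)%E.
  by apply: le_lt_trans hdel _; rewrite lte_fin ltrDl.
move=> /ereal_inf_lt[_ [Psi hPsi <-]] /ltW hd.
have cPsi := super_image_channel c1 hPsi.
have mu0 : 0 <= eps + eta by rewrite addr_ge0 // ltW.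
have hval := lin_fun_dnorm (a0, b0) (a1, b1) Fl F0 Ft mu0 c2 cPsi hd.
apply: (@le_trans _ _ (complex.Re (F Psi) + (eps + eta) / 2 * t)%:E); first by rewrite lee_fin.
rewrite EFinD -addeA; apply: leeD; first exact: FV.
rewrite -EFinD lee_fin; have : eta * t <= e.
  by rewrite /eta mulrAC ler_pdivrMr ?ltr_wpDl // ler_pM2l // lerDl.
have : 0 <= eta * t by rewrite mulr_ge0 // ltW.
have -> : (eps + eta) / 2 * t = eps / 2 * t + (eta * t) / 2 by ring.
by move: (eta * t) (eps / 2 * t) => x y; lra.
Qed.

Lemma delta_p_locc A0 B0 A1 B1 D0 E0 D1 E1 RA0 RB0 RA1 RB1
    (Phi1 : Lmap R (A0 * B0) (A1 * B1)) (Phi2 : Lmap R (D0 * E0) (D1 * E1)) (eps : R)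
    (a0 : D0) (b0 : E0) (a1 : D1) (b1 : E1) k (lam : 'I_k -> R)
    (rho : 'I_k -> mx R ((RA0 * RB0) * (RA1 * RB1)) ((RA0 * RB0) * (RA1 * RB1))) :
  channel Phi1 -> channel Phi2 -> 0 <= eps -> (delta_locc Phi1 Phi2 <= eps%:E)%E ->
  ensemble lam rho ->
  (p_locc Phi2 lam rho <= p_locc Phi1 lam rho + (eps / 2)%:E * psucc lam rho)%E.
Proof.
move=> c1 c2 eps0 hdel hens; apply: ge_ereal_sup => _ [UA [UB [al [M [hal hM ->]]]]].
have [F0 Ft] := stval_bounds (A0:=D0) (B0:=E0) hens (locc_channel_channel hal) hM.1.
have ps1 : (psucc lam rho <= 1)%E.
  by apply: ge_ereal_sup => _ [N hN <-]; rewrite lee_fin; exact: psucc_le1.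
have psf : psucc lam rho \is a fin_num.
  rewrite fin_real //; apply/andP; split; last exact: le_lt_trans ps1 (ltry _).
  exact: lt_le_trans (ltNyr _) (Ft _ c2).
set v2 := (X in (X%:E <= _)%E).
have -> : v2 = complex.Re (stval lam rho al M Phi2) by rewrite Re_stval.
apply: (delta_lin_fun a0 b0 a1 b1 c1) => //; first exact: stval_lin.
move=> _ [VA [VB [pre [post [hpre hpost ->]]]]].
have [Xi [hXi XiE]] := strat_super RA1 RB1 pre al Phi1 hpost.
have [N [hN NE]] := locc_meas_pullback hXi hM.
apply: ereal_sup_ubound; exists (UA * VA)%type, (VB * UB)%type, (pre_comp pre al), N; split=> //.
  exact: locc_pre_comp.
rewrite Re_stval; congr (_%:E); apply: eq_bigr => i _; congr (_ * complex.Re _).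
by rewrite XiE -NE.
Qed.

(** The superchannel applied to [Phi2] is fixed and made part of the functional; composed with an
    image of [Phi1] it yields another image of [Phi1]. *)
Lemma delta_sup_pair A0 B0 A1 B1 D0 E0 D1 E1 RA0 RB0 RA1 RB1
    (Phi1 : Lmap R (A0 * B0) (A1 * B1)) (Phi2 : Lmap R (D0 * E0) (D1 * E1)) (eps : R)
    (a0 : D0) (b0 : E0) (a1 : D1) (b1 : E1)
    (rho : mx R ((RA0 * RB0) * (RA1 * RB1)) ((RA0 * RB0) * (RA1 * RB1))) :
  channel Phi1 -> channel Phi2 -> 0 <= eps -> (delta_locc Phi1 Phi2 <= eps%:E)%E ->
  state rho ->
  (sup_pair rho Phi2 <= sup_pair rho Phi1 + (eps / 2)%:E * cond_dnorm rho)%E.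
Proof.
move=> c1 c2 eps0 hdel hrho; apply: ge_ereal_sup => _ [Xi hXi <-].
have cXi := super_image_channel c2 hXi.
have [UA [UB [pre [post [hpre hpost XiE]]]]] := hXi.
have cpre := locc_channel_channel hpre; have cpost := locc_channel_channel hpost.
pose F (G : Lmap R (D0 * E0) (D1 * E1)) := cpair rho (super_apply pre post G).
have Flin : lin_fun F.
  move=> a Phi Psi; rewrite /F super_apply_lin; last by case: cpost.
  rewrite /cpair mulr_sumr -big_split; apply: eq_bigr => s _ /=.
  by rewrite mulr_sumr -big_split.
have F0 P : lcp P -> 0 <= F P.
  move=> hP; apply: cpair_ge0; first exact: hrho.1.
  by apply: super_apply_lcp => //; exact: channel_lcp.
have cF g : channel g -> channel (super_apply pre post g).
  by move=> hg; exact: super_apply_channel.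
have hsE g : channel g -> hs_pair rho g = complex.Re (cpair rho g).
  by move=> hg; rewrite hs_pairE //; exact: channel_lcp.
have Ft g : channel g -> ((complex.Re (cpair rho g))%:E <= cond_dnorm rho)%E.
  by move=> hg; apply: ereal_sup_ubound; exists g => //; rewrite hsE.
have cdf : cond_dnorm rho \is a fin_num.
  rewrite fin_real //; apply/andP; split; first exact: lt_le_trans (ltNyr _) (Ft _ cXi).
  apply: (@le_lt_trans _ _ (#|{: RA0 * RB0}|%:R)%:E); last exact: ltry.
  by apply: ge_ereal_sup => _ [g hg <-]; rewrite lee_fin hsE //; exact: cpair_channel_le.
rewrite hsE // XiE -/(F Phi2).
apply: (delta_lin_fun a0 b0 a1 b1 c1) => // [g hg|Psi hPsi]; first by apply: Ft; exact: cF.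
apply: ereal_sup_ubound; exists (super_apply pre post Psi).
  by apply: super_trans hPsi _; exists UA, UB, pre, post.
by rewrite hsE //; apply: cF; exact: super_image_channel hPsi.
Qed.

End Strategies.

(** * Signed permutations and the twirled ensemble *)

Section Twirl.
Variable R : realType.
Local Notation C := (R[i]).
Implicit Types (I J T U Z XA XB YA YB : finType).
Implicit Types (A B D E : finType).

Lemma sum_cst (S : pzSemiRingType) I (x : S) : \sum_(i : I) x = #|I|%:R * x.
Proof. by rewrite sumr_const mulr_natl. Qed.

(** Labels of the signed permutation matrices $|s\rangle\mapsto\pm|\pi(s)\rangle$, with the sign
    attached to the input label. *)
Definition sperm T : finType := ({ffun T -> bool} * {perm T})%type.
Definition sg T (w : sperm T) (s : T) : C := (-1) ^+ (w.1 s).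

Lemma sgK T (w : sperm T) s : sg w s * sg w s = 1.
Proof. by rewrite /sg -expr2 -exprM mulnC exprM sqrrN expr1n expr1n. Qed.

Lemma sg_conj T (w : sperm T) s : Num.conj (sg w s) = sg w s.
Proof. by rewrite /sg rmorphXn rmorphN rmorph1. Qed.

Lemma sum_signs T (s t : T) :
  \sum_(f : {ffun T -> bool}) (-1) ^+ (f s) * (-1) ^+ (f t) =
  (s == t)%:R * #|{ffun T -> bool}|%:R :> C.
Proof.
have [->|st] := eqVneq s t.
  rewrite mul1r (eq_bigr (fun=> 1)) ?sumr_const // => f _.
  by case: (f t); rewrite /= ?expr1 ?expr0 ?mulrNN mulr1.
rewrite mul0r; set S := (LHS).
(* Flipping the sign at [s] alone is an involution that negates every term. *)
pose flip (f : {ffun T -> bool}) := [ffun x => f x (+) (x == s)].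
have flipK : involutive flip.
  by move=> f; apply/ffunP => x; rewrite !ffunE -addbA addbb addbF.
have e : S = - S.
  rewrite {1}/S (reindex_inj (inv_inj flipK)) /= -sumrN; apply: eq_bigr => f _.
  rewrite !ffunE eqxx addbT (eq_sym t) (negPf st) addbF.
  by case: (f s); rewrite /= ?expr1 ?expr0 ?mulN1r ?mul1r ?opprK.
by apply/eqP; rewrite -eqNr eq_sym; apply/eqP.
Qed.

(** Composition with transpositions on both sides shows that the sum depends on neither [x] nor [s];
    summed over [x] it counts all permutations. *)
Lemma sum_perm_point T (x s : T) :
  \sum_(p : {perm T}) (x == p s)%:R = #|{perm T}|%:R / #|T|%:R :> C.
Proof.
pose g (x s : T) : C := \sum_(p : {perm T}) (x == p s)%:R.
have gE x' s' : g x s = g x' s'.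
  pose h (p : {perm T}) := (tperm s s' * p * tperm x x')%g.
  have hK : involutive h.
    by move=> p; rewrite /h !mulgA tperm2 mul1g -mulgA tperm2 mulg1.
  rewrite {1}/g (reindex_inj (inv_inj hK)); apply: eq_bigr => p _ /=.
  rewrite /h !permM tpermL; congr (nat_of_bool _)%:R; rewrite -(inj_eq (@perm_inj _ (tperm x x'))).
  by rewrite tpermL tpermK.
have e : \sum_x' g x' s = #|{perm T}|%:R.
  rewrite exchange_big (eq_bigr (fun=> 1)) ?sumr_const // => p _ /=.
  by rewrite (bigD1 (p s)) //= eqxx big1 ?addr0 // => y /negPf ->.
have T0 : #|T|%:R != 0 :> C by rewrite pnatr_eq0 -lt0n; apply/card_gt0P; exists x.
move: e; rewrite (eq_bigr (fun=> g x s)); last by move=> x' _; exact/esym/gE.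
by rewrite sum_cst => <-; rewrite mulrC mulKf.
Qed.

(** Tight frame identity for the vectors obtained from $\sum_s|ss\rangle$ by a signed permutation of
    one factor: the signs kill $s\ne t$, and for $s=t$ the permutations equidistribute. *)
Lemma sperm_twirl T (s t x y : T) :
  \sum_(w : sperm T) sg w s * sg w t * ((x == w.2 s)%:R * (y == w.2 t)%:R) =
  #|sperm T|%:R / #|T|%:R * ((s == t)%:R * (x == y)%:R) :> C.
Proof.
rewrite (sum_pair (I:={ffun T -> bool}) (J:={perm T})) /sg /=.
under eq_bigr => f _ do rewrite -mulr_sumr.
rewrite -mulr_suml sum_signs card_prod natrM.
have [<-|st] := eqVneq s t; last by rewrite !mul0r mulr0.
rewrite (eq_bigr (fun p : {perm T} => (x == y)%:R * (x == p s)%:R)); last first.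
  move=> p _; case: (eqVneq x (p s)) => [->|hx]; last by rewrite !(mul0r, mulr0).
  by rewrite mul1r mulr1 eq_sym.
rewrite -mulr_sumr sum_perm_point; ring.
Qed.

Definition sperm2 D E : finType := (sperm D * sperm E)%type.
Definition sg2 D E (u : sperm2 D E) (s : D * E) : C := sg u.1 s.1 * sg u.2 s.2.
Definition pm2 D E (u : sperm2 D E) (s : D * E) : D * E := (u.1.2 s.1, u.2.2 s.2).
Definition ipm2 D E (u : sperm2 D E) (s : D * E) : D * E := ((u.1.2)^-1 s.1, (u.2.2)^-1 s.2)%g.

Lemma sg2K D E (u : sperm2 D E) s : sg2 u s * sg2 u s = 1.
Proof. by rewrite /sg2 mulrACA !sgK mulr1. Qed.
Lemma sg2_conj D E (u : sperm2 D E) s : Num.conj (sg2 u s) = sg2 u s.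
Proof. by rewrite /sg2 rmorphM /= !sg_conj. Qed.
Lemma pm2K D E (u : sperm2 D E) : cancel (pm2 u) (ipm2 u).
Proof. by case=> a b; rewrite /pm2 /ipm2 /= !permK. Qed.
Lemma ipm2K D E (u : sperm2 D E) : cancel (ipm2 u) (pm2 u).
Proof. by case=> a b; rewrite /pm2 /ipm2 /= !permKV. Qed.
Lemma pm2_bij D E (u : sperm2 D E) : bijective (pm2 u).
Proof. by exists (ipm2 u); [exact: pm2K | exact: ipm2K]. Qed.

(** $(1\otimes w)^\dagger X(1\otimes w)$ for the product signed permutation $w$ labelled by [u]. *)
Definition tw D E Z (u : sperm2 D E) (X : mx R (Z * (D * E)) (Z * (D * E))) :
    mx R (Z * (D * E)) (Z * (D * E)) :=
  fun p q => sg2 u p.2 * X (p.1, pm2 u p.2) (q.1, pm2 u q.2) * sg2 u q.2.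

Lemma tw_state D E Z (u : sperm2 D E) (X : mx R (Z * (D * E)) (Z * (D * E))) :
  state X -> state (tw u X).
Proof.
move=> [hX tX]; split.
  have := psd_scale_diag (fun p : Z * (D * E) => sg2 u p.2)
    (psd_relabel (fun p : Z * (D * E) => (p.1, pm2 u p.2)) hX).
  by congr psd; apply: mx_ext => p q; rewrite sg2_conj.
rewrite -tX /mtr !sum_pair; apply: eq_bigr => z _ /=.
rewrite [RHS](reindex (pm2 u)); last by apply: onW_bij; exact: pm2_bij.
by apply: eq_bigr => s _; rewrite /tw /= mulrAC sg2K mul1r.
Qed.

Lemma tid_tw D E I Z (u : sperm2 D E) (G : Lmap R I Z) X : lin_map G ->
  tid (K:=(D * E)%type) G (tw u X) = tw u (tid (K:=(D * E)%type) G X).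
Proof.
move=> l; apply: mx_ext => -[z s] [z' t]; rewrite /tid /tw /=.
transitivity (G (fun a b => (sg2 u s * sg2 u t) * X (a, pm2 u s) (b, pm2 u t)) z z').
  by congr (G _ z z'); apply: mx_ext => a b; ring.
rewrite lin_mapZ //; ring.
Qed.

Lemma sum_enum_val (S : nmodType) T (F : T -> S) : \sum_(i < #|T|) F (enum_val i) = \sum_u F u.
Proof.
rewrite (reindex (@enum_rank T)); last by apply: onW_bij; exact: enum_rank_bij.
by apply: eq_bigr => u _; rewrite enum_rankK.
Qed.

Lemma sum_enum_rank (S : nmodType) T (F : 'I_#|T| -> S) : \sum_u F (enum_rank u) = \sum_i F i.
Proof. by rewrite [RHS](reindex (@enum_rank T)) //; apply: onW_bij; exact: enum_rank_bij. Qed.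

Definition tlam T (i : 'I_#|T|) : R := #|T|%:R^-1.
Definition trho D E Z (rho : mx R (Z * (D * E)) (Z * (D * E))) (i : 'I_#|sperm2 D E|) :=
  tw (enum_val i) rho.

Lemma card_sperm2_gt0 D E : (0 < #|sperm2 D E|)%N.
Proof.
by apply/card_gt0P; exists (([ffun=> true], 1%g), ([ffun=> true], 1%g)).
Qed.

Lemma twirl_ensemble D E Z (rho : mx R (Z * (D * E)) (Z * (D * E))) :
  state rho -> ensemble (@tlam (sperm2 D E)) (trho rho).
Proof.
move=> h; split=> [i||i]; [by rewrite invr_ge0 ler0n| |exact: tw_state].
rewrite /tlam sum_cst card_ord mulfV //.
by rewrite pnatr_eq0 -lt0n card_sperm2_gt0.
Qed.

(** The constant $c$: each local Bell vector enters its measurement with weight $|D|/|W_D|$, and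
    [tconstE] multiplies the two local weights. *)
Definition tconst D E : R := #|{: D * E}|%:R / #|sperm2 D E|%:R.

(** A POVM yields a channel: its Choi matrix sums the operators, each with its permutation undone,
    and completeness of the POVM is the marginal condition. Pairing with $\rho$ gives the success
    probability up to the factor $c$, so the bound on channels applies. *)
Lemma psucc_twirl D E Z (rho : mx R (Z * (D * E)) (Z * (D * E))) (t : R) (x0 : D * E) :
  state rho -> (forall g, channel g -> complex.Re (cpair rho g) <= t) ->
  (psucc (@tlam (sperm2 D E)) (trho rho) <= (tconst D E * t)%:E)%E.
Proof.
move=> hr ht; apply: ge_ereal_sup => _ [M [Mp M1] <-]; rewrite lee_fin.
pose n : C := #|{: D * E}|%:R.
have n0 : n != 0 by rewrite pnatr_eq0 -lt0n; apply/card_gt0P; exists x0.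
(* The two arguments of [M] are exchanged because the pairing is $\mathrm{Tr}(\rho K^T)$. *)
pose Kt (u : sperm2 D E) (p q : Z * (D * E)) : C := sg2 u (ipm2 u p.2) *
  M (enum_rank u) (q.1, ipm2 u q.2) (p.1, ipm2 u p.2) * sg2 u (ipm2 u q.2).
pose K (p q : Z * (D * E)) : C := n^-1 * \sum_u Kt u p q.
have hK : psd K.
  apply: psdZ; first by rewrite invr_ge0 ler0n.
  apply: psd_sum => u _.
  have := psd_scale_diag (fun p : Z * (D * E) => sg2 u (ipm2 u p.2))
    (psd_relabel (fun p : Z * (D * E) => (p.1, ipm2 u p.2)) (psd_tr (Mp (enum_rank u)))).
  by congr psd; apply: mx_ext => p q; rewrite sg2_conj.
have hc : channel (kmap K).
  apply: channel_kmap => // a b; rewrite /K -mulr_sumr exchange_big /=.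
  transitivity (n^-1 * \sum_u \sum_s M (enum_rank u) (b, s) (a, s)).
    congr (_ * _); apply: eq_bigr => u _.
    rewrite (reindex (pm2 u)); last by apply: onW_bij; exact: pm2_bij.
    by apply: eq_bigr => s _; rewrite /Kt /= pm2K mulrAC sg2K mul1r.
  rewrite exchange_big (eq_bigr (fun=> (a == b)%:R)); last first.
    move=> s _; rewrite (sum_enum_rank (fun i => M i (b, s) (a, s))).
    rewrite [LHS](congr1 (fun f => f (b, s) (a, s)) M1) /mid xpair_eqE eqxx andbT; congr (nat_of_bool _)%:R.
    exact: eq_sym.
  by rewrite sum_cst mulKf.
have := ht _ hc; rewrite cpair_kmap => h.
have -> : psucc_with (@tlam (sperm2 D E)) (trho rho) M =
    tconst D E * complex.Re (\sum_p \sum_q rho p q * K p q).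
  have -> : \sum_p \sum_q rho p q * K p q = (#|{: D * E}|%:R^-1 : R)%:C%C *
     \sum_(i < #|sperm2 D E|) mtr (mmul (trho rho i) (M i)).
    rewrite fmorphV rmorph_nat -/n.
    transitivity (n^-1 * \sum_u \sum_p \sum_q rho p q * Kt u p q).
      rewrite [in RHS]exchange_big [RHS]mulr_sumr; apply: eq_bigr => p _ /=.
      rewrite [in RHS]exchange_big [RHS]mulr_sumr; apply: eq_bigr => q _ /=.
      by rewrite /K -mulr_sumr mulrCA.
    congr (_ * _); rewrite -(sum_enum_val (fun u => \sum_p \sum_q rho p q * Kt u p q)).
    apply: eq_bigr => i _; rewrite /mtr /mmul.
    have bij : bijective (fun p : Z * (D * E) => (p.1, pm2 (enum_val i) p.2)).
      exists (fun p => (p.1, ipm2 (enum_val i) p.2)) => -[a s] /=.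
        by rewrite pm2K.
      by rewrite ipm2K.
    rewrite (reindex _ (onW_bij _ bij)); apply: eq_bigr => p _ /=.
    rewrite (reindex _ (onW_bij _ bij)); apply: eq_bigr => q _ /=.
    by rewrite /Kt /= !pm2K enum_valK -!surjective_pairing /trho /tw; ring.
  rewrite Re_rM /psucc_with /tconst /tlam -mulr_sumr Re_sum.
  have nR : (#|{: D * E}|%:R : R) != 0 by rewrite pnatr_eq0 -lt0n; apply/card_gt0P; exists x0.
  by rewrite [RHS]mulrA [X in _ = X * _]mulrAC mulfV // mul1r.
by apply: ler_wpM2l => //; rewrite divr_ge0 // ler0n.
Qed.

End Twirl.

(** * Bell measurements, teleportation and the value of the twirled ensemble *)

Section TwirlStrategies.
Variable R : realType.
Local Notation C := (R[i]).
Implicit Types (I J T U Z XA XB YA YB UA UB : finType).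
Implicit Types (A B D E : finType).

Lemma povm_instrument I T (M : T -> mx R I I) : (forall t, psd (M t)) ->
  (fun a b => \sum_t M t a b) = @mid R I ->
  instrument (fun t X (_ _ : unit) => mtr (mmul X (M t))).
Proof.
move=> hM M1; split=> [t|X].
  have hK : psd (fun p q : I * unit => M t q.1 p.1).
    exact: (psd_relabel fst (psd_tr (hM t))).
  have -> : (fun X (_ _ : unit) => mtr (mmul X (M t))) =
      kmap (fun p q : I * unit => M t q.1 p.1).
    by apply/funext => X; apply: mx_ext => i j; rewrite /kmap sum_pair.
  by split; [exact: lin_kmap | exact: cp_kmap].
rewrite {1}/mtr sum_unit -[in RHS](mmulx1 X) -M1 -mtr_sum; congr mtr.
apply: mx_ext => a b; rewrite /mmul exchange_big; apply: eq_bigr => c _ /=.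
by rewrite mulr_sumr.
Qed.

Lemma locc_fam_local2 XA XB YA YB T U (E : T -> Lmap R XA YA) (F : U -> Lmap R XB YB) :
  instrument E -> instrument F ->
  locc_fam (fun (u : T * U) X => idt (K:=YA) (F u.2) (tid (K:=XB) (E u.1) X)).
Proof.
move=> hE hF.
have h (t : T) := locc_fam_coarse (fun w => (t, w)) (locc_fam_localB YA hF).
have := locc_fam_bind (locc_fam_localA XB hE) h; congr locc_fam.
apply/funext => -[t w]; apply/funext => X; apply: mx_ext => i j /=.
rewrite (bigD1 t) //= [X in _ + X]big1 ?addr0 => [|t' /negPf ht].
  by rewrite (big_pred1 w) // => w'; rewrite /= xpair_eqE eqxx.
by rewrite big_pred0 // => w'; rewrite /= xpair_eqE ht.
Qed.

(* The Bell-type measurement on D (x) D given by the vectors (1 (x) w) sum_s |ss>. *)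
Definition bellv D (w : sperm D) (x s : D) : C := sg R w s * (x == w.2 s)%:R.

Lemma bellv_conj D (w : sperm D) x s : Num.conj (bellv w x s) = bellv w x s.
Proof. by rewrite /bellv rmorphM /= sg_conj conj_nat. Qed.

(** [f] and [g] read the two copies of [D] inside a local system, whatever their order and trivial
    factors; injectivity says that the system contains nothing else. Completeness is
    [sperm_twirl]. *)
Lemma bell_povm D I (f g : I -> D) : injective (fun i => (f i, g i)) ->
  (forall w, psd (fun i j : I => (#|D|%:R / #|sperm D|%:R) *
     (bellv w (f i) (g i) * bellv w (f j) (g j)))) /\
  (fun i j => \sum_w (#|D|%:R / #|sperm D|%:R) *
     (bellv w (f i) (g i) * bellv w (f j) (g j))) = @mid R I.
Proof.
move=> inj; split=> [w|].
  apply: psdZ; first by rewrite divr_ge0 // ler0n.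
  have := psd_rank1 (fun i => bellv w (f i) (g i)); congr psd.
  by apply: mx_ext => i j; rewrite bellv_conj.
apply: mx_ext => i j; rewrite -mulr_sumr.
rewrite (eq_bigr (fun w => sg R w (g i) * sg R w (g j) *
  ((f i == w.2 (g i))%:R * (f j == w.2 (g j))%:R))); last by move=> w _; rewrite /bellv; ring.
rewrite sperm_twirl mulrA.
have D0 : #|D|%:R != 0 :> C by rewrite pnatr_eq0 -lt0n; apply/card_gt0P; exists (f i).
have S0 : #|sperm D|%:R != 0 :> C.
  by rewrite pnatr_eq0 -lt0n; apply/card_gt0P; exists ([ffun=> true], 1%g).
have ab1 (a b : C) : a != 0 -> b != 0 -> a / b * (b / a) = 1.
  by move=> a0 b0; rewrite mulrA divfK // divff.
rewrite ab1 // mul1r.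
rewrite -natrM mulnb /mid; congr (nat_of_bool _)%:R; rewrite andbC.
by rewrite -(inj_eq inj) xpair_eqE.
Qed.

Lemma mtr_local2 XA XB (MA : mx R XA XA) (MB : mx R XB XB) X :
  mtr (idt (K:=unit) (fun Y (_ _ : unit) => mtr (mmul Y MB))
    (tid (K:=XB) (fun Y (_ _ : unit) => mtr (mmul Y MA)) X)) =
  mtr (mmul X (fun p q => MA p.1 q.1 * MB p.2 q.2)).
Proof.
rewrite {1}/mtr sum_pair !sum_unit /idt /tid /mtr /mmul /= [RHS]sum_pair [RHS]exchange_big.
apply: eq_bigr => b _ /=.
under [RHS]eq_bigr => a _ do rewrite sum_pair exchange_big /=.
rewrite [RHS]exchange_big; apply: eq_bigr => b' _ /=.
rewrite mulr_suml; apply: eq_bigr => a _; rewrite mulr_suml; apply: eq_bigr => a' _.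
by rewrite mulrA.
Qed.

Lemma tconstE D E : (#|D|%:R / #|sperm D|%:R) * (#|E|%:R / #|sperm E|%:R) = (tconst R D E)%:C%C :> C.
Proof.
have cS : #|sperm2 D E| = (#|sperm D| * #|sperm E|)%N by exact: card_prod.
rewrite /tconst (card_prod D E) cS rmorphM fmorphV !rmorph_nat !natrM invfM; ring.
Qed.

(** The strategy has trivial ancillas, passes the input to [Phi] unchanged and lets each party
    measure its output jointly with its $R_1$ in the Bell vectors. The element for [u] undoes the
    permutation that encodes [u], so every [u] contributes the same value
    $c\langle\rho,\Phi\rangle$. *)
Lemma p_locc_twirl_ge D0 E0 D E (Phi : Lmap R (D0 * E0) (D * E))
    (rho : mx R ((D0 * E0) * (D * E)) ((D0 * E0) * (D * E))) : channel Phi ->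
  ((tconst R D E * complex.Re (cpair rho Phi))%:E <=
     p_locc Phi (@tlam R (sperm2 D E)) (trho rho))%E.
Proof.
move=> cPhi; have [l _ _] := cPhi.
pose al := @relabel R ((unit * D0) * (E0 * unit))%type (D0 * E0)%type (fun p => (snd p.1, fst p.2)).
have hal : locc_channel al.
  apply: (locc_relabel R (f:=@snd unit D0) (g:=@fst E0 unit)).
    by exists (fun a => (tt, a)) => // -[[] ?].
  by exists (fun a => (a, tt)) => // -[? []].
pose XA : finType := ((unit * D) * D)%type; pose XB : finType := ((E * E) * unit)%type.
pose MA (w : sperm D) (i j : XA) : C := (#|D|%:R / #|sperm D|%:R) *
  (bellv w i.1.2 i.2 * bellv w j.1.2 j.2).
pose MB (w : sperm E) (i j : XB) : C := (#|E|%:R / #|sperm E|%:R) *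
  (bellv w i.1.2 i.1.1 * bellv w j.1.2 j.1.1).
have [MAp MA1] : (forall w, psd (MA w)) /\ (fun i j => \sum_w MA w i j) = @mid R XA.
  by apply: (bell_povm (f:=fun i : XA => i.1.2) (g:=fun i : XA => i.2)) => -[[[] ?] ?] [[[] ?] ?] [-> ->].
have [MBp MB1] : (forall w, psd (MB w)) /\ (fun i j => \sum_w MB w i j) = @mid R XB.
  by apply: (bell_povm (f:=fun i : XB => i.1.2) (g:=fun i : XB => i.1.1)) => -[[? ?] []] [[? ?] []] [-> ->].
pose M2 (u : sperm2 D E) (p q : XA * XB) : C := MA u.1 p.1 q.1 * MB u.2 p.2 q.2.
pose v (u : sperm2 D E) (p : XA * XB) : C := bellv u.1 p.1.1.2 p.1.2 * bellv u.2 p.2.1.2 p.2.1.1.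
have M2E u p q : M2 u p q = (tconst R D E)%:C%C * (v u p * v u q).
  by rewrite -tconstE /M2 /MA /MB /v; ring.
have tc0 : 0 <= tconst R D E by rewrite divr_ge0 // ler0n.
have vc u p : Num.conj (v u p) = v u p.
  by rewrite rmorphM; congr (_ * _); exact: bellv_conj.
pose M (i : 'I_#|sperm2 D E|) := M2 (enum_val i).
have pM : povm M.
  split=> [i|].
    have := psdZ (_ : 0 <= (tconst R D E)%:C%C) (psd_rank1 (v (enum_val i))).
    rewrite ler0c => /(_ tc0); congr psd; apply: mx_ext => p q.
    by rewrite /M M2E vc.
  apply: mx_ext => p q; rewrite /M (sum_enum_val (fun u => M2 u p q)).
  rewrite (sum_pair (I:=sperm D) (J:=sperm E)) /M2 /=.
  under eq_bigr => w _ do rewrite -mulr_sumr.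
  rewrite -mulr_suml [X in X * _](congr1 (fun f => f p.1 q.1) MA1).
  rewrite [X in _ * X](congr1 (fun f => f p.2 q.2) MB1) /mid -natrM mulnb.
  by case: p q => ? ? [].
have hH2 : locc_fam (fun (u : sperm2 D E) X => idt (K:=unit) (fun Y (_ _ : unit) => mtr (mmul Y (MB u.2)))
    (tid (K:=XB) (fun Y (_ _ : unit) => mtr (mmul Y (MA u.1))) X)).
  exact: (locc_fam_local2 (povm_instrument MAp MA1) (povm_instrument MBp MB1)).
have lM : locc_meas M.
  apply/locc_measP; split => //; eexists; split.
    exact: (locc_fam_coarse (@enum_rank (sperm2 D E)) hH2).
  move=> i X; rewrite mtr_sum (big_pred1 (enum_val i)) => [|u]; last first.
    by rewrite /= -(inj_eq enum_val_inj) enum_rankK.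
  by rewrite mtr_local2.
apply: ereal_sup_ubound; exists unit, unit, al, M; split => //; congr (_%:E).
set rhs := (RHS).
have -> : rhs = \sum_(i < #|sperm2 D E|) #|sperm2 D E|%:R^-1 *
   complex.Re (mtr (mmul (strat al Phi (trho rho i)) (M i))) by [].
suff key u : mtr (mmul (strat al Phi (tw u rho)) (M2 u)) = (tconst R D E)%:C%C * cpair rho Phi.
  rewrite (eq_bigr (fun=> #|sperm2 D E|%:R^-1 * (tconst R D E * complex.Re (cpair rho Phi)))).
    rewrite sum_cst card_ord mulrA mulfV ?mul1r //.
    by rewrite pnatr_eq0 -lt0n card_sperm2_gt0.
  by move=> i _; rewrite /trho /M key Re_rM.
(* Regroups outputs and references by party, as the measurement sees them, with the [unit] ancillas
   inserted. *)
pose h (a : (D * E) * (D * E)) : XA * XB := (((tt, a.1.1), a.2.1), ((a.2.2, a.1.2), tt)).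
have hbij : bijective h.
  by exists (fun p => ((p.1.1.2, p.2.1.2), (p.1.2, p.2.1.1))) => [[[? ?] [? ?]]|[[[[] ?] ?] [[? ?] []]]].
have sE p q : strat al Phi (tw u rho) (h p) (h q) = tw u (tid (K:=(D * E)%type) Phi rho) p q.
  rewrite -tid_tw //; case: p q => [[x x'] [s s']] [[y y'] [t t']].
  rewrite /strat /relabel /tid /idt /al /relabel /=.
  by congr (Phi _ _ _); apply: mx_ext => -[? ?] [? ?].
have vE p : v u (h p) = sg2 R u p.2 * (p.1 == pm2 u p.2)%:R.
  rewrite /v /h /bellv /sg2 /pm2 /=; case: p => [[x x'] [s s']] /=.
  by rewrite xpair_eqE -mulnb natrM; ring.
rewrite /mtr /mmul (reindex _ (onW_bij _ hbij)) /=.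
transitivity ((tconst R D E)%:C%C * \sum_s \sum_t tid (K:=(D * E)%type) Phi rho
   (pm2 u s, pm2 u s) (pm2 u t, pm2 u t)); last first.
  congr (_ * _); rewrite /cpair [RHS](reindex _ (onW_bij _ (pm2_bij u))).
  by apply: eq_bigr => s _; rewrite [RHS](reindex _ (onW_bij _ (pm2_bij u))).
rewrite sum_pair exchange_big mulr_sumr; apply: eq_bigr => s _ /=.
rewrite mulr_sumr.
transitivity (\sum_x (x == pm2 u s)%:R * \sum_t (tconst R D E)%:C%C *
   tid (K:=(D * E)%type) Phi rho (x, pm2 u s) (pm2 u t, pm2 u t)); last by rewrite sum_delta.
apply: eq_bigr => x _; rewrite (reindex _ (onW_bij _ hbij)) /= sum_pair exchange_big mulr_sumr.
apply: eq_bigr => t _ /=.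
transitivity (\sum_y (y == pm2 u t)%:R * ((x == pm2 u s)%:R * ((tconst R D E)%:C%C *
   tid (K:=(D * E)%type) Phi rho (x, pm2 u s) (y, pm2 u t)))); last by rewrite sum_delta.
apply: eq_bigr => y _; rewrite sE M2E !vE /tw /=.
(* The signs from [tw] and from the Bell vectors meet in pairs and square to 1. *)
transitivity ((sg2 R u s * sg2 R u s) * (sg2 R u t * sg2 R u t) *
   ((y == pm2 u t)%:R * ((x == pm2 u s)%:R * ((tconst R D E)%:C%C *
   tid (K:=(D * E)%type) Phi rho (x, pm2 u s) (y, pm2 u t))))); first by ring.
by rewrite !sg2K !mul1r.
Qed.

(** Adjoins a normalized maximally entangled pair on [D]: one half on the outer side, where [anc]
    leaves it untouched, the other next to the system, in the place of the reference register. *)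
Definition prep D I : Lmap R I (D * (I * D)) := fun X p q =>
  #|D|%:R^-1 * ((p.1 == p.2.2)%:R * X p.2.1 q.2.1 * (q.1 == q.2.2)%:R).

Lemma channel_prep D I (d0 : D) : channel (@prep D I).
Proof.
split.
- by move=> a X Y; apply: mx_ext => p q; rewrite /prep; ring.
- move=> K X hX; have := psdZ (_ : 0 <= #|D|%:R^-1) (psd_scale_diag
    (fun p : K * (D * (I * D)) => (p.2.1 == p.2.2.2)%:R)
    (psd_relabel (fun p : K * (D * (I * D)) => (p.1, p.2.2.1)) hX)).
  rewrite invr_ge0 ler0n => /(_ isT); congr psd.
  by apply: mx_ext => p q; rewrite /prep /idt /relabel conj_nat.
- move=> X; rewrite /mtr sum_pair /prep /=.
  transitivity (\sum_(d : D) #|D|%:R^-1 * mtr X).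
    apply: eq_bigr => d _; rewrite -mulr_sumr sum_pair; congr (_ * _).
    apply: eq_bigr => i _ /=; under eq_bigr do rewrite -mulrA.
    by rewrite sum_deltaV eqxx mulr1.
  by rewrite sum_cst mulrA mulfV ?mul1r // pnatr_eq0 -lt0n; apply/card_gt0P; exists d0.
Qed.

(** $wXw^\dagger$, the inverse of the conjugation in [tw], after identifying the system with [D]
    along [f]. *)
Definition corr D (w : sperm D) I (f : D -> I) : Lmap R I D := fun X r q =>
  sg R w ((w.2)^-1 r)%g * X (f ((w.2)^-1 r)%g) (f ((w.2)^-1 q)%g) * sg R w ((w.2)^-1 q)%g.

Lemma channel_corr D (w : sperm D) I (f : D -> I) : bijective f -> channel (corr w f).
Proof.
move=> hf; have hb : bijective (fun r => f ((w.2)^-1 r)%g).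
  by apply: (bij_comp hf); exists (w.2) => r; rewrite ?permK ?permKV.
split.
- by move=> a X Y; apply: mx_ext => p q; rewrite /corr; ring.
- move=> K X hX; have := psd_scale_diag (fun p : K * D => sg R w ((w.2)^-1 p.2)%g)
    (psd_relabel (fun p : K * D => (p.1, f ((w.2)^-1 p.2)%g)) hX).
  by congr psd; apply: mx_ext => p q; rewrite sg_conj.
- move=> X; rewrite /mtr [RHS](reindex _ (onW_bij _ hb)); apply: eq_bigr => r _.
  by rewrite /corr mulrAC sgK mul1r.
Qed.

(** Teleportation: the measurement receives halves of entangled pairs in place of $R_1$, and the
    other halves, corrected according to the announced outcome, become the output. Pairing the
    resulting map with $\rho$ reassembles the success probability. *)
Lemma p_locc_twirl_le UA UB A0 B0 A1 B1 D0 E0 D E (Phi : Lmap R (A0 * B0) (A1 * B1))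
    (rho : mx R ((D0 * E0) * (D * E)) ((D0 * E0) * (D * E)))
    (al : Lmap R (D0 * E0) ((UA * A0) * (B0 * UB)))
    (M : 'I_#|sperm2 D E| -> mx R (((UA * A1) * D) * ((E * B1) * UB)) (((UA * A1) * D) * ((E * B1) * UB)))
    (d0 : D) (e0 : E) : lin_map Phi -> locc_channel al -> locc_meas M ->
  exists Psi, locc_super_image Phi Psi /\
    complex.Re (stval (@tlam R (sperm2 D E)) (trho rho) al M Phi) =
    tconst R D E * complex.Re (cpair rho Psi).
Proof.
move=> l hal /locc_measP[_ [H [hH HE]]]; have [lal _ _] := locc_channel_channel hal.
pose prA := @prep D (UA * A1)%type.
pose rB (p : ((E * B1) * UB) * E) : E * ((B1 * UB) * E) := (p.2, ((p.1.1.2, p.1.2), p.1.1.1)).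
pose prB X := relabel rB (@prep E (B1 * UB)%type X).
have hprA : channel prA by exact: channel_prep.
have hprB : channel prB.
  apply: (channel_comp (channel_prep _ e0)); apply: channel_relabel.
  by exists (fun p => (((p.2.2, p.2.1.1), p.2.1.2), p.1)) => [[[[? ?] ?] ?]|[? [[? ?] ?]]].
pose pr X := idt (K:=(D * ((UA * A1) * D))%type) prB (tid (K:=(B1 * UB)%type) prA X).
have hpr : locc_channel pr by exact: (locc_channel_comp (locc_localA _ hprA) (locc_localB _ hprB)).
pose cA (u : sperm2 D E) := corr u.1 (fun d : D => (d, tt)).
pose cB (u : sperm2 D E) := corr u.2 (fun e : E => (tt, e)).
pose post X r q := \sum_i idt (K:=D) (cB (enum_val i)) (tid (K:=(unit * E)%type) (cA (enum_val i))
   (anc D E (H i) (pr X))) r q.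
have hpost : locc_channel post.
  have h1 := locc_fam_after hpr (locc_fam_anc D E hH).
  apply: (locc_fam_then h1 (K:=fun i Y => idt (K:=D) (cB (enum_val i))
    (tid (K:=(unit * E)%type) (cA (enum_val i)) Y))) => i.
  apply: locc_channel_comp; [apply: locc_localA | apply: locc_localB]; apply: channel_corr.
    by exists fst => // -[? []].
  by exists snd => // -[[] ?].
(* Its inverse is the joint normalization of the two entangled pairs; compared with the uniform
   weight $1/|W|$ of the ensemble it produces $c$. *)
pose n : C := #|{: D * E}|%:R.
pose sx (x : ((UA * A1) * D) * ((E * B1) * UB)) : D * E := (x.1.2, x.2.1.1).
pose zx (x : ((UA * A1) * D) * ((E * B1) * UB)) : (UA * A1) * (B1 * UB) := (x.1.1, (x.2.1.2, x.2.2)).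
have postE X r q : post X r q = \sum_(i < #|sperm2 D E|) let u := enum_val i in
    sg2 R u (ipm2 u r) * sg2 R u (ipm2 u q) * mtr (mmul (fun x y => n^-1 *
      ((ipm2 u r == sx x)%:R * X (zx x) (zx y) * (ipm2 u q == sx y)%:R)) (M i)).
  apply: eq_bigr => i _; set u := enum_val i.
  have HiE W : H i W (tt, tt) (tt, tt) = mtr (mmul W (M i)) by rewrite HE /mtr sum_pair !sum_unit.
  transitivity (sg2 R u (ipm2 u r) * sg2 R u (ipm2 u q) * H i (fun x y => pr X
     (((ipm2 u r).1, x.1), (x.2, (ipm2 u r).2)) (((ipm2 u q).1, y.1), (y.2, (ipm2 u q).2))) (tt, tt) (tt, tt)).
    by rewrite /idt /tid /cA /cB /corr /anc /sg2 /=; ring.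
  rewrite HiE; congr (_ * mtr (mmul _ _)).
  apply: mx_ext => x y; rewrite /pr /idt /tid /prB /prA /relabel /rB /prep /= !xpair_eqE -!mulnb !natrM.
  by rewrite /n card_prod natrM invfM; ring.
exists (super_apply al post Phi); split; first by exists UA, UB, al, post.
pose G X := idt (K:=(UA * UB)%type) Phi (relabel (fun q : (UA * UB) * (A0 * B0) =>
                     ((q.1.1, q.2.1), (q.2.2, q.1.2))) (al X)).
have lG : lin_map G.
  move=> a X Y; rewrite /G lal; apply: mx_ext => p q; rewrite /idt /relabel.
  by rewrite (l a (fun i i' => al X ((p.1.1, i.1), (i.2, p.1.2)) ((q.1.1, i'.1), (i'.2, q.1.2)))).
pose Y := tid (K:=(D * E)%type) G rho.
pose rel (p : (UA * A1) * (B1 * UB)) : (UA * UB) * (A1 * B1) := ((p.1.1, p.2.2), (p.1.2, p.2.1)).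
have key : cpair rho (super_apply al post Phi) = n^-1 * \sum_i mtr (mmul (strat al Phi (trho rho i)) (M i)).
  have sE i x y : strat al Phi (trho rho i) x y = tw (enum_val i) Y (rel (zx x), sx x) (rel (zx y), sx y).
    by rewrite /Y -tid_tw.
  rewrite mulr_sumr /cpair.
  transitivity (\sum_r \sum_q \sum_(i < #|sperm2 D E|) let u := enum_val i in
    sg2 R u (ipm2 u r) * sg2 R u (ipm2 u q) * mtr (mmul (fun x y => n^-1 *
      ((ipm2 u r == sx x)%:R * Y (rel (zx x), r) (rel (zx y), q) * (ipm2 u q == sx y)%:R)) (M i))).
    by apply: eq_bigr => r _; apply: eq_bigr => q _; rewrite /super_apply postE.
  under eq_bigr => r _ do rewrite exchange_big /=.
  rewrite exchange_big; apply: eq_bigr => i _ /=; set u := enum_val i.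
  rewrite (reindex _ (onW_bij _ (pm2_bij u))).
  transitivity (\sum_r \sum_q \sum_x \sum_y (r == sx x)%:R * ((q == sx y)%:R *
     (n^-1 * (sg2 R u r * Y (rel (zx x), pm2 u r) (rel (zx y), pm2 u q) * sg2 R u q) * M i y x))).
    apply: eq_bigr => r _; rewrite (reindex _ (onW_bij _ (pm2_bij u))); apply: eq_bigr => q _.
    rewrite !pm2K /mtr /mmul mulr_sumr; apply: eq_bigr => x _; rewrite mulr_sumr.
    by apply: eq_bigr => y _; ring.
  under eq_bigr => r _ do rewrite exchange_big /=.
  rewrite exchange_big /= /mtr mulr_sumr; apply: eq_bigr => x _.
  under eq_bigr => r _ do rewrite exchange_big /=.
  rewrite exchange_big /= /mmul mulr_sumr; apply: eq_bigr => y _.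
  under eq_bigr => r _ do rewrite -mulr_sumr.
  by rewrite sum_delta sum_delta sE [RHS]mulrA.
have n0 : (#|{: D * E}|%:R : R) != 0 by rewrite pnatr_eq0 -lt0n; apply/card_gt0P; exists (d0, e0).
rewrite key (_ : n^-1 = (#|{: D * E}|%:R^-1 : R)%:C%C); last by rewrite fmorphV rmorph_nat.
rewrite Re_rM Re_stval /tconst /tlam -mulr_sumr Re_sum.
by rewrite [RHS]mulrA [X in _ = X * _]mulrAC mulfV // mul1r.
Qed.

End TwirlStrategies.

(** * The converse implications *)

Section Converse.
Variable R : realType.
Implicit Types (A B D E : finType).

Lemma le_ereal_sup_witness (S : set (\bar R)) (x c eta : R) :
  (x%:E <= ereal_sup S + c%:E)%E -> 0 < eta ->
  exists2 y, S y & ((x - c - eta)%:E < y)%E.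
Proof.
rewrite -leeBlDr // -EFinB => h eta0; apply: ereal_sup_gt.
by apply: lt_le_trans h; rewrite lte_fin ltrBlDr ltrDl.
Qed.

(** [Phi2] is an image of itself, so its own pairing with $\rho$ lies below the left-hand
    supremum. *)
Lemma sup_pair_delta A0 B0 A1 B1 D0 E0 D1 E1
    (Phi1 : Lmap R (A0 * B0) (A1 * B1)) (Phi2 : Lmap R (D0 * E0) (D1 * E1))
    (eps : R) (a0 : D0) (b0 : E0) (a1 : D1) (b1 : E1) :
  channel Phi1 -> channel Phi2 -> 0 <= eps ->
  (forall rho : mx R ((D0 * E0) * (D1 * E1)) ((D0 * E0) * (D1 * E1)), state rho ->
     (sup_pair rho Phi2 <= sup_pair rho Phi1 + (eps / 2)%:E * cond_dnorm rho)%E) ->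
  (delta_locc Phi1 Phi2 <= eps%:E)%E.
Proof.
move=> c1 c2 eps0 hyp; apply: (dnorm_le_delta a0 b0 a1 b1) => // rho t eta hrho ht eta0.
have hsE g : channel g -> hs_pair rho g = complex.Re (cpair rho g).
  by move=> hg; rewrite hs_pairE //; exact: channel_lcp.
have h2 : ((complex.Re (cpair rho Phi2))%:E <= sup_pair rho Phi2)%E.
  by apply: ereal_sup_ubound; exists Phi2; [exact: super_refl | rewrite hsE].
have hc : (cond_dnorm rho <= t%:E)%E.
  by apply: ge_ereal_sup => _ [g hg <-]; rewrite lee_fin hsE //; exact: ht.
have hh : ((complex.Re (cpair rho Phi2))%:E <= sup_pair rho Phi1 + (eps / 2 * t)%:E)%E.
  apply: le_trans h2 _; apply: le_trans (hyp _ hrho) _; rewrite (EFinM (eps / 2) t).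
  by apply: leeD => //; apply: lee_wpmul2l => //; rewrite lee_fin divr_ge0.
have [_ [Psi hPsi <-]] := le_ereal_sup_witness hh eta0.
rewrite lte_fin hsE; last exact: super_image_channel hPsi.
by move=> h; exists Psi; split => //; lra.
Qed.

(** On the twirled ensemble of $\rho$ every term carries the factor $c>0$; the slack is taken as
    $c\eta$ so that $c$ cancels throughout. *)
Lemma p_locc_delta A0 B0 A1 B1 D0 E0 D1 E1
    (Phi1 : Lmap R (A0 * B0) (A1 * B1)) (Phi2 : Lmap R (D0 * E0) (D1 * E1))
    (eps : R) (a0 : D0) (b0 : E0) (a1 : D1) (b1 : E1) :
  channel Phi1 -> channel Phi2 -> 0 <= eps ->
  (forall k (lam : 'I_k -> R)
     (rho : 'I_k -> mx R ((D0 * E0) * (D1 * E1)) ((D0 * E0) * (D1 * E1))), ensemble lam rho ->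
     (p_locc Phi2 lam rho <= p_locc Phi1 lam rho + (eps / 2)%:E * psucc lam rho)%E) ->
  (delta_locc Phi1 Phi2 <= eps%:E)%E.
Proof.
move=> c1 c2 eps0 hyp; apply: (dnorm_le_delta a0 b0 a1 b1) => // rho t eta hrho ht eta0.
pose tc := tconst R D1 E1.
have tc0 : 0 < tc.
  rewrite divr_gt0 // ltr0n ?card_sperm2_gt0 //; by apply/card_gt0P; exists (a1, b1).
have := hyp _ _ _ (twirl_ensemble hrho).
have h2 := p_locc_twirl_ge rho c2; have hs := psucc_twirl (a1, b1) hrho ht.
move=> h3; have hh : ((tc * complex.Re (cpair rho Phi2))%:E <=
    p_locc Phi1 (@tlam R (sperm2 D1 E1)) (trho rho) + (eps / 2 * (tc * t))%:E)%E.
  apply: le_trans h2 _; apply: le_trans h3 _; rewrite [X in (_ <= _ + X)%E]EFinM.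
  by apply: leeD => //; apply: lee_wpmul2l => //; rewrite lee_fin divr_ge0.
have [_ [UA [UB [al [M [hal hM ->]]]]]] := le_ereal_sup_witness hh (mulr_gt0 tc0 eta0).
rewrite lte_fin; set v := (X in _ < X -> _).
have -> : v = complex.Re (stval (@tlam R (sperm2 D1 E1)) (trho rho) al M Phi1) by rewrite Re_stval.
have [l1 _ _] := c1.
have [Psi [hPsi ->]] := p_locc_twirl_le rho a1 b1 l1 hal hM.
move=> h; exists Psi; split => //; rewrite -/tc in h.
rewrite -(ler_pM2l tc0); move: h; lra.
Qed.

End Converse.

Theorem theorem7 (R : realType) (A0 B0 A1 B1 A0' B0' A1' B1' : finType)
  (hA0 : (0 < #|A0|)%N) (hB0 : (0 < #|B0|)%N) (hA1 : (0 < #|A1|)%N) (hB1 : (0 < #|B1|)%N)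
  (hA0' : (0 < #|A0'|)%N) (hB0' : (0 < #|B0'|)%N) (hA1' : (0 < #|A1'|)%N) (hB1' : (0 < #|B1'|)%N)
  (Phi1 : Lmap R (A0 * B0) (A1 * B1)) (Phi2 : Lmap R (A0' * B0') (A1' * B1'))
  (eps : R) :
  channel Phi1 -> channel Phi2 -> 0 <= eps ->
  let i := (delta_locc Phi1 Phi2 <= eps%:E)%E in
  let ii_for := fun (RA0 RB0 RA1 RB1 : finType) =>
    forall rho : mx R ((RA0 * RB0) * (RA1 * RB1)) ((RA0 * RB0) * (RA1 * RB1)),
      state rho ->
      (sup_pair rho Phi2 <= sup_pair rho Phi1 + (eps / 2)%:E * cond_dnorm rho)%E in
  let iii_for := fun (RA0 RB0 RA1 RB1 : finType) =>
    forall (k : nat) (lam : 'I_k -> R)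
           (rho : 'I_k -> mx R ((RA0 * RB0) * (RA1 * RB1)) ((RA0 * RB0) * (RA1 * RB1))),
      ensemble lam rho ->
      (p_locc Phi2 lam rho <= p_locc Phi1 lam rho + (eps / 2)%:E * psucc lam rho)%E in
  [/\ (i <-> forall RA0 RB0 RA1 RB1 : finType, ii_for RA0 RB0 RA1 RB1),
      (i <-> forall RA0 RB0 RA1 RB1 : finType, iii_for RA0 RB0 RA1 RB1),
      (i <-> ii_for A0' B0' A1' B1')
    & (i <-> iii_for A0' B0' A1' B1')].
Proof.
move=> c1 c2 eps0 /=.
have [a0 _] := card_gt0P hA0'; have [b0 _] := card_gt0P hB0'.
have [a1 _] := card_gt0P hA1'; have [b1 _] := card_gt0P hB1'.
split; split=> h.
- by move=> RA0 RB0 RA1 RB1 rho; exact: delta_sup_pair.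
- by apply: (sup_pair_delta a0 b0 a1 b1) => // rho; exact: h.
- by move=> RA0 RB0 RA1 RB1 k lam rho; exact: delta_p_locc.
- by apply: (p_locc_delta a0 b0 a1 b1) => // k lam rho; exact: h.
- by move=> rho; exact: delta_sup_pair.
- exact: (sup_pair_delta a0 b0 a1 b1).
- by move=> k lam rho; exact: delta_p_locc.
- exact: (p_locc_delta a0 b0 a1 b1).
Qed.
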